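(* Let $\Omega\subset\mathbb{R}^N$ be a bounded open connected set and $h\in C(\Omega)$ with $h(\Omega)\subset\mathcal{I}_k:=\big((N-2k)\frac{\pi}{2},(N-2(k-1))\frac{\pi}{2}\big)$ for some fixed $k\in\{1,\dots,N\}$. Let $G(A):=\sum_{i=1}^N\arctan(\lambda_i(A))$ and $\Theta(x):=\{(r,A)\in\mathbb{R}\times\mathcal{S}(N):G(A)\ge h(x)\}$. Then $\Theta$ is a Hausdorff continuous proper elliptic map and $\partial\Theta(x)\subset\{(r,A):G(A)=h(x)\}$ for every $x\in\Omega$. Moreover, if $u\in\mathrm{USC}(\overline\Omega)$ restricts to a viscosity subsolution and $v\in\mathrm{LSC}(\overline\Omega)$ restricts to a viscosity supersolution of $G(D^2u(x))=h(x)$ in $\Omega$, then $u\le v$ on $\partial\Omega$ implies $u\le v$ in $\Omega$.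
   Context: $\mathcal{S}(N)$: real symmetric $N\times N$ matrices with usual partial order; $\lambda_1(A)\le\dots\le\lambda_N(A)$ eigenvalues. $\mathcal{Q}:=\{(s,P): s\le0,\ P\ge0\}$. A proper elliptic map assigns to each $x\in\Omega$ a closed, nonempty set $\subsetneq\mathbb{R}\times\mathcal{S}(N)$ invariant under adding elements of $\mathcal Q$. Hausdorff continuity: with norm $\|(r,A)\|=\max\{|r|,\max_i|\lambda_i(A)|\}$ and the induced Hausdorff distance $d_{\mathcal H}$ (possibly $+\infty$), for all $x\in\Omega,\eta>0$ there is $\delta>0$ with $d_{\mathcal H}(\Theta(x),\Theta(y))<\eta$ for $y\in\Omega$, $|x-y|<\delta$. $J^+_{x_0}u:=\{(\varphi(x_0),D^2\varphi(x_0)):\varphi$ is $C^2$ near $x_0$, $u\le\varphi$ near $x_0$, $u(x_0)=\varphi(x_0)\}$, $J^-_{x_0}u$ likewise with $u\ge\varphi$. $u\in\mathrm{USC}(\Omega)$ is a viscosity subsolution if $G(A)\ge h(x_0)$ for all $x_0\in\Omega$, $(r,A)\in J^+_{x_0}u$; $v\in\mathrm{LSC}(\Omega)$ is a viscosity supersolution if $G(A)\le h(x_0)$ for all $x_0\in\Omega$, $(r,A)\in J^-_{x_0}v$. *)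

(* Defs.v *)
From HB Require Import structures.
From mathcomp Require Import all_boot all_order all_algebra.
From mathcomp Require Import all_classical all_reals all_analysis.
Set Implicit Arguments. Unset Strict Implicit. Unset Printing Implicit Defensive.
Import Order.TTheory GRing.Theory Num.Theory.
Import numFieldNormedType.Exports.
Local Open Scope classical_set_scope.
Local Open Scope ring_scope.

Section Defs.
Variables (R : realType) (N : nat).

Definition symmetric (A : 'M[R]_N) : Prop := A^T = A.

Definition psd (P : 'M[R]_N) : Prop :=
  symmetric P /\ forall x : 'cV[R]_N, 0 <= (x^T *m P *m x) 0 0.

(* the increasingly sorted list of eigenvalues, counted with multiplicity
   (for symmetric A the characteristic polynomial splits over R) *)
Definition is_eigseq (A : 'M[R]_N) (s : seq R) : Prop :=
  [/\ size s = N, sorted <=%R s &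
      char_poly A = \prod_(x <- s) ('X - x%:P)].

Definition eigseq (A : 'M[R]_N) : seq R := xget [::] (is_eigseq A).

(* lambda_i(A), i = 0, ..., N-1 (i.e. lambda_1 <= ... <= lambda_N) *)
Definition eig (A : 'M[R]_N) (i : 'I_N) : R := nth 0 (eigseq A) i.

Definition Gop (A : 'M[R]_N) : R := \sum_(i < N) atan (eig A i).

Definition specnorm (A : 'M[R]_N) : R := \big[Num.max/0]_(i < N) `|eig A i|.

Definition pnorm (p : R * 'M[R]_N) : R := Num.max `|p.1| (specnorm p.2).

Definition pdist (p q : R * 'M[R]_N) : R := pnorm (p.1 - q.1, p.2 - q.2).

Definition SN : set (R * 'M[R]_N) := [set p | symmetric p.2].

Definition exc (X Y : set (R * 'M[R]_N)) : \bar R :=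
  ereal_sup [set ereal_inf [set (pdist p q)%:E | q in Y] | p in X].

Definition hausdorff_dist (X Y : set (R * 'M[R]_N)) : \bar R :=
  maxe (exc X Y) (exc Y X).

Definition closedS (X : set (R * 'M[R]_N)) : Prop :=
  X `<=` SN /\
  forall p, SN p -> (forall e : R, 0 < e -> exists2 q, X q & pdist q p < e) -> X p.

Definition boundaryS (X : set (R * 'M[R]_N)) : set (R * 'M[R]_N) :=
  [set p | SN p /\ forall e : R, 0 < e ->
     (exists2 q, X q & pdist q p < e) /\
     (exists2 q, (SN `\` X) q & pdist q p < e)].

Definition Qcone : set (R * 'M[R]_N) := [set p | p.1 <= 0 /\ psd p.2].

Definition proper_elliptic_map (Om : set 'rV[R]_N)
    (Th : 'rV[R]_N -> set (R * 'M[R]_N)) : Prop :=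
  forall x, Om x ->
    [/\ closedS (Th x), Th x !=set0, Th x <> SN &
        forall p q, Th x p -> Qcone q -> Th x (p.1 + q.1, p.2 + q.2)].

Definition enorm (x : 'rV[R]_N) : R := Num.sqrt (\sum_(i < N) x 0 i ^+ 2).

Definition hausdorff_continuous (Om : set 'rV[R]_N)
    (Th : 'rV[R]_N -> set (R * 'M[R]_N)) : Prop :=
  forall x, Om x -> forall eta : R, 0 < eta -> exists2 delta : R, 0 < delta &
    forall y, Om y -> enorm (x - y) < delta ->
      (hausdorff_dist (Th x) (Th y) < eta%:E)%E.

Definition evec (i : 'I_N) : 'rV[R]_N := delta_mx 0 i.

Definition pd (i : 'I_N) (f : 'rV[R]_N -> R) : 'rV[R]_N -> R :=
  fun x => 'D_(evec i) f x.

Definition C2near (phi : 'rV[R]_N -> R) (x0 : 'rV[R]_N) : Prop :=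
  exists2 e : R, 0 < e & forall x, enorm (x - x0) < e ->
    [/\ {for x, continuous phi},
        forall i, derivable phi x (evec i) /\ {for x, continuous (pd i phi)} &
        forall i j, derivable (pd j phi) x (evec i) /\
                    {for x, continuous (pd i (pd j phi))}].

Definition hessian (phi : 'rV[R]_N -> R) (x0 : 'rV[R]_N) : 'M[R]_N :=
  \matrix_(i, j) pd i (pd j phi) x0.

Definition Jplus (u : 'rV[R]_N -> R) (x0 : 'rV[R]_N) : set (R * 'M[R]_N) :=
  [set p | exists phi, [/\ C2near phi x0,
     (exists2 e : R, 0 < e & forall x, enorm (x - x0) < e -> u x <= phi x),
     u x0 = phi x0 & p = (phi x0, hessian phi x0)]].

Definition Jminus (u : 'rV[R]_N -> R) (x0 : 'rV[R]_N) : set (R * 'M[R]_N) :=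
  [set p | exists phi, [/\ C2near phi x0,
     (exists2 e : R, 0 < e & forall x, enorm (x - x0) < e -> phi x <= u x),
     u x0 = phi x0 & p = (phi x0, hessian phi x0)]].

Definition usc_on (D : set 'rV[R]_N) (u : 'rV[R]_N -> R) : Prop :=
  forall x, D x -> forall eps : R, 0 < eps -> exists2 delta : R, 0 < delta &
    forall y, D y -> enorm (y - x) < delta -> u y < u x + eps.

Definition lsc_on (D : set 'rV[R]_N) (v : 'rV[R]_N -> R) : Prop :=
  forall x, D x -> forall eps : R, 0 < eps -> exists2 delta : R, 0 < delta &
    forall y, D y -> enorm (y - x) < delta -> v x - eps < v y.

(* (Om is open, so jets of u|_Om at x0 in Om only involve values in Om) *)
Definition visc_sub (Om : set 'rV[R]_N) (h u : 'rV[R]_N -> R) : Prop :=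
  usc_on Om u /\
  forall x0, Om x0 -> forall p, Jplus u x0 p -> h x0 <= Gop p.2.

Definition visc_super (Om : set 'rV[R]_N) (h v : 'rV[R]_N -> R) : Prop :=
  lsc_on Om v /\
  forall x0, Om x0 -> forall p, Jminus v x0 p -> Gop p.2 <= h x0.

Definition ThetaG (h : 'rV[R]_N -> R) (x : 'rV[R]_N) : set (R * 'M[R]_N) :=
  [set p | symmetric p.2 /\ h x <= Gop p.2].

End Defs.

(* Main.v *)
Require Import Defs.
From HB Require Import structures.
From mathcomp Require Import all_boot all_order all_algebra fingroup perm.
From mathcomp Require Import all_classical all_reals all_analysis.
From mathcomp Require Import ring lra zify.
Set Implicit Arguments. Unset Strict Implicit. Unset Printing Implicit Defensive.
Import Order.TTheory GRing.Theory Num.Theory.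
Import numFieldNormedType.Exports.
Local Open Scope classical_set_scope.
Local Open Scope ring_scope.

(* Adding a small multiple of |x|^2 makes the subsolution strict: inside a phase interval
   some eigenvalue stays bounded, so G increases along the identity by a uniform amount;
   this also gives the Hausdorff continuity.  Near a positive interior maximum of u - v one
   doubles the variables with the penalty kappa/2 (|x - xi|^2 + |x - y|^2 + |y - eta|^2) and
   takes the Legendre transform in (x, y), a convex function psi on R^(2N).

   Alexandrov's and Jensen's theorems are replaced by a discrete argument.  The averages
   over lattice cubes of the second differences of psi are nonnegative and each is the mean
   of the averages over the subcubes.  Passing to a subcube as long as the sum of the square
   roots of the averages drops by theta stops at a cube all of whose subcubes have, by strict
   concavity of the square root, nearly the same averages; on it psi is within eps r^2 of a
   quadratic polynomial, r being the size of the cube.  By duality u and -v are bounded above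
   up to eps r^2, on balls of radius comparable to r, by paraboloids whose Hessians X and Y
   satisfy X + Y <= eps.  Sliding these paraboloids produces exact touching points of u and v
   that are close to each other, which contradicts strictness and the continuity of h. *)

Local Notation symmetric := Defs.symmetric.
Local Notation convex psi := (convex_function setT psi).

(** * Averages over lattice cubes *)

Section LatticeAverages.
Variables (R : realType) (n : nat).
Implicit Types (m l : nat) (phi d : 'rV[R]_n -> R) (j : 'I_n -> nat).

Definition natvec j : 'rV[R]_n := \row_k (j k)%:R.

Lemma natvecD j1 j2 :
  natvec (fun k => j1 k + j2 k)%N = natvec j1 + natvec j2.
Proof. by apply/rowP => k; rewrite !mxE natrD. Qed.

Lemma natvec_delta k : natvec (fun q => (q == k) : nat) = delta_mx 0 k.
Proof. by apply/rowP => q; rewrite !mxE eqxx. Qed.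

Definition in_cube m j := forall k, (j k < m)%N.

Definition lattice_sum m phi : R :=
  \sum_(f : {ffun 'I_n -> 'I_m}) phi (natvec (fun k => f k)).

Definition lattice_avg m phi : R := lattice_sum m phi / (m ^ n)%:R.

Lemma expn_gt0r m : (0 < m)%N -> 0 < (m ^ n)%:R :> R.
Proof. by move=> m0; rewrite ltr0n expn_gt0 m0. Qed.

Lemma lattice_sumE m phi : (0 < m)%N ->
  lattice_sum m phi = (m ^ n)%:R * lattice_avg m phi.
Proof. by move=> m0; rewrite mulrC divfK // gt_eqF // expn_gt0r. Qed.

Lemma eq_lattice_avg m phi phi' : phi =1 phi' -> lattice_avg m phi = lattice_avg m phi'.
Proof. by move=> /funext ->. Qed.

Lemma ler_lattice_avg m phi phi' :
  (forall j, in_cube m j -> phi (natvec j) <= phi' (natvec j)) ->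
  lattice_avg m phi <= lattice_avg m phi'.
Proof.
move=> le_phi; apply: ler_wpM2r; first by rewrite invr_ge0.
by apply: ler_sum => f _; apply: le_phi => k.
Qed.

Lemma lattice_avg_ge0 m phi : (forall o, 0 <= phi o) -> 0 <= lattice_avg m phi.
Proof. by move=> phi0; rewrite divr_ge0 //; apply: sumr_ge0. Qed.

Lemma lattice_avgD m phi phi' :
  lattice_avg m (fun o => phi o + phi' o) = lattice_avg m phi + lattice_avg m phi'.
Proof. by rewrite /lattice_avg /lattice_sum big_split mulrDl. Qed.

Lemma lattice_avgZ m a phi : lattice_avg m (fun o => a * phi o) = a * lattice_avg m phi.
Proof. by rewrite /lattice_avg /lattice_sum -mulr_sumr mulrA. Qed.

Lemma lattice_avg_cst m c : (0 < m)%N -> lattice_avg m (fun=> c) = c.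
Proof.
move=> m0; rewrite /lattice_avg /lattice_sum sumr_const card_ffun !card_ord.
by rewrite -[c *+ _]mulr_natr mulfK // gt_eqF // expn_gt0r.
Qed.

Lemma lattice_avg_sum (I : finType) m (F : I -> 'rV[R]_n -> R) :
  lattice_avg m (fun o => \sum_i F i o) = \sum_i lattice_avg m (F i).
Proof. by rewrite /lattice_avg /lattice_sum exchange_big mulr_suml. Qed.

Lemma le_lattice_sum m phi j : (forall o, 0 <= phi o) -> in_cube m j ->
  phi (natvec j) <= lattice_sum m phi.
Proof.
move=> phi0 jm; rewrite /lattice_sum (bigD1 [ffun k => Ordinal (jm k)]) //=.
have -> : natvec j = natvec (fun k => [ffun k => Ordinal (jm k)] k).
  by apply/rowP => k; rewrite !mxE ffunE.
by rewrite lerDl sumr_ge0.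
Qed.

Lemma lattice_sum_shift_le m1 m2 phi j : (forall o, 0 <= phi o) ->
  (forall k, j k + m1 <= m2)%N ->
  lattice_sum m1 (fun o => phi (natvec j + o)) <= lattice_sum m2 phi.
Proof.
move=> phi0 jm.
have lt_shift k (i : 'I_m1) : (j k + i < m2)%N by rewrite (leq_trans _ (jm k)) // ltn_add2l.
pose sh (f : {ffun 'I_n -> 'I_m1}) : {ffun 'I_n -> 'I_m2} := [ffun k => Ordinal (lt_shift k (f k))].
have sh_inj : injective sh.
  move=> f g /ffunP fg; apply/ffunP => k; apply/val_inj/(@addnI (j k)).
  by have /(congr1 val) := fg k; rewrite !ffunE.
rewrite /lattice_sum [leRHS](bigID (mem [set sh f | f : {ffun 'I_n -> 'I_m1}])) /=.
rewrite big_imset /=; last by move=> f g _ _ /sh_inj.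
rewrite ler_wpDr ?sumr_ge0 //; apply: ler_sum => f _; rewrite -natvecD.
by have -> : (fun k => j k + f k)%N = (fun k => sh f k : nat) by apply/funext => k; rewrite ffunE.
Qed.

Lemma lattice_avg_mul m l phi :
  lattice_avg (m * l) phi =
  lattice_avg m (fun o => lattice_avg l (fun o' => phi (l%:R *: o + o'))).
Proof.
have lt_glue (q : 'I_m) (r : 'I_l) : (q * l + r < m * l)%N.
  by have := ltn_ord q; have := ltn_ord r; nia.
pose glue (qr : {ffun 'I_n -> 'I_m} * {ffun 'I_n -> 'I_l}) :
    {ffun 'I_n -> 'I_(m * l)} := [ffun k => Ordinal (lt_glue (qr.1 k) (qr.2 k))].
have glue_inj : injective glue.
  move=> [q r] [q' r'] /ffunP E; have {}E k : (q k * l + r k = q' k * l + r' k)%N.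
    by have /(congr1 val) := E k; rewrite !ffunE.
  have qE k : q k = q' k.
    have l0 : (0 < l)%N := leq_ltn_trans (leq0n _) (ltn_ord (r k)).
    apply/val_inj; have := congr1 (divn^~ l) (E k).
    by rewrite /= !divnMDl // !divn_small // !addn0.
  congr pair; apply/ffunP => k; first exact: qE.
  by apply/val_inj/eqP; rewrite -(eqn_add2l (q k * l)) E qE.
have glue_bij : bijective glue.
  by apply: inj_card_bij => //; rewrite card_prod !card_ffun !card_ord expnMn.
rewrite /lattice_avg /lattice_sum -mulr_suml expnMn natrM invfM mulrA mulrAC.
congr (_ * _ * _); rewrite (reindex glue) /=; last exact: onW_bij.
rewrite pair_big /=; apply: eq_bigr => -[q r] _; congr phi.
by apply/rowP => k; rewrite !mxE ffunE natrD natrM mulrC.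
Qed.

Lemma lattice_avg_rev m phi :
  lattice_avg m phi = lattice_avg m (fun o => phi (const_mx m.-1%:R - o)).
Proof.
pose rev (f : {ffun 'I_n -> 'I_m}) : {ffun 'I_n -> 'I_m} := [ffun k => rev_ord (f k)].
have rev_inj : injective rev.
  move=> f g /ffunP fg; apply/ffunP => k; apply: rev_ord_inj.
  by have := fg k; rewrite !ffunE.
rewrite /lattice_avg /lattice_sum (reindex_inj rev_inj) /=; congr (_ / _).
apply: eq_bigr => f _; congr phi; apply/rowP => k; rewrite !mxE ffunE.
by rewrite -natrB; [congr _%:R|]; case: (f k) => i /=; lia.
Qed.

Lemma card_ffun_at (T T' : finType) (x : T) (y : T') :
  (#|[pred f : {ffun T -> T'} | f x == y]| * #|T'| = #|T'| ^ #|T|)%N.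
Proof.
pose F z := if z == x then pred1 y else predT.
rewrite (@eq_card _ _ (mem (family F))); last first.
  move=> f; rewrite !inE; apply/eqP/familyP => [fx z|/(_ x)]; rewrite /F.
    by case: eqP => [->|//]; rewrite inE /= fx.
  by rewrite eqxx inE => /eqP.
rewrite card_family foldrE big_image /= (bigD1 x) //= /F eqxx card1 mul1n.
rewrite (eq_bigr (fun=> #|T'|)) => [|z /negbTE -> //].
rewrite prod_nat_const cardC1 mulnC -expnS prednK //.
by apply/card_gt0P; exists x.
Qed.

(* Summation by parts on a cyclic lattice: only the last layer survives. *)
Lemma lattice_avg_diff_le m k (E : 'rV[R]_n -> R) (b : R) : (0 < m)%N ->
  (forall o, `|E o| <= b) ->
  `|lattice_avg m (fun o => E (o + delta_mx 0 k) - E o)| <= 2 * b / m%:R.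
Proof.
case: m => // m _ Eb.
pose rot (f : {ffun 'I_n -> 'I_m.+1}) : {ffun 'I_n -> 'I_m.+1} :=
  [ffun q => if q == k then ordS (f q) else f q].
have rot_inj : injective rot.
  move=> f g /ffunP fg; apply/ffunP => q; have := fg q; rewrite !ffunE.
  by case: eqP => // _; exact: (can_inj (@ordSK _)).
pose nv (f : {ffun 'I_n -> 'I_m.+1}) := natvec (fun q => f q).
have -> : lattice_avg m.+1 (fun o => E (o + delta_mx 0 k) - E o) =
    (\sum_f (E (nv f + delta_mx 0 k) - E (nv (rot f)))) / (m.+1 ^ n)%:R.
  rewrite /lattice_avg /lattice_sum !sumrB; congr ((_ - _) / _).
  exact: (reindex_inj rot_inj).
rewrite (bigID [pred f : {ffun 'I_n -> 'I_m.+1} | f k == ord_max]) /= [X in _ + X]big1.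
  rewrite addr0 normrM normfV normr_nat.
  rewrite ler_pdivrMr ?ltr0n ?expn_gt0 // mulrAC ler_pdivlMr //.
  have card := card_ffun_at k (@ord_max m); rewrite !card_ord in card.
  rewrite -card natrM mulrA ler_wpM2r // mulr_natr -sumr_const.
  apply: le_trans (ler_norm_sum _ _ _) _; apply: ler_sum => f _.
  by apply: (le_trans (ler_normB _ _)); rewrite mulr2n mulrDl mul1r lerD.
move=> f fk; rewrite (_ : nv f + _ = nv (rot f)) ?subrr //.
apply/rowP => q; rewrite !mxE ffunE eqxx /=; case: eqP => [->|_]; last by rewrite addr0.
rewrite /= natr1 modn_small //.
by have := ltn_ord (f k); move: fk; rewrite -val_eqE /=; lia.
Qed.

Lemma lattice_avg_sqrt_sqr m d c : (0 < m)%N -> (forall o, 0 <= d o) ->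
  lattice_avg m (fun o => (Num.sqrt (d o) - c) ^+ 2) =
  lattice_avg m d - 2 * c * lattice_avg m (fun o => Num.sqrt (d o)) + c ^+ 2.
Proof.
move=> m0 d0; rewrite -{1}(lattice_avg_cst (c ^+ 2) m0) -mulNr -lattice_avgZ -!lattice_avgD.
apply: eq_lattice_avg => o; rewrite -[X in _ = X + _ + _](sqr_sqrtr (d0 o)); ring.
Qed.

Lemma lattice_avg_sqrt_le m d : (0 < m)%N -> (forall o, 0 <= d o) ->
  lattice_avg m (fun o => Num.sqrt (d o)) <= Num.sqrt (lattice_avg m d).
Proof.
move=> m0 d0; set A := lattice_avg m _.
have A0 : 0 <= A by apply: lattice_avg_ge0 => o; exact: sqrtr_ge0.
rewrite -(ger0_norm A0) -sqrtr_sqr ler_wsqrtr //.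
have : 0 <= lattice_avg m (fun o => (Num.sqrt (d o) - A) ^+ 2).
  by apply: lattice_avg_ge0 => o; exact: sqr_ge0.
by rewrite lattice_avg_sqrt_sqr // -/A; nra.
Qed.

Lemma sqrt_deviation m d j : (0 < m)%N -> (forall o, 0 <= d o) -> in_cube m j ->
  (Num.sqrt (d (natvec j)) - Num.sqrt (lattice_avg m d)) ^+ 2 <=
  2 * Num.sqrt (lattice_avg m d) * (m ^ n)%:R *
    (Num.sqrt (lattice_avg m d) - lattice_avg m (fun o => Num.sqrt (d o))).
Proof.
move=> m0 d0 jm; set c := Num.sqrt (lattice_avg m d).
have c2 : c ^+ 2 = lattice_avg m d by rewrite sqr_sqrtr //; apply: lattice_avg_ge0.
apply: (le_trans (le_lattice_sum (phi := fun o => (Num.sqrt (d o) - c) ^+ 2) _ jm)).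
  by move=> o; exact: sqr_ge0.
by rewrite lattice_sumE // lattice_avg_sqrt_sqr // -c2; lra.
Qed.

End LatticeAverages.

Section CubeAverages.
Variables (R : realType) (n : nat).
Implicit Types (m l w : nat) (s : R) (g : 'rV[R]_n -> R) (x : 'rV[R]_n) (j : 'I_n -> nat).

Definition cube_avg s g l x : R := lattice_avg l (fun o => g (x + s *: o)).

Lemma cube_avg_mul s g m l x :
  cube_avg s g (m * l) x = lattice_avg m (fun o => cube_avg s g l (x + (s * l%:R) *: o)).
Proof.
rewrite /cube_avg lattice_avg_mul; apply: eq_lattice_avg => o.
by apply: eq_lattice_avg => o'; rewrite scalerDr scalerA addrA.
Qed.

Lemma cube_avg_ge0 s g l x : (forall y, 0 <= g y) -> 0 <= cube_avg s g l x.
Proof. by move=> g0; apply: lattice_avg_ge0. Qed.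

Lemma cube_avg_sub_le s g l1 l2 x j : (forall y, 0 <= g y) ->
  (0 < l1)%N -> (0 < l2)%N -> (forall k, j k + l1 <= l2)%N ->
  l1%:R ^+ n * cube_avg s g l1 (x + s *: natvec R j) <= l2%:R ^+ n * cube_avg s g l2 x.
Proof.
move=> g0 l10 l20 jl; rewrite -!natrX -!lattice_sumE //.
apply: le_trans (lattice_sum_shift_le (phi := fun o => g (x + s *: o)) (fun o => g0 _) jl).
by apply: ler_sum => f _; rewrite scalerDr addrA.
Qed.

Definition sum_sqrt_avg (I : finType) s (g : I -> 'rV[R]_n -> R) l x : R :=
  \sum_i Num.sqrt (cube_avg s (g i) l x).

Definition stable_cube (I : finType) s (g : I -> 'rV[R]_n -> R) m l (theta : R) x :=
  forall j, in_cube m j ->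
    sum_sqrt_avg s g (m * l) x - theta <= sum_sqrt_avg s g l (x + (s * l%:R) *: natvec R j).

Lemma sum_sqrt_avg_ge0 (I : finType) s (g : I -> 'rV[R]_n -> R) l x :
  0 <= sum_sqrt_avg s g l x.
Proof. by apply: sumr_ge0 => i _; exact: sqrtr_ge0. Qed.

Lemma sqrt_avg_le_sum (I : finType) s (g : I -> 'rV[R]_n -> R) l x i :
  Num.sqrt (cube_avg s (g i) l x) <= sum_sqrt_avg s g l x.
Proof.
by rewrite /sum_sqrt_avg (bigD1 i) //= lerDl; apply: sumr_ge0 => *; exact: sqrtr_ge0.
Qed.

(* As long as some subcube lowers [sum_sqrt_avg] by [theta], pass to it; there are fewer
   than [T] such steps. *)
Lemma exists_stable_cube (I : finType) s (theta : R) (g : I -> 'rV[R]_n -> R) m T x :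
  0 <= s -> 0 < theta -> (0 < m)%N ->
  sum_sqrt_avg s g (m ^ T) x < T%:R * theta ->
  exists t y, [/\ (t < T)%N,
    forall k, 0 <= (y - x) 0 k <= s * (m ^ T)%:R - s * (m ^ t.+1)%:R,
    sum_sqrt_avg s g (m ^ t.+1) y <= sum_sqrt_avg s g (m ^ T) x &
    stable_cube s g m (m ^ t) theta y].
Proof.
move=> s0 th0 m0; elim: T x => [|T IH] x.
  by rewrite mul0r ltNge sum_sqrt_avg_ge0.
move=> small; have [stable|/existsNP[j /not_implyP[jm /negP]]] :=
  pselect (stable_cube s g m (m ^ T) theta x).
  by exists T, x; split => // k; rewrite !mxE subrr lexx /= subrr.
rewrite -ltNge -expnS => drop.
have [|t [y [tT yx yle ystable]]] := IH (x + (s * (m ^ T)%:R) *: natvec R j).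
  by move: small; rewrite -natr1; lra.
exists t, y; split => //; first exact: leqW; last by apply: (le_trans yle); lra.
move=> k; have := yx k; rewrite !mxE.
have jk : (j k)%:R + 1 <= m%:R :> R by rewrite natr1 ler_nat.
have j0 : 0 <= (j k)%:R :> R by [].
have M0 : 0 <= s * (m ^ T)%:R by rewrite mulr_ge0.
rewrite (expnS m T) natrM; set M := (m ^ T)%:R in M0 *.
by move=> /andP[? ?]; apply/andP; split; nra.
Qed.

Lemma stable_cube_sqrt_close (I : finType) s (theta : R) (g : I -> 'rV[R]_n -> R) m l x i j :
  (forall i y, 0 <= g i y) -> (0 < m)%N -> stable_cube s g m l theta x -> in_cube m j ->
  (Num.sqrt (cube_avg s (g i) l (x + (s * l%:R) *: natvec R j))
    - Num.sqrt (cube_avg s (g i) (m * l) x)) ^+ 2 <=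
  2 * sum_sqrt_avg s g (m * l) x * (m ^ n)%:R * theta.
Proof.
move=> g0 m0 stable jm.
pose d i o := cube_avg s (g i) l (x + (s * l%:R) *: o).
have d0 i' o : 0 <= d i' o by apply: cube_avg_ge0.
have avgE i' : cube_avg s (g i') (m * l) x = lattice_avg m (d i') by rewrite cube_avg_mul.
pose defect i := Num.sqrt (lattice_avg m (d i)) - lattice_avg m (fun o => Num.sqrt (d i o)).
have defect0 i' : 0 <= defect i' by rewrite subr_ge0 lattice_avg_sqrt_le.
have defect_le : defect i <= theta.
  apply: (@le_trans _ _ (\sum_i defect i)).
    by rewrite (bigD1 i) //= lerDl sumr_ge0.
  rewrite sumrB; under eq_bigr do rewrite -avgE.
  rewrite -lattice_avg_sum -/(sum_sqrt_avg s g (m * l) x) lerBlDr -lerBlDl.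
  by rewrite -[leLHS](lattice_avg_cst n _ m0); exact: ler_lattice_avg.
rewrite avgE; apply: (le_trans (sqrt_deviation m0 (d0 i) jm)); rewrite -/(defect i).
apply: ler_pM => //; rewrite ?mulr_ge0 ?sqrtr_ge0 //.
by rewrite ler_wpM2r // ler_wpM2l // -avgE; exact: sqrt_avg_le_sum.
Qed.

Lemma cube_avg_blocks_itv s g m l v x (a b : R) j :
  (forall i, in_cube m i -> a <= cube_avg s g l (x + (s * l%:R) *: natvec R i) <= b) ->
  (0 < v)%N -> (forall k, j k + v <= m)%N ->
  a <= cube_avg s g (v * l) (x + (s * l%:R) *: natvec R j) <= b.
Proof.
move=> ab v0 jm; rewrite cube_avg_mul -{1}(lattice_avg_cst n a v0) -(lattice_avg_cst n b v0).
have {}ab i : in_cube v i -> a <= cube_avg s g l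
    (x + (s * l%:R) *: natvec R j + (s * l%:R) *: natvec R i) <= b.
  move=> iv; rewrite -addrA -scalerDr -natvecD; apply: ab => k.
  by have := jm k; have := iv k; lia.
by apply/andP; split; apply: ler_lattice_avg => i /ab /andP[].
Qed.

Lemma natvec_divn_modn l j :
  natvec R j = l%:R *: natvec R (fun k => j k %/ l)%N + natvec R (fun k => j k %% l)%N.
Proof. by apply/rowP => k; rewrite !mxE {1}(divn_eq (j k) l) natrD natrM mulrC. Qed.

Lemma ler_cube_avg_window s g m l w x (b : R) j :
  (forall y, 0 <= g y) -> (0 < l)%N -> (0 < w)%N ->
  (forall i, in_cube m i -> 0 <= cube_avg s g l (x + (s * l%:R) *: natvec R i) <= b) ->
  (forall k, j k + w.+1 * l <= m * l)%N ->
  cube_avg s g (w * l) (x + s *: natvec R j) <= (1 + w%:R^-1) ^+ n * b.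
Proof.
move=> g0 l0 w0 gb jm; pose q k := (j k %/ l)%N.
have w0r : (0 : R) < w%:R by rewrite ltr0n.
have wl0 : 0 < (w * l)%:R ^+ n :> R by rewrite exprn_gt0 // ltr0n muln_gt0 w0.
have qm k : (q k + w.+1 <= m)%N.
  rewrite -(leq_pmul2r l0) mulnDl; apply: leq_trans (jm k).
  by rewrite leq_add2r leq_divM.
have -> : x + s *: natvec R j =
    x + (s * l%:R) *: natvec R q + s *: natvec R (fun k => j k %% l)%N.
  by rewrite (natvec_divn_modn l) scalerDr scalerA addrA.
rewrite -(ler_pM2l wl0).
apply: (le_trans (cube_avg_sub_le (l2 := w.+1 * l) s _ g0 _ _ _)).
- by rewrite muln_gt0 w0.
- by rewrite muln_gt0.
- by move=> k; rewrite mulSn leq_add2r ltnW // ltn_mod.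
have /andP[_ /(ler_wpM2l (exprn_ge0 n (ler0n R (w.+1 * l))))] :=
  cube_avg_blocks_itv gb (ltn0Sn w) qm.
move/le_trans; apply; rewrite [leRHS]mulrA -exprMn.
rewrite (_ : _ * (1 + _) = (w.+1 * l)%:R) // !natrM -natr1; field.
by rewrite gt_eqF.
Qed.

Lemma ger_cube_avg_window s g m l w x (a b : R) j :
  (forall y, 0 <= g y) -> (0 < l)%N -> (1 < w)%N ->
  (forall i, in_cube m i -> a <= cube_avg s g l (x + (s * l%:R) *: natvec R i) <= b) ->
  (forall k, j k + w * l <= m * l)%N ->
  (1 - w%:R^-1) ^+ n * a <= cube_avg s g (w * l) (x + s *: natvec R j).
Proof.
move=> g0 l0 w1 ga jm; pose q k := (j k %/ l)%N; pose r k := (j k %% l)%N.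
have w0r : (0 : R) < w%:R by rewrite ltr0n ltnW.
have wl0 : 0 < (w * l)%:R ^+ n :> R by rewrite exprn_gt0 // ltr0n muln_gt0 ltnW.
have rl k : (r k <= l)%N by rewrite ltnW // ltn_mod.
have w10 : (0 < w.-1)%N by lia.
have qm k : ((q k).+1 + w.-1 <= m)%N.
  rewrite addSnnS prednK ?(ltnW w1) // -(leq_pmul2r l0) mulnDl; apply: leq_trans (jm k).
  by rewrite leq_add2r leq_divM.
have shiftE : x + s *: natvec R j + s *: natvec R (fun k => l - r k)%N =
    x + (s * l%:R) *: natvec R (fun k => (q k).+1).
  apply/rowP => k; rewrite (natvec_divn_modn l j) !mxE natrB // -natr1; ring.
rewrite -(ler_pM2l wl0).
apply: le_trans (cube_avg_sub_le (l1 := w.-1 * l) (j := fun k => (l - r k)%N) s _ g0 _ _ _).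
- have /andP[/(ler_wpM2l (exprn_ge0 n (ler0n R (w.-1 * l)))) + _] :=
    cube_avg_blocks_itv ga w10 qm.
  rewrite shiftE; apply: le_trans; rewrite [leLHS]mulrA -exprMn.
  rewrite (_ : _ * (1 - _) = (w.-1 * l)%:R) // !natrM -subn1 natrB ?(ltnW w1) //; field.
  by rewrite gt_eqF.
- by rewrite muln_gt0 w10.
- by rewrite muln_gt0 ltnW.
- by move=> k; rewrite -{2}(prednK (ltnW w1)) mulSn leq_add2r leq_subr.
Qed.

End CubeAverages.

(** * Quadratic forms and second differences *)

Section QuadraticForms.
Variables (R : realType) (n : nat).
Implicit Types (x y z v b : 'rV[R]_n) (H : 'M[R]_n) (k l : 'I_n) (a c : R).

Definition dot x y : R := \sum_k x 0 k * y 0 k.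
Definition bil H x y : R := dot (x *m H) y.
Definition quad c b H v : R := c + dot b v + 2^-1 * bil H v v.

Lemma dotC x y : dot x y = dot y x.
Proof. by apply: eq_bigr => k _; rewrite mulrC. Qed.

Lemma dotDl x y z : dot (x + y) z = dot x z + dot y z.
Proof. by rewrite -big_split; apply: eq_bigr => k _; rewrite mxE mulrDl. Qed.

Lemma dotZl a x z : dot (a *: x) z = a * dot x z.
Proof. by rewrite mulr_sumr; apply: eq_bigr => k _; rewrite mxE mulrA. Qed.

Lemma dotNl x z : dot (- x) z = - dot x z.
Proof. by rewrite -scaleN1r dotZl mulN1r. Qed.

Lemma dotDr x y z : dot x (y + z) = dot x y + dot x z.
Proof. by rewrite dotC dotDl !(dotC x). Qed.

Lemma dotZr a x z : dot x (a *: z) = a * dot x z.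
Proof. by rewrite dotC dotZl dotC. Qed.

Lemma dotNr x z : dot x (- z) = - dot x z.
Proof. by rewrite dotC dotNl dotC. Qed.

Lemma dot0l x : dot 0 x = 0.
Proof. by rewrite -(scale0r 0) dotZl mul0r. Qed.

Lemma dot0r x : dot x 0 = 0.
Proof. by rewrite dotC dot0l. Qed.

Definition dotE := (dotDl, dotDr, dotZl, dotZr, dotNl, dotNr, dot0l, dot0r).

Lemma dot_delta x k : dot x (delta_mx 0 k) = x 0 k.
Proof.
rewrite /dot (bigD1 k) //= mxE !eqxx mulr1 big1 ?addr0 // => i ik.
by rewrite mxE (negbTE ik) andbF mulr0.
Qed.

Lemma dot_ge0 x : 0 <= dot x x.
Proof. by apply: sumr_ge0 => k _; rewrite -expr2 sqr_ge0. Qed.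

Lemma dot_eq0 x : dot x x = 0 -> x = 0.
Proof.
move=> /eqP; rewrite psumr_eq0 => [/allP sq0|k _]; last by rewrite -expr2 sqr_ge0.
apply/rowP => k; rewrite mxE; apply/eqP.
by have := sq0 k; rewrite mem_index_enum -expr2 sqrf_eq0 => /(_ isT).
Qed.

Lemma sqr_coord_le_dot x k : x 0 k ^+ 2 <= dot x x.
Proof.
rewrite /dot (bigD1 k) //= expr2 lerDl; apply: sumr_ge0 => i _.
by rewrite -expr2 sqr_ge0.
Qed.

Lemma cauchy_schwarz x y : dot x y ^+ 2 <= dot x x * dot y y.
Proof.
have [y0|y0] := eqVneq (dot y y) 0.
  by rewrite (dot_eq0 y0) !dot0r mulr0 expr0n.
have yp : 0 < dot y y by rewrite lt_def y0 dot_ge0.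
have := dot_ge0 (dot y y *: x - dot x y *: y).
rewrite !dotE (dotC y x) => h.
have : 0 <= dot y y * (dot x x * dot y y - dot x y ^+ 2).
  by move: h; congr (_ <= _); ring.
by rewrite pmulr_rge0 // subr_ge0.
Qed.

Lemma dot_le_coord x y (a b : R) :
  (forall k, `|x 0 k| <= a) -> (forall k, `|y 0 k| <= b) -> `|dot x y| <= n%:R * (a * b).
Proof.
move=> xa yb; apply: (le_trans (ler_norm_sum _ _ _)).
apply: (@le_trans _ _ (\sum_(k < n) a * b)).
  by apply: ler_sum => k _; rewrite normrM; apply: ler_pM.
by rewrite sumr_const card_ord mulr_natl.
Qed.

Lemma bilDl H x y z : bil H (x + y) z = bil H x z + bil H y z.
Proof. by rewrite /bil mulmxDl dotDl. Qed.

Lemma bilDr H x y z : bil H x (y + z) = bil H x y + bil H x z.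
Proof. by rewrite /bil dotDr. Qed.

Lemma bilZl H a x z : bil H (a *: x) z = a * bil H x z.
Proof. by rewrite /bil -scalemxAl dotZl. Qed.

Lemma bilZr H a x z : bil H x (a *: z) = a * bil H x z.
Proof. by rewrite /bil dotZr. Qed.

Lemma bilNl H x z : bil H (- x) z = - bil H x z.
Proof. by rewrite /bil mulNmx dotNl. Qed.

Lemma bilNr H x z : bil H x (- z) = - bil H x z.
Proof. by rewrite /bil dotNr. Qed.

Lemma bil0l H x : bil H 0 x = 0.
Proof. by rewrite /bil mul0mx dot0l. Qed.

Lemma bil0r H x : bil H x 0 = 0.
Proof. by rewrite /bil dot0r. Qed.

Definition bilE := (bilDl, bilDr, bilZl, bilZr, bilNl, bilNr, bil0l, bil0r).

Lemma bilDm H1 H2 x y : bil (H1 + H2) x y = bil H1 x y + bil H2 x y.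
Proof. by rewrite /bil mulmxDr dotDl. Qed.

Lemma bilNm H x y : bil (- H) x y = - bil H x y.
Proof. by rewrite /bil mulmxN dotNl. Qed.

Lemma bil0m x y : bil 0 x y = 0.
Proof. by rewrite /bil mulmx0 dot0l. Qed.

Lemma bil_scalar a x y : bil a%:M x y = a * dot x y.
Proof. by rewrite /bil mul_mx_scalar dotZl. Qed.

Definition bilmE := (bilDm, bilNm, bil0m, bil_scalar).

Lemma bil_sum H x y : bil H x y = \sum_k \sum_l x 0 k * H k l * y 0 l.
Proof.
rewrite /bil /dot exchange_big; apply: eq_bigr => l _.
by rewrite mxE mulr_suml.
Qed.

Lemma bil_delta H k l : bil H (delta_mx 0 k) (delta_mx 0 l) = H k l.
Proof. by rewrite /bil dot_delta -rowE mxE. Qed.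

Lemma bilC H x y : symmetric H -> bil H x y = bil H y x.
Proof.
move=> HT; rewrite !bil_sum exchange_big; apply: eq_bigr => k _; apply: eq_bigr => l _.
by rewrite -{1}HT mxE; ring.
Qed.

Lemma bil_le_coord H x y (C a b : R) :
  (forall k l, `|H k l| <= C) -> (forall k, `|x 0 k| <= a) ->
  (forall k, `|y 0 k| <= b) -> `|bil H x y| <= n%:R ^+ 2 * C * a * b.
Proof.
move=> HC xa yb.
have -> : n%:R ^+ 2 * C * a * b = n%:R * (n%:R * (C * a) * b) by ring.
apply: dot_le_coord => // l.
rewrite mxE [n%:R * _]mulr_natl -[n in leRHS]card_ord -sumr_const.
apply: (le_trans (ler_norm_sum _ _ _)); apply: ler_sum => k _.
by rewrite normrM mulrC ler_pM.
Qed.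

Lemma quadD c b H v d : symmetric H ->
  quad c b H (v + d) = quad (quad c b H v) (b + v *m H) H d.
Proof.
by move=> HT; rewrite /quad dotDl -/(bil H v d) !(dotDr, bilE) (bilC d v HT); field.
Qed.

Lemma quad0r c b H : quad c b H 0 = c.
Proof. by rewrite /quad dot0r bil0r mulr0 !addr0. Qed.

Lemma quadDN c b H v d : symmetric H ->
  quad c b H (v + d) + quad c b H (v - d) = 2 * quad c b H v + bil H d d.
Proof. by move=> HT; rewrite /quad !(bilE, dotDr, dotNr) (bilC d v HT); field. Qed.

Lemma quad_segment c b H v d t : symmetric H ->
  t * quad c b H (v + d) + (1 - t) * quad c b H v =
  quad c b H (v + t *: d) + 2^-1 * (t * (1 - t) * bil H d d).
Proof. by move=> HT; rewrite /quad !(bilE, dotDr, dotZr) (bilC d v HT); field. Qed.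

End QuadraticForms.

Section EuclideanNorm.
Variables (R : realType) (n : nat).
Implicit Types (x y z : 'rV[R]_n) (H : 'M[R]_n).

Lemma enorm_dot x : enorm x = Num.sqrt (dot x x).
Proof. by congr Num.sqrt; apply: eq_bigr => k _; rewrite expr2. Qed.

Lemma enorm_ge0 x : 0 <= enorm x.
Proof. exact: sqrtr_ge0. Qed.

Lemma enorm_sqr x : enorm x ^+ 2 = dot x x.
Proof. by rewrite enorm_dot sqr_sqrtr // dot_ge0. Qed.

Lemma enormZ a x : enorm (a *: x) = `|a| * enorm x.
Proof.
by rewrite !enorm_dot dotZl dotZr mulrA -expr2 sqrtrM ?sqr_ge0 // sqrtr_sqr.
Qed.

Lemma enormN x : enorm (- x) = enorm x.
Proof. by rewrite -scaleN1r enormZ normrN normr1 mul1r. Qed.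

Lemma enorm0 : enorm (0 : 'rV[R]_n) = 0.
Proof. by rewrite -(scale0r 0) enormZ normr0 mul0r. Qed.

Lemma enorm_eq0 x : enorm x = 0 -> x = 0.
Proof. by move=> x0; apply: dot_eq0; rewrite -enorm_sqr x0 expr0n. Qed.

Lemma enorm_gt0 x : x != 0 -> 0 < enorm x.
Proof. by rewrite lt_def enorm_ge0 andbT; apply: contra => /eqP/enorm_eq0 ->. Qed.

Lemma enorm_le x (a : R) : 0 <= a -> dot x x <= a ^+ 2 -> enorm x <= a.
Proof. by move=> a0 h; rewrite -(ler_sqr (enorm_ge0 x) a0) enorm_sqr. Qed.

Lemma dot_le_enorm x y : `|dot x y| <= enorm x * enorm y.
Proof.
rewrite -ler_sqr ?nnegrE ?mulr_ge0 ?enorm_ge0 // real_normK ?num_real //.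
by rewrite exprMn !enorm_sqr cauchy_schwarz.
Qed.

Lemma dot_le_mul x y (a b : R) : enorm x <= a -> enorm y <= b -> `|dot x y| <= a * b.
Proof.
by move=> xa yb; apply: (le_trans (dot_le_enorm _ _)); rewrite ler_pM ?enorm_ge0.
Qed.

Lemma ler_enormD x y : enorm (x + y) <= enorm x + enorm y.
Proof.
apply: enorm_le; first by rewrite addr_ge0 ?enorm_ge0.
rewrite !dotE (dotC y x) sqrrD -!enorm_sqr.
by have := le_trans (ler_norm _) (dot_le_enorm x y); lra.
Qed.

Lemma ler_enormB x y : enorm (x - y) <= enorm x + enorm y.
Proof. by rewrite -(enormN y) ler_enormD. Qed.

Lemma enormC x y : enorm (x - y) = enorm (y - x).
Proof. by rewrite -enormN opprB. Qed.

Lemma ler_enorm_triangle y x z : enorm (x - z) <= enorm (x - y) + enorm (y - z).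
Proof. by apply: le_trans (ler_enormD _ _); rewrite addrA subrK. Qed.

Lemma coord_le_enorm x k : `|x 0 k| <= enorm x.
Proof.
rewrite -ler_sqr ?nnegrE ?enorm_ge0 // real_normK ?num_real // enorm_sqr.
exact: sqr_coord_le_dot.
Qed.

Lemma enorm_le_coord x (a : R) : 0 <= a -> (forall k, `|x 0 k| <= a) ->
  enorm x <= n%:R * a.
Proof.
move=> a0 xa; apply: enorm_le; first by rewrite mulr_ge0.
apply: (le_trans (ler_norm _)); apply: (le_trans (dot_le_coord xa xa)).
rewrite exprMn -expr2 ler_wpM2r ?sqr_ge0 //.
by case: n => [|m]; rewrite ?expr0n // expr2 ler_peMl // ler1n.
Qed.

Lemma bil_le_enorm H (C : R) x y : (forall k l, `|H k l| <= C) ->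
  `|bil H x y| <= n%:R ^+ 2 * C * enorm x * enorm y.
Proof. by move=> HC; apply: bil_le_coord => // k; exact: coord_le_enorm. Qed.

Lemma enorm_le_dual x (a t : R) : 0 <= a -> 0 < t ->
  (forall d, enorm d <= t -> dot d x <= a) -> t * enorm x <= a.
Proof.
move=> a0 t0 dual; have [->|/enorm_gt0 xp] := eqVneq x 0; first by rewrite enorm0 mulr0.
have := dual ((t / enorm x) *: x); rewrite enormZ ger0_norm ?divr_ge0 ?(ltW t0) ?enorm_ge0 //.
rewrite divfK ?gt_eqF // lexx dotZl -enorm_sqr expr2 mulrA divfK ?gt_eqF // => h; exact: h.
Qed.

Lemma bil_le_homogeneous H (a r : R) x : 0 < r ->
  (forall y, enorm y <= r -> bil H y y <= a * r ^+ 2) -> bil H x x <= a * dot x x.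
Proof.
move=> r0 le_a; have [->|/enorm_gt0 xp] := eqVneq x 0.
  by rewrite bil0l dot0l mulr0.
have t0 : 0 < r / enorm x by rewrite divr_gt0.
have := le_a ((r / enorm x) *: x); rewrite enormZ gtr0_norm // divfK ?gt_eqF // lexx.
have rE : r = r / enorm x * enorm x by rewrite divfK ?gt_eqF.
move=> /(_ isT); rewrite [in leRHS]rE exprMn enorm_sqr !(bilZl, bilZr) mulrA -expr2.
by rewrite mulrCA ler_pM2l // exprn_gt0.
Qed.

Lemma mx_norm_le x (a : R) : 0 <= a -> (forall k, `|x 0 k| <= a) -> `|x| <= a.
Proof.
move=> a0 xa; rewrite [leLHS]/Num.Def.normr /= mx_normrE; apply: bigmax_le => //= -[i j] _.
by rewrite ord1 /=.
Qed.

Lemma coord_le_norm x k : `|x 0 k| <= `|x|.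
Proof.
rewrite [leRHS]/Num.Def.normr /= mx_normrE.
by apply: le_trans (le_bigmax _ _ (0, k)).
Qed.

Lemma norm_le_enorm x : `|x| <= enorm x.
Proof. by apply: mx_norm_le; [exact: enorm_ge0|exact: coord_le_enorm]. Qed.

Lemma enorm_le_norm x : enorm x <= n%:R * `|x|.
Proof. by apply: enorm_le_coord => // k; exact: coord_le_norm. Qed.

End EuclideanNorm.

Section SecondDifferences.
Variables (R : realType) (n : nat).
Implicit Types (f : 'rV[R]_n -> R) (a b x y v : 'rV[R]_n) (H : 'M[R]_n) (k l : 'I_n).
Implicit Types (s eta beta : R) (j : 'I_n -> nat) (kap : 'I_n -> 'I_n -> R).

Definition mixed_diff f a b y : R := f (y + a + b) - f (y + a) - f (y + b) + f y.
Definition diff2 f v y : R := mixed_diff f v v y.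

Lemma diff2E f v y : diff2 f v y = f (y + v + v) - 2 * f (y + v) + f y.
Proof. by rewrite /diff2 /mixed_diff; ring. Qed.

Lemma diff2_quad H (c : R) b x v y : symmetric H ->
  diff2 (fun z => quad c b H (z - x)) v y = bil H v v.
Proof.
move=> HT; rewrite diff2E /quad.
have -> : y + v + v - x = (y - x) + v + v by rewrite addrAC (addrAC y).
have -> : y + v - x = (y - x) + v by rewrite addrAC.
by rewrite !(bilE, dotE) (bilC v _ HT); field.
Qed.

Lemma mixed_diff_le f a b y eta :
  `|diff2 f (a + b) y| <= eta -> `|diff2 f a y| <= eta ->
  `|diff2 f a (y + b)| <= eta -> `|diff2 f b (y + a)| <= eta ->
  `|diff2 f b (y + a + a)| <= eta -> `|mixed_diff f a b y| <= 4 * eta.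
Proof.
rewrite !diff2E /mixed_diff.
have -> : y + (a + b) + (a + b) = y + a + a + b + b.
  by apply/rowP => k; rewrite !mxE; ring.
rewrite (addrA y a b) (addrAC y b a) (addrAC (y + a) b a).
by rewrite !ler_norml => *; apply/andP; split; lra.
Qed.

Definition weight j := (\sum_k j k)%N.

Lemma weight_add j1 j2 : weight (fun k => j1 k + j2 k)%N = (weight j1 + weight j2)%N.
Proof. exact: big_split. Qed.

Lemma weight_delta k : weight (fun q => (q == k) : nat) = 1%N.
Proof. by rewrite /weight (bigD1 k) //= eqxx big1 // => q /negbTE ->. Qed.

Lemma weight_ge j k : (j k <= weight j)%N.
Proof. by rewrite /weight (bigD1 k) //= leq_addr. Qed.

Lemma lattice_ind (P : ('I_n -> nat) -> Prop) : P (fun=> 0%N) ->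
  (forall j k, P j -> P (fun q => j q + (q == k))%N) -> forall j, P j.
Proof.
move=> P0 PS j; move: {2}(weight j) (erefl (weight j)) => d.
elim: d j => [|d IH] j jd.
  rewrite (_ : j = fun=> 0%N) //; apply/funext => k; apply/eqP.
  by rewrite -leqn0 -jd weight_ge.
have [k jk] : exists k, (0 < j k)%N.
  apply: contrapT => /forallNP j0; move: jd; rewrite /weight big1 // => k _.
  by apply/eqP; have /negP := j0 k; rewrite -eqn0Ngt.
have jE : j = (fun q => (j q - (q == k)) + (q == k))%N.
  by apply/funext => q; case: eqP => [->|_]; [rewrite subnK|rewrite subn0 addn0].
rewrite jE; apply/PS/IH/eqP; rewrite -eqSS -jd [in X in _ == X]jE weight_add weight_delta.
by rewrite addn1.
Qed.

Lemma lattice_step x s j k :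
  x + s *: natvec R (fun q => j q + (q == k))%N = x + s *: natvec R j + s *: delta_mx 0 k.
Proof. by rewrite natvecD natvec_delta scalerDr addrA. Qed.

Lemma lattice_origin x s : x + s *: natvec R (fun=> 0%N : nat) = x :> 'rV[R]_n.
Proof. by apply/rowP => k; rewrite !mxE mulr0 addr0. Qed.

(* Along a monotone lattice path the increments change by at most [beta] per step. *)
Lemma affine_on_lattice f x s beta B : 0 <= beta ->
  (forall k l j, (weight j < B)%N ->
    `|mixed_diff f (s *: delta_mx 0 k) (s *: delta_mx 0 l) (x + s *: natvec R j)| <= beta) ->
  forall j, (weight j <= B)%N ->
  `|f (x + s *: natvec R j) - f x - \sum_k (j k)%:R * (f (x + s *: delta_mx 0 k) - f x)|
   <= beta * (weight j)%:R ^+ 2.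
Proof.
move=> beta0 mixed.
have weightS j k : weight (fun q => j q + (q == k))%N = (weight j).+1.
  by rewrite weight_add weight_delta addn1.
have increment k : forall j, (weight j <= B)%N ->
  `|(f (x + s *: natvec R j + s *: delta_mx 0 k) - f (x + s *: natvec R j))
    - (f (x + s *: delta_mx 0 k) - f x)| <= beta * (weight j)%:R.
  apply: lattice_ind => [_|j l IH]; first by rewrite lattice_origin subrr normr0 mulr_ge0.
  rewrite weightS => jB; have := IH (ltnW jB); have := mixed k l j jB.
  rewrite /mixed_diff lattice_step (addrAC _ (s *: delta_mx 0 l)) -natr1 !ler_norml.
  by move=> /andP[? ?] /andP[? ?]; apply/andP; split; lra.
apply: lattice_ind => [_|j k IH].
  rewrite lattice_origin subrr sub0r big1 ?oppr0 ?normr0 ?mulr_ge0 ?sqr_ge0 // => k _.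
  by rewrite mul0r.
rewrite weightS => jB; have := IH (ltnW jB); have := increment k j (ltnW jB).
have -> : \sum_q (j q + (q == k))%:R * (f (x + s *: delta_mx 0 q) - f x) =
    \sum_q (j q)%:R * (f (x + s *: delta_mx 0 q) - f x) + (f (x + s *: delta_mx 0 k) - f x).
  under eq_bigr do rewrite natrD mulrDl; rewrite big_split /=; congr (_ + _).
  by rewrite (bigD1 k) //= eqxx mul1r big1 ?addr0 // => q /negbTE ->; rewrite mul0r.
rewrite lattice_step -natr1; move: (\sum_q _) => L.
have w0 : 0 <= beta * (weight j)%:R by rewrite mulr_ge0.
by rewrite !ler_norml => /andP[? ?] /andP[? ?]; apply/andP; split; lra.
Qed.

Definition pair_dir k l : 'rV[R]_n := delta_mx 0 k + (k != l)%:R *: delta_mx 0 l.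

Lemma pair_dirC k l : pair_dir k l = pair_dir l k.
Proof.
rewrite /pair_dir eq_sym; case: eqVneq => [->//|_] /=.
by rewrite !scale1r addrC.
Qed.

Lemma pair_dir_diag k : pair_dir k k = delta_mx 0 k.
Proof. by rewrite /pair_dir eqxx scale0r addr0. Qed.

(* The symmetric matrix whose quadratic form takes the values [kap k l] at [pair_dir k l]. *)
Definition polar_mx kap : 'M[R]_n :=
  \matrix_(k, l) if k == l then kap k k else (kap k l - kap k k - kap l l) / 2.

Lemma polar_mx_sym kap : (forall k l, kap k l = kap l k) -> symmetric (polar_mx kap).
Proof.
move=> kC; apply/matrixP => k l; rewrite !mxE eq_sym kC; case: eqVneq => [->//|_]; ring.
Qed.

Lemma bil_polar_mx kap k l : (forall k l, kap k l = kap l k) ->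
  bil (polar_mx kap) (pair_dir k l) (pair_dir k l) = kap k l.
Proof.
move=> kC; rewrite /pair_dir; case: (eqVneq k l) => [->|kl] /=.
  by rewrite scale0r addr0 bil_delta mxE eqxx.
rewrite scale1r !bilE !bil_delta !mxE !eqxx (eq_sym l) (negbTE kl) (kC l k); by field.
Qed.

Lemma polar_mx_le kap (K : R) k l :
  (forall k l, 0 <= kap k l <= K) -> `|polar_mx kap k l| <= 2 * K.
Proof.
move=> kapK; rewrite mxE; have /andP[? ?] := kapK k l; have /andP[? ?] := kapK k k.
have /andP[? ?] := kapK l l.
by rewrite ler_norml; case: eqP => _; apply/andP; split; lra.
Qed.

Lemma mixed_diff_on_lattice f x s eta B : 0 <= eta ->
  (forall k l j, (weight j <= B + 2)%N ->
    `|diff2 f (s *: pair_dir k l) (x + s *: natvec R j)| <= eta) ->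
  forall k l j, (weight j < B)%N ->
  `|mixed_diff f (s *: delta_mx 0 k) (s *: delta_mx 0 l) (x + s *: natvec R j)| <= 4 * eta.
Proof.
move=> eta0 small k l j jB.
have axis q i : (weight i <= B + 2)%N ->
    `|diff2 f (s *: delta_mx 0 q) (x + s *: natvec R i)| <= eta.
  by rewrite -pair_dir_diag; exact: small.
have [->|kl] := eqVneq k l.
  by apply: (@le_trans _ _ eta); [apply: axis; lia|lra].
apply: mixed_diff_le.
- have -> : s *: delta_mx 0 k + s *: delta_mx 0 l = s *: pair_dir k l.
    by rewrite /pair_dir kl scale1r scalerDr.
  by apply: small; lia.
- by apply: axis; lia.
- by rewrite -lattice_step; apply: axis; rewrite weight_add weight_delta; lia.
- by rewrite -lattice_step; apply: axis; rewrite weight_add weight_delta; lia.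
- by rewrite -!lattice_step; apply: axis; rewrite !weight_add !weight_delta; lia.
Qed.

Lemma quad_on_lattice f x s eta kap B :
  0 < s -> 0 <= eta -> (forall k l, kap k l = kap l k) ->
  (forall k l j, (weight j <= B + 2)%N ->
    `|diff2 f (s *: pair_dir k l) (x + s *: natvec R j) - s ^+ 2 * kap k l| <= eta) ->
  exists c b, forall j, (weight j <= B)%N ->
    `|f (x + s *: natvec R j) - quad c b (polar_mx kap) (s *: natvec R j)|
    <= 4 * eta * (weight j)%:R ^+ 2.
Proof.
move=> s0 eta0 kC near; set H := polar_mx kap; have HT : symmetric H := polar_mx_sym kC.
pose g z := f z - quad 0 0 H (z - x).
have g_small k l j : (weight j <= B + 2)%N ->
    `|diff2 g (s *: pair_dir k l) (x + s *: natvec R j)| <= eta.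
  move=> /(near k l); set v := s *: pair_dir k l; set y := x + _.
  have <- : bil H v v = s ^+ 2 * kap k l.
    by rewrite /v bilZl bilZr bil_polar_mx // mulrA expr2.
  by rewrite -(diff2_quad 0 0 x v y HT) !diff2E /g; congr (`|_| <= _); ring.
have eta40 : 0 <= 4 * eta by rewrite mulr_ge0.
have affine := affine_on_lattice eta40 (mixed_diff_on_lattice eta0 g_small).
exists (g x), (s^-1 *: \row_k (g (x + s *: delta_mx 0 k) - g x)) => j /affine.
have -> : \sum_k (j k)%:R * (g (x + s *: delta_mx 0 k) - g x) =
   dot (s^-1 *: \row_k (g (x + s *: delta_mx 0 k) - g x)) (s *: natvec R j).
  rewrite dotZl dotZr mulrA mulVf ?gt_eqF // mul1r.
  by apply: eq_bigr => k _; rewrite !mxE mulrC.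
congr (`|_| <= _); rewrite {1}/g (addrC x (s *: natvec R j)) addrK /quad dot0l.
ring.
Qed.

End SecondDifferences.

(** * Convex functions on stable cubes *)

Section ConvexFunctions.
Variables (R : realType) (n : nat).
Implicit Types (psi : 'rV[R]_n -> R) (x y z v : 'rV[R]_n).

Lemma convexP psi : convex psi <->
  forall x y (t : R), 0 <= t <= 1 ->
    psi (t *: x + (1 - t) *: y) <= t * psi x + (1 - t) * psi y.
Proof.
split=> [cvx x y t /andP[t0 t1]|cvx t x y _ _].
  exact: (cvx (Itv01 t0 t1) x y (in_setT _) (in_setT _)).
by apply: cvx; apply/andP.
Qed.

Lemma convex_midpoint psi z v : convex psi -> 2 * psi z <= psi (z + v) + psi (z - v).
Proof.
move=> /convexP/(_ (z + v) (z - v) 2^-1).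
rewrite (_ : 2^-1 *: (z + v) + (1 - 2^-1) *: (z - v) = z); last first.
  by apply/rowP => k; rewrite !mxE; field.
by rewrite invr_ge0 ler0n invf_le1 ?ler1n //= => /(_ isT); lra.
Qed.

Lemma convex_diff2_ge0 psi v y : convex psi -> 0 <= diff2 psi v y.
Proof. by move=> /(convex_midpoint (y + v) v); rewrite addrK diff2E; lra. Qed.

End ConvexFunctions.

Section QuadraticCubeAverages.
Variables (R : realType) (n : nat).
Implicit Types (z v : 'rV[R]_n) (j : 'I_n -> nat).

Variables (psi : 'rV[R]_n -> R) (s : R) (x b : 'rV[R]_n) (H : 'M[R]_n).
Variables (c C E : R) (W M : nat).
Hypotheses (psi_convex : convex psi) (s0 : 0 < s) (HT : symmetric H).
Hypotheses (W0 : (0 < W)%N) (C0 : 0 <= C) (HC : forall k l, `|H k l| <= C).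

Let Q := quad c b H.
Let K := n%:R ^+ 2 * C * (s * W%:R) ^+ 2.

Definition cube_center : 'rV[R]_n := const_mx (s * W.-1%:R / 2).
Let offset o : 'rV[R]_n := s *: o - cube_center.

Let lattice_avg_offsetN (f : 'rV[R]_n -> R) :
  lattice_avg W (fun o => f (offset o)) = lattice_avg W (fun o => f (- offset o)).
Proof.
rewrite lattice_avg_rev; apply: eq_lattice_avg => o; congr f.
by apply/rowP => k; rewrite !mxE; field.
Qed.

Let offset_le i k : in_cube W i -> `|offset (natvec R i) 0 k| <= s * W%:R.
Proof.
move=> /(_ k) ik; rewrite !mxE.
have : (i k)%:R <= W%:R :> R by rewrite ler_nat ltnW.
have : (W.-1)%:R <= W%:R :> R by rewrite ler_nat leq_pred.
rewrite -(ler_pM2l s0) => pred_le; rewrite -(ler_pM2l s0) => ik_le.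
have ik0 : 0 <= s * (i k)%:R by rewrite mulr_ge0 // ltW.
have pred0 : 0 <= s * (W.-1)%:R by rewrite mulr_ge0 // ltW.
by rewrite ler_norml; apply/andP; split; lra.
Qed.

Lemma cube_center_itv k : 0 <= cube_center 0 k <= s * W%:R.
Proof.
rewrite mxE; have : 0 <= s * (W.-1)%:R by rewrite mulr_ge0 // ltW.
have : (W.-1)%:R <= W%:R :> R by rewrite ler_nat leq_pred.
by rewrite -(ler_pM2l s0) => *; apply/andP; split; lra.
Qed.

Lemma convex_le_centered_avg z : psi z <= lattice_avg W (fun o => psi (z + offset o)).
Proof.
have : 2 * psi z <= lattice_avg W (fun o => psi (z + offset o)) +
                    lattice_avg W (fun o => psi (z - offset o)).
  rewrite -lattice_avgD -(lattice_avg_cst n (2 * psi z) W0).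
  by apply: ler_lattice_avg => i _; exact: convex_midpoint.
by rewrite -(lattice_avg_offsetN (fun d => psi (z + d))); lra.
Qed.

Lemma quad_centered_avg_le v :
  lattice_avg W (fun o => Q (v + 2 *: offset o)) <= Q v + 2 * K.
Proof.
have sym : lattice_avg W (fun o => Q (v + 2 *: offset o)) =
           lattice_avg W (fun o => Q (v - 2 *: offset o)).
  rewrite (lattice_avg_offsetN (fun d => Q (v + 2 *: d))).
  by apply: eq_lattice_avg => o; rewrite scalerN.
suff : lattice_avg W (fun o => Q (v + 2 *: offset o)) +
       lattice_avg W (fun o => Q (v - 2 *: offset o)) <= 2 * (Q v + 2 * K).
  by rewrite -sym; lra.
rewrite -lattice_avgD -(lattice_avg_cst n (2 * (Q v + _)) W0).
apply: ler_lattice_avg => i iW; rewrite quadDN // bilZl bilZr -/Q.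
have := bil_le_coord HC (fun k => offset_le k iW) (fun k => offset_le k iW).
by rewrite /K ler_norml => /andP[_]; lra.
Qed.

Hypothesis avg_near_quad : forall j, (forall k, j k <= M)%N ->
  `|cube_avg s psi W (x + s *: natvec R j) - Q (s *: natvec R j)| <= E.

Let cube_avgE v :
  cube_avg s psi W (x + v) = lattice_avg W (fun o => psi (x + cube_center + v + offset o)).
Proof.
by apply: eq_lattice_avg => o; congr psi; apply/rowP => k; rewrite !mxE; ring.
Qed.

Lemma lattice_upper j : (forall k, j k <= M)%N ->
  psi (x + cube_center + s *: natvec R j) <= Q (s *: natvec R j) + E.
Proof.
move=> /avg_near_quad; rewrite ler_distl => /andP[_]; apply: le_trans.
by rewrite cube_avgE convex_le_centered_avg.
Qed.

Lemma lattice_lower j : (forall k, W <= j k)%N -> (forall k, j k + W <= M)%N ->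
  Q (s *: natvec R j) - 3 * E - 2 * K <= psi (x + cube_center + s *: natvec R j).
Proof.
move=> Wj jM; set z := x + cube_center + _; set v := s *: natvec R j.
have /avg_near_quad : (forall k, j k <= M)%N by move=> k; exact: leq_trans (leq_addr _ _) (jM k).
rewrite ler_distl cube_avgE -/z -/v => /andP[+ _].
have far i : in_cube W i ->
    psi (z + 2 *: offset (natvec R i)) <= Q (v + 2 *: offset (natvec R i)) + E.
  move=> iW; pose i' k := (j k + (i k + i k) - W.-1)%N.
  have i'E k : (i' k)%:R = (j k)%:R + ((i k)%:R + (i k)%:R) - (W.-1)%:R :> R.
    by rewrite /i' natrB ?natrD //; have := Wj k; lia.
  have offE u : u + s *: natvec R j + 2 *: offset (natvec R i) = u + s *: natvec R i'.
    by apply/rowP => k; rewrite !mxE i'E; field.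
  have := offE 0; rewrite !add0r -/v => ->; rewrite offE.
  by apply: lattice_upper => k; rewrite /i'; have := jM k; have := iW k; lia.
have : lattice_avg W (fun o => psi (z + offset o)) <=
    2^-1 * psi z + 2^-1 * (lattice_avg W (fun o => Q (v + 2 *: offset o)) + E).
  rewrite -(lattice_avg_cst n E W0) -lattice_avgD -lattice_avgZ.
  rewrite -[X in X + _](lattice_avg_cst n _ W0) -lattice_avgD.
  apply: ler_lattice_avg => i /far.
  have := convex_midpoint (z + offset (natvec R i)) (offset (natvec R i)) psi_convex.
  rewrite addrK (_ : z + _ + _ = z + 2 *: offset (natvec R i)); first by lra.
  by rewrite -addrA scaler_nat mulr2n.
by have := quad_centered_avg_le v; lra.
Qed.

Lemma convex_edge_upper z v k (t e : R) : 0 <= t <= 1 ->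
  psi (z + v) <= Q v + e ->
  psi (z + (v + s *: delta_mx 0 k)) <= Q (v + s *: delta_mx 0 k) + e ->
  psi (z + (v + t *: (s *: delta_mx 0 k))) <=
    Q (v + t *: (s *: delta_mx 0 k)) + e + C * s ^+ 2.
Proof.
move=> t01; have /andP[t0 t1] := t01; have t1' : 0 <= 1 - t by rewrite subr_ge0.
move=> /(ler_wpM2l t1') low /(ler_wpM2l t0) up.
have := quad_segment c b v (s *: delta_mx 0 k) t HT; rewrite -/Q bilZl bilZr bil_delta.
have : t * (1 - t) * (s * (s * H k k)) <= 2 * (C * s ^+ 2).
  have u0 : 0 <= t * (1 - t) by rewrite mulr_ge0.
  have u1 : t * (1 - t) <= 1 by nra.
  have q0 : 0 <= C * s ^+ 2 by rewrite mulr_ge0 // sqr_ge0.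
  have : s * (s * H k k) <= C * s ^+ 2.
    rewrite mulrA -expr2 mulrC ler_wpM2r ?sqr_ge0 //.
    exact: le_trans (ler_norm _) (HC k k).
  by move=> /(ler_wpM2l u0); have := ler_wpM2r q0 u1; lra.
have -> : z + (v + t *: (s *: delta_mx 0 k)) =
    t *: (z + (v + s *: delta_mx 0 k)) + (1 - t) *: (z + v).
  by apply/rowP => q; rewrite !mxE; ring.
by have := (convexP psi).1 psi_convex (z + (v + s *: delta_mx 0 k)) (z + v) t t01; lra.
Qed.

Lemma exists_natr_cell (a : R) (m : nat) : (0 < m)%N -> 0 <= a <= m%:R ->
  exists2 i : nat, (i < m)%N & i%:R <= a <= i.+1%:R.
Proof.
move=> m0 /andP[a0 am]; have [lt|ge] := ltP a m%:R.
  exists (Num.truncn a); last by have /andP[-> /ltW ->] := truncn_itv a0.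
  by rewrite -(ltr_nat R); apply: le_lt_trans lt; have /andP[] := truncn_itv a0.
exists m.-1; first by lia.
by rewrite prednK // am andbT (le_trans _ ge) // ler_nat leq_pred.
Qed.

Let on_grid v k := exists2 i : nat, (i <= M)%N & v 0 k = s * i%:R.

(* One coordinate at a time, by convexity along the edges of the lattice. *)
Let box_upper_seq (ks : seq 'I_n) v : (0 < M)%N ->
  (forall k, 0 <= v 0 k <= s * M%:R) -> (forall k, k \notin ks -> on_grid v k) ->
  psi (x + cube_center + v) <= Q v + E + (size ks)%:R * (C * s ^+ 2).
Proof.
move=> M0; elim: ks v => [|k ks IH] v inbox grid.
  have /choice [j jP] : forall k, exists i : nat, (i <= M)%N /\ v 0 k = s * i%:R.
    by move=> k; have [//|i iM vi] := grid k; exists i.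
  have -> : v = s *: natvec R j by apply/rowP => k; rewrite !mxE (jP k).2.
  by rewrite mul0r addr0; apply: lattice_upper => k; have [] := jP k.
have [i iM /andP[i1 i2]] : exists2 i : nat, (i < M)%N & i%:R <= v 0 k / s <= i.+1%:R.
  apply: exists_natr_cell => //; have /andP[v_ge0 v_le] := inbox k.
  by rewrite divr_ge0 ?(ltW s0) //= ler_pdivrMr // mulrC.
pose t := v 0 k / s - i%:R.
have t01 : 0 <= t <= 1 by rewrite /t -natr1 in i2 *; apply/andP; split; lra.
pose snap i' := v + (s * i'%:R - v 0 k) *: delta_mx 0 k.
have snapE i' q : snap i' 0 q = if q == k then s * i'%:R else v 0 q.
  by rewrite !mxE eqxx /=; case: eqP => [->|_] /=; ring.
have snapS : snap i.+1 = snap i + s *: delta_mx 0 k.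
  by apply/rowP => q; rewrite !mxE -natr1; ring.
have snapv : v = snap i + t *: (s *: delta_mx 0 k).
  by apply/rowP => q; rewrite !mxE /t; field; rewrite gt_eqF.
have snap_upper i' : (i' <= M)%N ->
    psi (x + cube_center + snap i') <= Q (snap i') + E + (size ks)%:R * (C * s ^+ 2).
  move=> i'M; apply: IH => q; rewrite /on_grid snapE; case: eqP => [_|/eqP qk].
  - by rewrite mulr_ge0 ?(ltW s0) //= ler_pM2l // ler_nat.
  - exact: inbox.
  - by move=> _; exists i'.
  - by move=> qks; apply: grid; rewrite in_cons negb_or qk.
rewrite {1 2}snapv.
apply: le_trans (convex_edge_upper (e := E + (size ks)%:R * (C * s ^+ 2)) t01 _ _) _.
- by rewrite [leRHS]addrA; apply: snap_upper; exact: ltnW.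
- by rewrite -snapS [leRHS]addrA; exact: snap_upper.
- by rewrite /= -natr1 mulrDl mul1r !addrA.
Qed.

Lemma box_upper v : (0 < M)%N -> (forall k, 0 <= v 0 k <= s * M%:R) ->
  psi (x + cube_center + v) <= Q v + E + n%:R * (C * s ^+ 2).
Proof.
move=> M0 inbox; have := @box_upper_seq (enum 'I_n) v M0 inbox.
by rewrite size_enum_ord; apply=> k; rewrite mem_enum.
Qed.

Let lattice_floor v : (forall k, s * (W%:R + 1) <= v 0 k <= s * M%:R - s * W%:R) ->
  exists j, [/\ forall k, (W <= j k)%N, forall k, (j k + W <= M)%N &
    forall k, 0 <= (v - s *: natvec R j) 0 k <= s].
Proof.
move=> vW; exists (fun k => Num.truncn (v 0 k / s)).
have cell k : s * (Num.truncn (v 0 k / s))%:R <= v 0 k < s * (Num.truncn (v 0 k / s))%:R + s.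
  have v0 : 0 <= v 0 k / s.
    have /andP[v_ge _] := vW k; rewrite divr_ge0 ?(ltW s0) //.
    by apply: le_trans v_ge; rewrite mulr_ge0 ?(ltW s0) // addr_ge0.
  have /andP[] := truncn_itv v0; rewrite ler_pdivlMr // ltr_pdivrMr // -natr1 => ? ?.
  by apply/andP; split; lra.
split=> k; have /andP[? ?] := vW k; have /andP[? ?] := cell k.
- by rewrite -(ler_nat R) -(ler_pM2l s0); lra.
- by rewrite -(ler_nat R) natrD -(ler_pM2l s0); lra.
- by rewrite !mxE; apply/andP; split; lra.
Qed.

Lemma convex_quad_approx v : (0 < n)%N ->
  (forall k, s * (W%:R + 1) <= v 0 k <= s * M%:R - s * W%:R) ->
  `|psi (x + cube_center + v) - Q v| <= 7 * E + 6 * K.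
Proof.
move=> n0 vW; have [j [Wj jM near]] := lattice_floor vW.
pose v1 := s *: natvec R j; pose d := v - v1.
have s_ge0 : 0 <= s := ltW s0.
have sW : s <= s * W%:R by rewrite ler_peMr // ler1n.
have M0 : (0 < M)%N by have := jM (Ordinal n0); have := Wj (Ordinal n0); lia.
have d_le k : `|d 0 k| <= s * W%:R.
  by have /andP[d_ge0 d_s] := near k; rewrite ger0_norm // (le_trans d_s).
have up := box_upper M0 (_ : forall k, 0 <= v 0 k <= s * M%:R).
have {}up : psi (x + cube_center + v) <= Q v + E + n%:R * (C * s ^+ 2).
  by apply: up => k; have /andP[? ?] := vW k; apply/andP; split; lra.
have up' : psi (x + cube_center + (v1 - d)) <= Q (v1 - d) + E + n%:R * (C * s ^+ 2).
  apply: box_upper => // k; have /andP[? ?] := vW k; have /andP[? ?] := near k.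
  have -> : (v1 - d) 0 k = v 0 k - 2 * (v - s *: natvec R j) 0 k by rewrite !mxE; ring.
  by apply/andP; split; lra.
have low : Q v1 - 3 * E - 2 * K <= psi (x + cube_center + v1) := lattice_lower Wj jM.
have mid := convex_midpoint (x + cube_center + v1) d psi_convex.
have vE : v1 + d = v by rewrite addrC subrK.
have parallelogram := quadDN c b v1 d HT.
rewrite -(addrA _ v1 d) -(addrA _ v1 (- d)) vE in mid; rewrite -/Q vE in parallelogram.
have := bil_le_coord HC d_le d_le; rewrite ler_norml => /andP[d1 d2].
have KE : n%:R ^+ 2 * C * (s * W%:R) * (s * W%:R) = K by rewrite /K; ring.
have edges : n%:R * (C * s ^+ 2) <= K.
  rewrite /K -mulrA; apply: ler_pM => //; first by rewrite mulr_ge0 // sqr_ge0.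
    by rewrite expr2 ler_peMl // ler1n.
  by rewrite ler_wpM2l // ler_pXn2r ?nnegrE // (le_trans s_ge0).
have E0 : 0 <= E by apply: le_trans (avg_near_quad (fun k => leq_trans (leq_addr W (j k)) (jM k))).
have K0 : 0 <= K by rewrite /K mulr_ge0 ?sqr_ge0 // mulr_ge0 // sqr_ge0.
by rewrite ler_norml; apply/andP; split; lra.
Qed.

Lemma convex_quad_approx_center (r : R) z (v0 : 'rV[R]_n := const_mx (2 * r))
    (p := x + cube_center + v0) : (0 < n)%N ->
  s * M%:R = 4 * r -> 2 * (s * W%:R) <= r -> (forall k, `|z 0 k| <= r) ->
  `|psi (p + z) - quad (psi p) (b + v0 *m H) H z| <= 2 * (7 * E + 6 * K).
Proof.
move=> n0 sM sW zr; have sW1 : s <= s * W%:R by rewrite ler_peMr ?(ltW s0) // ler1n.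
have r0 : 0 <= r by have s_gt0 := s0; lra.
have approx (d : 'rV[R]_n) : (forall k, `|d 0 k| <= r) ->
    `|psi (p + d) - Q (v0 + d)| <= 7 * E + 6 * K.
  move=> dr; rewrite /p -addrA; apply: convex_quad_approx => // k.
  rewrite !mxE sM mulrDr mulr1; have := dr k; rewrite ler_norml => /andP[? ?].
  by apply/andP; split; lra.
have := approx 0; rewrite !addr0 => /(_ _) near_p.
have {}near_p : `|psi p - Q v0| <= 7 * E + 6 * K by apply: near_p => k; rewrite mxE normr0.
have := approx z zr; move: near_p; rewrite /Q quadD // /quad !ler_norml.
by move=> /andP[? ?] /andP[? ?]; apply/andP; split; lra.
Qed.

End QuadraticCubeAverages.

Section PowersNearOne.
Variable R : realFieldType.
Implicit Type a : R.

Lemma exprD1_le a d : 0 <= a <= 1 -> (1 + a) ^+ d <= 1 + (2 ^ d)%:R * a.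
Proof.
move=> /andP[a0 a1]; suff : (1 + a) ^+ d <= 1 + ((2 ^ d)%:R - 1) * a by nra.
elim: d => [|d IH]; first by rewrite expr0 subrr mul0r addr0.
have p1 : 1 <= (2 ^ d)%:R :> R by rewrite ler1n expn_gt0.
rewrite exprS expnS natrM; apply: (le_trans (ler_wpM2l _ IH)); first by lra.
move: (2 ^ d)%:R p1 => p p1.
have : (p - 1) * a * a <= (p - 1) * a by apply: ler_piMr => //; rewrite mulr_ge0 ?subr_ge0.
nra.
Qed.

Lemma expr1B_ge a d : 0 <= a <= 1 -> 1 - d%:R * a <= (1 - a) ^+ d.
Proof.
move=> /andP[a0 a1]; elim: d => [|d IH]; first by rewrite expr0 mul0r subr0.
have a1' : 0 <= 1 - a by rewrite subr_ge0.
rewrite exprS -natr1; apply: (le_trans _ (ler_wpM2l a1' IH)).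
have : 0 <= d%:R * (a * a) by rewrite !mulr_ge0.
nra.
Qed.

End PowersNearOne.

Section AlmostQuadratic.
Variables (R : realType) (n : nat).
Implicit Types (psi : 'rV[R]_n -> R) (x y z v : 'rV[R]_n) (k : 'I_n) (kl : 'I_n * 'I_n).
Implicit Types (s L eta : R).

Definition coord_lipschitz L psi :=
  forall y k (t : R), `|psi (y + t *: delta_mx 0 k) - psi y| <= L * `|t|.

Definition second_quotient psi s kl y : R :=
  diff2 psi (s *: pair_dir R kl.1 kl.2) y / s ^+ 2.

Lemma coord_lipschitz_pair_dir psi L s k l y : coord_lipschitz L psi -> 0 < s ->
  `|psi (y + s *: pair_dir R k l) - psi y| <= 2 * (L * s).
Proof.
move=> lip s0; have L0 : 0 <= L.
  by have := le_trans (normr_ge0 _) (lip 0 k 1); rewrite normr1 mulr1.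
have := lip y k s; have := lip (y + s *: delta_mx 0 k) l (s * (k != l)%:R).
have : L * `|s * (k != l)%:R| <= L * s.
  apply: ler_wpM2l => //; rewrite normrM (gtr0_norm s0).
  by case: eqP => _ /=; rewrite ?normr1 ?mulr1 // normr0 mulr0 ltW.
rewrite (gtr0_norm s0) /pair_dir scalerDr addrA scalerA !ler_norml.
by move=> ? /andP[? ?] /andP[? ?]; apply/andP; split; lra.
Qed.

Lemma second_quotient_ge0 psi s kl y : convex psi -> 0 <= second_quotient psi s kl y.
Proof. by move=> cvx; rewrite divr_ge0 ?sqr_ge0 // convex_diff2_ge0. Qed.

Lemma cube_avg_second_quotient_le psi L s kl m x : coord_lipschitz L psi -> 0 < s ->
  (0 < m)%N -> cube_avg s (second_quotient psi s kl) m x <= 8 * L / (s * m%:R).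
Proof.
move=> lip s0 m0; case: kl => k l; pose v := s *: pair_dir R k l.
pose D o : R := psi (x + s *: o + v) - psi (x + s *: o).
have D_le o : `|D o| <= 2 * (L * s) by exact: coord_lipschitz_pair_dir.
have m0r : 0 < m%:R :> R by rewrite ltr0n.
have quotientE o : second_quotient psi s (k, l) (x + s *: o) =
    s ^- 2 * ((D (o + delta_mx 0 k) - D o) +
      (k != l)%:R * (D (o + delta_mx 0 k + delta_mx 0 l) - D (o + delta_mx 0 k))).
  rewrite /second_quotient /= mulrC; congr (_ * _); rewrite diff2E -/v.
  have -> : psi (x + s *: o + v + v) - 2 * psi (x + s *: o + v) + psi (x + s *: o) =
      D (o + pair_dir R k l) - D o by rewrite /D scalerDr addrA -/v; ring.
  rewrite /pair_dir; case: eqVneq => [_|_] /=; first by rewrite scale0r addr0; ring.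
  by rewrite scale1r addrA; ring.
rewrite /cube_avg (eq_lattice_avg m quotientE) lattice_avgZ lattice_avgD lattice_avgZ.
have Ls0 : 0 <= 2 * (L * s) := le_trans (normr_ge0 _) (D_le 0).
have k_le := le_trans (ler_norm _) (lattice_avg_diff_le k m0 D_le).
have l_le := le_trans (ler_norm _) (lattice_avg_diff_le (E := fun o => D (o + delta_mx 0 k))
  l m0 (fun o => D_le _)).
have {}l_le : (k != l)%:R * lattice_avg m (fun o => D (o + delta_mx 0 k + delta_mx 0 l) -
    D (o + delta_mx 0 k)) <= 2 * (2 * (L * s)) / m%:R.
  case: eqP => _ /=; first by rewrite mul0r divr_ge0 // mulr_ge0.
  rewrite mul1r; apply: le_trans l_le; apply: ler_lattice_avg => j _.
  by rewrite (addrAC (natvec R j)).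
have -> : 8 * L / (s * m%:R) = s ^- 2 * (2 * (2 * (2 * (L * s)) / m%:R)).
  by field; rewrite !gt_eqF.
by rewrite ler_wpM2l ?invr_ge0 ?sqr_ge0 //; lra.
Qed.

Lemma diff2_cube_avg psi s kl W y : 0 < s ->
  diff2 (cube_avg s psi W) (s *: pair_dir R kl.1 kl.2) y =
  s ^+ 2 * cube_avg s (second_quotient psi s kl) W y.
Proof.
move=> s0; rewrite /cube_avg -lattice_avgZ diff2E -mulNr -lattice_avgZ -!lattice_avgD.
apply: eq_lattice_avg => o; rewrite /second_quotient [in RHS]mulrC.
rewrite divfK ?expf_neq0 ?gt_eqF // diff2E; set v := s *: pair_dir R _ _.
by rewrite -!(addrAC _ _ (s *: o)) mulNr.
Qed.

Lemma dist_le_of_sqrt (a b c rho : R) : 0 <= a -> 0 <= b -> 0 <= rho <= 1 ->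
  Num.sqrt b <= c -> (Num.sqrt a - Num.sqrt b) ^+ 2 <= rho ^+ 2 ->
  `|a - b| <= rho * (2 * c + 1).
Proof.
move=> a0 b0 /andP[r0 r1] bc.
rewrite -[X in X <= _]real_normK ?num_real // ler_sqr ?nnegrE // => h.
rewrite -{1}(sqr_sqrtr a0) -{1}(sqr_sqrtr b0) subr_sqr normrM.
have sa := sqrtr_ge0 a; have sb := sqrtr_ge0 b.
apply: ler_pM => //; move: h; rewrite ler_norml => /andP[? ?].
by rewrite ger0_norm ?addr_ge0 //; lra.
Qed.

Lemma window_width (K eta : R) : 0 <= K -> 0 < eta ->
  exists w (tau : R), [/\ (1 < w)%N, 0 < tau <= 1 &
    forall kap d : R, 0 <= kap <= K ->
      (1 - w%:R^-1) ^+ n * (kap - tau) <= d <= (1 + w%:R^-1) ^+ n * (kap + tau) ->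
      `|d - kap| <= eta].
Proof.
move=> K0 eta0; pose P := (2 ^ n)%:R : R.
pose tau := Num.min 1 (eta / 2); pose w := (Num.bound (P * (K + 1) / (eta / 2))).+2.
have tau0 : 0 < tau by rewrite lt_min ltr01 divr_gt0.
have tau1 : tau <= 1 by rewrite ge_min lexx.
have tau_eta : tau <= eta / 2 by rewrite ge_min lexx orbT.
exists w, tau; split => //; first by rewrite tau0.
move=> kap d /andP[kap0 kapK]; pose a : R := w%:R^-1; rewrite -/a.
have w0 : 0 < w%:R :> R by rewrite ltr0n.
have a01 : 0 <= a <= 1 by rewrite /a invr_ge0 ltW //= invf_le1 // ler1n.
have /andP[a0 a1] := a01.
have Pa : P * a * (K + 1) <= eta / 2.
  rewrite mulrAC ler_pdivrMr // [leRHS]mulrC -ler_pdivrMr ?divr_gt0 //.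
  apply: (@le_trans _ _ (Num.bound (P * (K + 1) / (eta / 2)))%:R); last first.
    by rewrite ler_nat; exact/leqW/leqnSn.
  by rewrite ltW // archi_boundP // divr_ge0 ?divr_ge0 ?(ltW eta0) // mulr_ge0 // addr_ge0.
have := exprD1_le n a01; have := expr1B_ge n a01; rewrite -/P.
have : (1 - a) ^+ n <= 1 by rewrite exprn_ile1 ?subr_ge0 // gerBl.
have : n%:R * a <= P * a by rewrite ler_wpM2r // ler_nat ltnW // ltn_expl.
have : 0 <= P * a by rewrite mulr_ge0.
move: (P * a) Pa (n%:R * a) (_ ^+ n) (_ ^+ n) => e e_eta e' up low e0 e'e low1 low_ge up_le.
move=> /andP[d1 d2].
have : e * (kap + tau) <= e * (K + 1) by rewrite ler_wpM2l //; lra.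
have : up * (kap + tau) <= (1 + e) * (kap + tau) by rewrite ler_wpM2r //; lra.
have : (1 - e) * kap <= low * kap by rewrite ler_wpM2r //; lra.
have : e * kap <= e * (K + 1) by rewrite ler_wpM2l //; lra.
have : low * tau <= 1 * tau by rewrite ler_wpM2r // ltW.
by rewrite ler_norml => *; apply/andP; split; lra.
Qed.

Definition sqrt_avg_bound L (R0 : R) : R := \sum_(kl : 'I_n * 'I_n) Num.sqrt (8 * L / R0).

Lemma sqrt_avg_bound_ge0 L (R0 : R) : 0 <= sqrt_avg_bound L R0.
Proof. by apply: sumr_ge0 => *; exact: sqrtr_ge0. Qed.

(* Convexity makes the second quotients nonnegative, the Lipschitz bound controls their mean
   over the initial cube, whatever the mesh [s]. *)
Lemma exists_stable_second_quotients psi L (R0 tau : R) m :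
  convex psi -> coord_lipschitz L psi -> 0 < R0 -> 0 < tau <= 1 -> (0 < m)%N ->
  exists s l x, [/\ 0 < s, (0 < l)%N, forall k, 0 <= x 0 k <= R0 - s * (m * l)%:R,
    forall kl, cube_avg s (second_quotient psi s kl) (m * l) x <= sqrt_avg_bound L R0 ^+ 2 &
    forall kl j, in_cube m j ->
      `|cube_avg s (second_quotient psi s kl) l (x + (s * l%:R) *: natvec R j) -
        cube_avg s (second_quotient psi s kl) (m * l) x| <= tau].
Proof.
move=> cvx lip R00 /andP[tau0 tau1] m0; pose S := sqrt_avg_bound L R0.
have S0 : 0 <= S := sqrt_avg_bound_ge0 L R0.
have den0 : 0 < 2 * S + 1 by lra.
pose rho := tau / (2 * S + 1).
have rho0 : 0 < rho by rewrite divr_gt0.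
have rho1 : rho <= 1 by rewrite ler_pdivrMr // mul1r; lra.
have mn0 : 0 < (m ^ n)%:R :> R by exact: expn_gt0r.
pose theta := rho ^+ 2 / (2 * (S + 1) * (m ^ n)%:R).
have den1 : 0 < 2 * (S + 1) * (m ^ n)%:R by rewrite mulr_gt0 //; lra.
have theta0 : 0 < theta by rewrite divr_gt0 // exprn_gt0.
have S_theta : 2 * S * (m ^ n)%:R * theta <= rho ^+ 2.
  rewrite /theta mulrA ler_pdivrMr // mulrC ler_wpM2l ?sqr_ge0 //.
  by rewrite ler_wpM2r // ?ltW //; lra.
pose T := Num.bound (S / theta).
have ST : S < T%:R * theta.
  by rewrite -ltr_pdivrMr // archi_boundP // divr_ge0 // ltW.
pose s := R0 / (m ^ T)%:R.
have mT0 : 0 < (m ^ T)%:R :> R by rewrite ltr0n expn_gt0 m0.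
have s0 : 0 < s by rewrite divr_gt0.
have smT : s * (m ^ T)%:R = R0 by rewrite divfK // gt_eqF.
pose g := second_quotient psi s.
have g0 kl y : 0 <= g kl y by exact: second_quotient_ge0.
have root : sum_sqrt_avg s g (m ^ T) 0 <= S.
  apply: ler_sum => kl _; apply: ler_wsqrtr.
  by rewrite -[in leRHS]smT; apply: cube_avg_second_quotient_le; rewrite ?expn_gt0 ?m0.
have [t [x [_ xR xle stable]]] :=
  exists_stable_cube (ltW s0) theta0 m0 (le_lt_trans root ST).
rewrite expnS in xR xle; have xS := le_trans xle root; exists s, (m ^ t)%N, x.
have sqrt_le kl : Num.sqrt (cube_avg s (g kl) (m * m ^ t) x) <= S.
  by apply: le_trans xS; exact: sqrt_avg_le_sum.
have avg0 kl : 0 <= cube_avg s (g kl) (m * m ^ t) x by exact: cube_avg_ge0.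
split; rewrite ?expn_gt0 ?m0 //.
- by move=> k; have := xR k; rewrite !mxE subr0 smT.
- by move=> kl; rewrite -[leLHS](sqr_sqrtr (avg0 kl)) ler_pXn2r ?nnegrE ?sqrtr_ge0.
move=> kl j jm; rewrite -[tau](divfK (lt0r_neq0 den0)) -/rho.
apply: dist_le_of_sqrt => //; rewrite ?(ltW rho0) ?cube_avg_ge0 //.
apply: le_trans S_theta; apply: le_trans (stable_cube_sqrt_close _ _ m0 stable jm) _ => //.
by apply: ler_wpM2r; [exact: ltW|apply: ler_wpM2r; [exact: ltW|rewrite ler_wpM2l]].
Qed.

Lemma exists_window psi L (R0 eta : R) :
  convex psi -> coord_lipschitz L psi -> 0 < R0 -> 0 < eta ->
  exists2 w, (1 < w)%N & forall m, (0 < m)%N ->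
  exists s l x (kap : 'I_n -> 'I_n -> R),
    [/\ 0 < s, (0 < l)%N, forall k, 0 <= x 0 k <= R0 - s * (m * l)%:R,
      (forall k k', kap k k' = kap k' k) /\
      (forall k k', 0 <= kap k k' <= sqrt_avg_bound L R0 ^+ 2) &
      forall k k' j, (forall q, j q + w.+1 * l <= m * l)%N ->
        `|diff2 (cube_avg s psi (w * l)) (s *: pair_dir R k k') (x + s *: natvec R j)
          - s ^+ 2 * kap k k'| <= eta * s ^+ 2].
Proof.
move=> cvx lip R00 eta0.
have [w [tau [w1 /andP[tau0 tau1] close]]] := window_width (sqr_ge0 (sqrt_avg_bound L R0)) eta0.
exists w => // m m0.
have [|s [l [x [s0 l0 xR avg_le near]]]] :=
  exists_stable_second_quotients (tau := tau) cvx lip R00 _ m0; first by rewrite tau0.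
have g0 kl y : 0 <= second_quotient psi s kl y by exact: second_quotient_ge0.
pose kap k k' := cube_avg s (second_quotient psi s (k, k')) (m * l) x.
have kap0 k k' : 0 <= kap k k' by exact: cube_avg_ge0.
exists s, l, x, kap; split => //.
  split=> k k'; last by rewrite kap0 avg_le.
  by apply: eq_lattice_avg => o; rewrite /second_quotient /= pair_dirC.
move=> k k' j jm; rewrite (diff2_cube_avg psi (k, k')) // -mulrBr normrM ger0_norm ?sqr_ge0 //.
rewrite mulrC ler_wpM2r ?sqr_ge0 //; apply: close; first by rewrite kap0 avg_le.
have near' i : in_cube m i -> kap k k' - tau <=
    cube_avg s (second_quotient psi s (k, k')) l (x + (s * l%:R) *: natvec R i)
    <= kap k k' + tau.
  by move=> /(near (k, k')); rewrite ler_distl.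
apply/andP; split.
  apply: ger_cube_avg_window near' _ => // q.
  by apply: leq_trans (jm q); rewrite leq_add2l leq_mul2r leqnSn orbT.
apply: ler_cube_avg_window jm => //; first exact: ltnW.
by move=> i /near' /andP[_ ->]; rewrite cube_avg_ge0.
Qed.

Lemma quad_near_window_center psi s (eta K r : R) W M x (kap : 'I_n -> 'I_n -> R)
    (p := x + cube_center n s W + const_mx (2 * r)) :
  (0 < n)%N -> convex psi -> 0 < s -> 0 <= eta -> (0 < W)%N ->
  (forall k k', kap k k' = kap k' k) -> (forall k k', 0 <= kap k k' <= K) ->
  (forall k k' j, (weight j <= n * M + 2)%N ->
    `|diff2 (cube_avg s psi W) (s *: pair_dir R k k') (x + s *: natvec R j)
      - s ^+ 2 * kap k k'| <= eta * s ^+ 2) ->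
  s * M%:R = 4 * r -> 2 * (s * W%:R) <= r ->
  exists b, forall z, (forall k, `|z 0 k| <= r) ->
    `|psi (p + z) - quad (psi p) b (polar_mx kap) z| <=
      56 * n%:R ^+ 2 * eta * (s * M%:R) ^+ 2 + 24 * n%:R ^+ 2 * K * (s * W%:R) ^+ 2.
Proof.
move=> n0 cvx s0 eta0 W0 kapC kapK near sM sW; pose k0 := Ordinal n0.
have [c [b on_lattice]] := quad_on_lattice s0 (mulr_ge0 eta0 (sqr_ge0 s)) kapC near.
pose H := polar_mx kap; have HT : symmetric H := polar_mx_sym kapC.
have HC k k' : `|H k k'| <= 2 * K by exact: polar_mx_le.
have C0 : 0 <= 2 * K := le_trans (normr_ge0 _) (HC k0 k0).
have avg_near_quad j : (forall k, j k <= M)%N ->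
    `|cube_avg s psi W (x + s *: natvec R j) - quad c b H (s *: natvec R j)|
    <= 4 * (eta * s ^+ 2) * (n * M)%:R ^+ 2.
  move=> jM; have jB : (weight j <= n * M)%N.
    by apply: (@leq_trans (\sum_(k < n) M)); [exact: leq_sum|rewrite sum_nat_const card_ord].
  apply: le_trans (on_lattice j jB) _; apply: ler_wpM2l.
    by rewrite mulr_ge0 // mulr_ge0 // sqr_ge0.
  by rewrite ler_pXn2r ?nnegrE // ler_nat.
exists (b + const_mx (2 * r) *m H) => z zr.
apply: le_trans (convex_quad_approx_center cvx s0 HT W0 C0 HC avg_near_quad n0 sM sW zr) _.
by rewrite natrM; lra.
Qed.

Lemma window_center_itv s W (r d R0 : R) x k : 0 < s -> 0 < r -> 4 * r + s * W%:R <= d ->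
  0 <= x 0 k <= R0 - d ->
  0 <= (x + cube_center n s W + const_mx (2 * r) : 'rV_n) 0 k <= R0 - r.
Proof.
move=> s0 r0 fits; have := @cube_center_itv R n s W s0 k; rewrite !mxE.
by move=> /andP[? ?] /andP[? ?]; apply/andP; split; lra.
Qed.

Lemma exists_natr_sqr_ge (a : R) : exists2 q, (1 < q)%N & a <= q%:R ^+ 2.
Proof.
exists (Num.bound `|a|).+2 => //; rewrite -natrX.
apply: (le_trans (ler_norm a)); apply: (le_trans (ltW (archi_boundP (normr_ge0 a)))).
by rewrite ler_nat -mulnn (leq_trans _ (leq_pmull _ _)) // -addn2 leq_addr.
Qed.

Lemma window_error_le (eps K q t : R) : (0 < n)%N -> 0 < eps ->
  48 * n%:R ^+ 2 * K / eps <= q ^+ 2 ->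
  56 * n%:R ^+ 2 * (eps / 2 / (56 * 4 ^+ 2 * n%:R ^+ 2)) * (4 * (q * t)) ^+ 2
    + 24 * n%:R ^+ 2 * K * t ^+ 2 <= eps * (q * t) ^+ 2.
Proof.
move=> n0 eps0; rewrite ler_pdivrMr // => q_ge.
have nr0 : n%:R != 0 :> R by rewrite pnatr_eq0 -lt0n.
have -> : 56 * n%:R ^+ 2 * (eps / 2 / (56 * 4 ^+ 2 * n%:R ^+ 2)) * (4 * (q * t)) ^+ 2 =
    eps / 2 * q ^+ 2 * t ^+ 2 by field.
rewrite exprMn [leRHS]mulrA -mulrDl ler_wpM2r ?sqr_ge0 //; lra.
Qed.

(* Replaces Alexandrov's theorem: second-order differentiability up to [eps], at a single
   scale [r]; it matters that [C] does not depend on [eps]. *)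
Lemma convex_almost_quadratic psi L (R0 : R) : (0 < n)%N ->
  convex psi -> coord_lipschitz L psi -> 0 < R0 ->
  exists2 C : R, 0 <= C & forall eps : R, 0 < eps ->
  exists (p : 'rV[R]_n) (r : R) (H : 'M[R]_n) (b : 'rV[R]_n),
    [/\ 0 < r <= R0, forall k, 0 <= p 0 k <= R0,
      symmetric H, forall k l, `|H k l| <= C &
      forall z, (forall k, `|z 0 k| <= r) ->
        `|psi (p + z) - quad (psi p) b H z| <= eps * r ^+ 2].
Proof.
move=> n0 cvx lip R00; pose K := sqrt_avg_bound L R0 ^+ 2; pose C := 2 * K.
have K0 : 0 <= K by exact: sqr_ge0.
exists C => [|eps eps0]; first by rewrite mulr_ge0.
pose eta := eps / 2 / (56 * 4 ^+ 2 * n%:R ^+ 2).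
have den0 : 0 < 56 * 4 ^+ 2 * n%:R ^+ 2 :> R by rewrite !mulr_gt0 ?exprn_gt0 ?ltr0n.
have eta0 : 0 < eta by rewrite divr_gt0 // divr_gt0.
have [w w1 window] := exists_window cvx lip R00 eta0.
have [q q1 q_ge] := exists_natr_sqr_ge (48 * n%:R ^+ 2 * K / eps).
pose A := (w * q)%N; pose m := (n * (4 * A) + w + 3)%N.
have [|s [l [x [kap [s0 l0 xR [kapC kapK] near]]]]] := window m; first by rewrite addn_gt0 orbT.
pose W := (w * l)%N; pose M := (4 * A * l)%N; pose sig := s * l%:R; pose r := sig * A%:R.
have W0 : (0 < W)%N by rewrite muln_gt0 (ltnW w1).
have sig0 : 0 < sig by rewrite mulr_gt0 // ltr0n.
have r0 : 0 < r by rewrite mulr_gt0 // ltr0n muln_gt0 (ltnW w1) (ltnW q1).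
have rE : r = q%:R * (s * W%:R) by rewrite /r /sig /A /W !natrM; ring.
have sM : s * M%:R = 4 * r by rewrite /M /r /sig !natrM; ring.
have sW : 2 * (s * W%:R) <= r by rewrite rE ler_wpM2r ?ler_nat // mulr_ge0 // ltW.
have near_weight k k' j : (weight j <= n * M + 2)%N ->
    `|diff2 (cube_avg s psi W) (s *: pair_dir R k k') (x + s *: natvec R j)
      - s ^+ 2 * kap k k'| <= eta * s ^+ 2.
  move=> jM; apply: near => i; have := leq_trans (weight_ge j i) jM.
  by rewrite /M /m; move: l0; clear; nia.
have [b approx] :=
  quad_near_window_center n0 cvx s0 (ltW eta0) W0 kapC kapK near_weight sM sW.
exists (x + cube_center n s W + const_mx (2 * r)), r, (polar_mx kap), b.
have fits : 4 * r + s * W%:R <= s * (m * l)%:R.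
  have -> : s * (m * l)%:R = n%:R * (4 * r) + s * W%:R + 3 * sig.
    by rewrite /m /r /sig /W /A !(natrM, natrD); ring.
  by have : r <= n%:R * r by [rewrite ler_peMl ?(ltW r0) // ler1n]; lra.
have p_in k := window_center_itv s0 r0 fits (xR k).
split=> //; first by rewrite r0; have /andP[? ?] := p_in (Ordinal n0); lra.
- by move=> k; have /andP[? ?] := p_in k; apply/andP; split; lra.
- exact: polar_mx_sym.
- by move=> k k'; exact: polar_mx_le.
by move=> z /approx /le_trans; apply; rewrite sM rE; exact: window_error_le.
Qed.

End AlmostQuadratic.

(** * Duality *)

Section SupportFunction.
Variables (R : realType) (n : nat) (T : Type) (S : set T) (a : T -> R).
Variables (z : T -> 'rV[R]_n) (M L : R).
Hypotheses (S_nonempty : S !=set0) (a_le : forall i, S i -> a i <= M).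
Hypothesis z_le : forall i k, S i -> `|z i 0 k| <= L.
Implicit Types (P : 'rV[R]_n) (e : R).

Definition support P : R := sup [set a i + dot P (z i) | i in S].

Let has_sup_support P : has_sup [set a i + dot P (z i) | i in S].
Proof.
have [i0 Si0] := S_nonempty; split; first by exists (a i0 + dot P (z i0)), i0.
exists (M + n%:R * (enorm P * L)) => _ [i Si <-]; apply: lerD; first exact: a_le.
apply: (le_trans (ler_norm _)); apply: dot_le_coord => k; first exact: coord_le_enorm.
exact: z_le.
Qed.

Lemma support_ge i P : S i -> a i + dot P (z i) <= support P.
Proof. by move=> Si; apply: ub_le_sup; [exact: (has_sup_support P).2|exists i]. Qed.

Lemma support_adherent P e : 0 < e -> exists2 i, S i & support P - e < a i + dot P (z i).
Proof.
by move=> e0; have [_ [i Si <-] h] := sup_adherent e0 (has_sup_support P); exists i.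
Qed.

Lemma support_le P e : (forall i, S i -> a i + dot P (z i) <= e) -> support P <= e.
Proof.
by move=> h; apply: ge_sup; [exact: (has_sup_support P).1|move=> _ [i Si <-]; exact: h].
Qed.

Lemma support_convex : convex support.
Proof.
apply/convexP => x y t /andP[t0 t1]; apply: support_le => i Si; rewrite dotDl !dotZl.
have t1' : 0 <= 1 - t by rewrite subr_ge0.
by have := ler_wpM2l t0 (support_ge x Si); have := ler_wpM2l t1' (support_ge y Si); lra.
Qed.

Lemma support_coord_lipschitz : coord_lipschitz L support.
Proof.
have half y k t : support (y + t *: 'e_k) - support y <= L * `|t|.
  rewrite lerBlDr; apply: support_le => i Si; rewrite dotDl dotZl (dotC 'e_k) dot_delta.
  have := support_ge y Si; have : t * z i 0 k <= L * `|t|.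
    by apply: (le_trans (ler_norm _)); rewrite normrM mulrC ler_wpM2r // z_le.
  by lra.
move=> y k t; rewrite ler_norml half andbT lerNl opprB.
by have := half (y + t *: 'e_k) k (- t); rewrite scaleNr addrK normrN.
Qed.

End SupportFunction.

Section Blocks.
Variables (R : realType) (N : nat).
Implicit Types (x y p q : 'rV[R]_N) (S : 'M[R]_(N + N)).

Lemma dot_row x y p q : dot (row_mx x y) (row_mx p q) = dot x p + dot y q.
Proof.
by rewrite /dot big_split_ord /=; congr (_ + _); apply: eq_bigr => k _;
  rewrite ?row_mxEl ?row_mxEr.
Qed.

Lemma enorm_row_sqr x y : enorm (row_mx x y) ^+ 2 = enorm x ^+ 2 + enorm y ^+ 2.
Proof. by rewrite !enorm_sqr dot_row. Qed.

Lemma enorm_row0 x : enorm (row_mx x (0 : 'rV[R]_N)) = enorm x.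
Proof. by rewrite !enorm_dot dot_row dot0r addr0. Qed.

Lemma enorm_0row x : enorm (row_mx (0 : 'rV[R]_N) x) = enorm x.
Proof. by rewrite !enorm_dot dot_row dot0r add0r. Qed.

Lemma enorm_row_le x y : enorm (row_mx x y) <= enorm x + enorm y.
Proof.
have -> : row_mx x y = row_mx x 0 + row_mx 0 y by rewrite add_row_mx addr0 add0r.
by rewrite -(enorm_row0 x) -(enorm_0row y) ler_enormD.
Qed.

Lemma enorm_lsub_le x y : enorm x <= enorm (row_mx x y).
Proof.
by apply: enorm_le; rewrite ?enorm_ge0 // enorm_row_sqr -enorm_sqr lerDl sqr_ge0.
Qed.

Lemma enorm_rsub_le x y : enorm y <= enorm (row_mx x y).
Proof.
by apply: enorm_le; rewrite ?enorm_ge0 // enorm_row_sqr -enorm_sqr lerDr sqr_ge0.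
Qed.

Lemma enorm_row_exchange x1 y1 x2 y2 (a : R) :
  enorm (row_mx x1 y1) <= a -> enorm (row_mx x2 y2) <= a -> enorm (row_mx x1 y2) <= 2 * a.
Proof.
move=> le1 le2; apply: (le_trans (enorm_row_le _ _)).
by have := enorm_lsub_le x1 y1; have := enorm_rsub_le x2 y2; lra.
Qed.

Lemma dot_increments_le x y x0 y0 (bx by' om : 'rV[R]_N) (a g : R) :
  enorm om <= a ->
  enorm (row_mx (x - bx - om) (y - by' + om)) <= g ->
  enorm (row_mx (x0 - bx) (y0 - by')) <= g ->
  dot (x - x0) (y - y0) <= - dot om om + 4 * a * g + 4 * g ^+ 2.
Proof.
set gx := x - bx - om; set gy := y - by' + om; set gx0 := x0 - bx; set gy0 := y0 - by'.
move=> om_a g_le g0_le.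
have dx : enorm (gx - gx0) <= 2 * g.
  apply: (le_trans (ler_enormB _ _)).
  by have := enorm_lsub_le gx gy; have := enorm_lsub_le gx0 gy0; lra.
have dy : enorm (gy - gy0) <= 2 * g.
  apply: (le_trans (ler_enormB _ _)).
  by have := enorm_rsub_le gx gy; have := enorm_rsub_le gx0 gy0; lra.
have -> : x - x0 = om + (gx - gx0) by apply/rowP => k; rewrite !mxE; ring.
have -> : y - y0 = - om + (gy - gy0) by apply/rowP => k; rewrite !mxE; ring.
have := dot_le_mul om_a dy; have := dot_le_mul dx om_a; have := dot_le_mul dx dy.
move: (gx - gx0) (gy - gy0) => d1 d2; rewrite !dotE !ler_norml.
by move=> /andP[_ ?] /andP[? _] /andP[_ ?]; lra.
Qed.

Lemma bil_ulsub S x y : bil S (row_mx x 0) (row_mx y 0) = bil (ulsubmx S) x y.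
Proof. by rewrite /bil -{1}(submxK S) mul_row_block !mul0mx !addr0 dot_row dot0r addr0. Qed.

Lemma bil_drsub S x y : bil S (row_mx 0 x) (row_mx 0 y) = bil (drsubmx S) x y.
Proof. by rewrite /bil -{1}(submxK S) mul_row_block !mul0mx !add0r dot_row dot0r add0r. Qed.

End Blocks.

Section PositiveDefinite.
Variables (R : realType) (n : nat) (H : 'M[R]_n) (alpha : R).
Hypotheses (alpha0 : 0 < alpha) (HT : symmetric H).
Hypothesis H_ge : forall x, alpha * dot x x <= bil H x x.

Lemma posdef_unitmx : H \in unitmx.
Proof.
rewrite -row_free_unit; apply: inj_row_free => x xH.
apply/dot_eq0/eqP; rewrite eq_le dot_ge0 andbT.
by have := H_ge x; rewrite /bil xH dot0l pmulr_rle0.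
Qed.

Lemma invmx_sym : symmetric (invmx H).
Proof. by rewrite /symmetric trmx_inv HT. Qed.

Lemma enorm_invmx_le x : enorm (x *m invmx H) <= enorm x / alpha.
Proof.
set y := x *m invmx H; have yH : y *m H = x by rewrite /y mulmxKV // posdef_unitmx.
have [->|/enorm_gt0 y0] := eqVneq y 0; first by rewrite enorm0 divr_ge0 ?enorm_ge0 // ltW.
rewrite ler_pdivlMr // -(ler_pM2l y0) mulrA -expr2 enorm_sqr mulrC.
apply: (le_trans (H_ge y)); rewrite /bil yH mulrC.
exact: le_trans (ler_norm _) (dot_le_enorm x y).
Qed.

Lemma bil_invmx x y : bil H (x *m invmx H) y = dot x y.
Proof. by rewrite /bil mulmxKV ?posdef_unitmx. Qed.

Lemma bil_invmx_ge0 x : 0 <= bil (invmx H) x x.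
Proof.
have := H_ge (x *m invmx H); rewrite bil_invmx dotC -/(bil _ x x).
by apply: le_trans; rewrite mulr_ge0 ?dot_ge0 // ltW.
Qed.

End PositiveDefinite.

Lemma sqrM_le_half (R : realType) (a r : R) : 0 <= a -> a <= 2^-1 ->
  a ^+ 2 * r ^+ 2 <= a * r ^+ 2 / 2.
Proof.
by move=> a0 a_le; rewrite [leRHS]mulrAC ler_wpM2r ?sqr_ge0 // expr2 ler_wpM2l.
Qed.

(* The functions [P |-> dot P (z t) + w t] lie below [psi], which is quadratic up to a small
   error near [p0]; so the values [w t] lie below the Legendre dual quadratic, and are close
   to it where the bound is nearly attained. *)
Section ApproximateDuality.
Variables (R : realType) (m : nat) (T : Type) (S : set T).
Variables (z : T -> 'rV[R]_m) (w : T -> R) (psi : 'rV[R]_m -> R).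
Variables (alpha C delta r : R) (p0 b : 'rV[R]_m) (H : 'M[R]_m).
Implicit Types (p tau : 'rV[R]_m) (t : T) (a : R).

Definition nearly_attains t p :=
  S t /\ psi (p0 + p) - delta ^+ 2 * r ^+ 2 <= dot (p0 + p) (z t) + w t.

Definition gradient_cst : R := m%:R ^+ 2 * C / 2 + 3.

Hypothesis psi_ge : forall t P, S t -> dot P (z t) + w t <= psi P.
Hypothesis psi_quad : forall p, enorm p <= r ->
  `|psi (p0 + p) - quad (psi p0) b H p| <= delta ^+ 2 * r ^+ 2.
Hypotheses (alpha0 : 0 < alpha) (r0 : 0 < r) (C0 : 0 <= C).
Hypotheses (delta0 : 0 < delta) (delta_le : delta <= 2^-1).
Hypotheses (HT : symmetric H) (HC : forall k l, `|H k l| <= C).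
Hypothesis H_ge : forall x, alpha * dot x x <= bil H x x.

Lemma gradient_cst_ge3 : 3 <= gradient_cst.
Proof. by rewrite lerDr divr_ge0 // mulr_ge0 // sqr_ge0. Qed.

Lemma nearly_attains_gradient t p : enorm p <= r / 2 -> nearly_attains t p ->
  enorm (z t - b - p *m H) <= gradient_cst * delta * r.
Proof.
move=> pr [St attained]; set g := z t - b - _.
have dr0 : 0 < delta * r by rewrite mulr_gt0.
have d2 : 0 <= delta ^+ 2 * r ^+ 2 by rewrite mulr_ge0 ?sqr_ge0.
have mC : 0 <= m%:R ^+ 2 * C by rewrite mulr_ge0 // sqr_ge0.
have dr_le : delta * r <= r / 2 by rewrite [leRHS]mulrC ler_pM2r.
rewrite -(ler_pM2l dr0).
have -> : delta * r * (gradient_cst * delta * r) =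
    gradient_cst * (delta ^+ 2 * r ^+ 2) by ring.
apply: enorm_le_dual => //; first by rewrite mulr_ge0 // (le_trans _ gradient_cst_ge3).
move=> d dt; have dr := le_trans dt dr_le.
have pdr : enorm (p + d) <= r by apply: (le_trans (ler_enormD _ _)); lra.
have {}pr : enorm p <= r by have := enorm_ge0 d; lra.
have := psi_ge (p0 + p + d) St; have := psi_quad pdr; have := psi_quad pr; move: attained.
rewrite -(addrA p0 p d) (quadD _ _ _ _ HT) [quad (quad _ _ _ _) _ _ _]/quad (dotDl b).
rewrite -/(bil H p d) (addrA p0) (dotDl (p0 + p)) !ler_norml => ? /andP[? ?] /andP[? ?] ?.
have := bil_le_enorm d d HC; rewrite ler_norml => /andP[_ dd_le].
have d_le : m%:R ^+ 2 * C * enorm d * enorm d <= m%:R ^+ 2 * C * (delta ^+ 2 * r ^+ 2).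
  by rewrite -mulrA -expr2 -exprMn ler_wpM2l // ler_sqr ?nnegrE ?enorm_ge0 // ltW.
rewrite /g !(dotDr, dotNr) (dotC d b) (dotC d (p *m H)) -/(bil H p d) /gradient_cst.
by move: dd_le d_le d2; lra.
Qed.

Let tilt t : R := w t + dot p0 (z t) - psi p0.

Let enorm_invmx_half tau : enorm tau <= alpha * r / 2 -> enorm (tau *m invmx H) <= r / 2.
Proof.
move=> tau_r; apply: (le_trans (enorm_invmx_le alpha0 H_ge tau)).
by rewrite ler_pdivrMr // [leRHS]mulrC mulrA.
Qed.

Let tilt_upper t tau a : S t -> enorm tau <= alpha * r / 2 -> enorm (z t - b - tau) <= a ->
  tilt t <= - 2^-1 * bil (invmx H) tau tau + r / 2 * a + delta ^+ 2 * r ^+ 2.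
Proof.
move=> St tau_r; set g := z t - b - tau => ga; set p := tau *m invmx H.
have pr : enorm p <= r / 2 by exact: enorm_invmx_half.
have pr' : enorm p <= r by have := r0; lra.
have := psi_ge (p0 + p) St; have := psi_quad pr'.
have := dot_le_mul pr ga; rewrite /quad (bil_invmx alpha0 H_ge) (dotC tau).
rewrite /tilt /g !(dotDl, dotDr, dotNr) (dotC b p) -[bil (invmx H) tau tau]/(dot p tau) !ler_norml.
by move=> /andP[? _] /andP[_ ?] ?; lra.
Qed.

Let tilt_lower t tau : enorm tau <= alpha * r / 2 -> nearly_attains t (tau *m invmx H) ->
  - 2^-1 * bil (invmx H) tau tau - r / 2 * (gradient_cst * delta * r)
    - 2 * (delta ^+ 2 * r ^+ 2) <= tilt t.
Proof.
move=> tau_r attained; set p := tau *m invmx H in attained.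
have pr : enorm p <= r / 2 by exact: enorm_invmx_half.
have pr' : enorm p <= r by have := r0; lra.
have := dot_le_mul pr (nearly_attains_gradient pr attained).
have -> : p *m H = tau by rewrite mulmxKV // (posdef_unitmx alpha0 H_ge).
set g := z t - b - tau; have [St low] := attained; have := psi_quad pr'; move: low.
rewrite /quad (bil_invmx alpha0 H_ge) (dotC tau).
rewrite /tilt /g !(dotDl, dotDr, dotNr) (dotC b p) -[bil (invmx H) tau tau]/(dot p tau) !ler_norml.
by move=> ? /andP[? _] /andP[? ?]; lra.
Qed.

Lemma dual_quad_upper t0 t tau : nearly_attains t0 0 -> S t -> z t = z t0 + tau ->
  enorm tau <= alpha * r / 2 ->
  w t <= w t0 - dot p0 tau - 2^-1 * bil (invmx H) tau tau
    + (gradient_cst + 2) * (delta * r ^+ 2).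
Proof.
move=> at0 St zE tau_r; have r2 : 0 <= r / 2 by rewrite divr_ge0 // ltW.
have low : - 2^-1 * bil (invmx H) 0 0 - r / 2 * (gradient_cst * delta * r)
    - 2 * (delta ^+ 2 * r ^+ 2) <= tilt t0.
  by apply: tilt_lower; rewrite ?mul0mx // enorm0 divr_ge0 // mulr_ge0 ?(ltW r0) // ltW.
have grad : enorm (z t - b - tau) <= gradient_cst * delta * r.
  have := nearly_attains_gradient (p := 0) _ at0; rewrite enorm0 mul0mx subr0.
  rewrite zE (addrAC (z t0) tau) addrK; apply.
  by rewrite divr_ge0 // ltW.
move: (tilt_upper St tau_r grad) low; rewrite /tilt zE dotDr bil0l.
have d2 : 0 <= delta * r ^+ 2 by rewrite mulr_ge0 ?sqr_ge0 // ltW.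
by have := sqrM_le_half r (ltW delta0) delta_le; lra.
Qed.

(* The points form a parallelogram: [t1] and [t2] recombine the components of [t0] and [t]. *)
Lemma dual_quad_cross t0 t t1 t2 (tau1 tau2 : 'rV[R]_m) :
  nearly_attains t0 0 -> nearly_attains t ((tau1 - tau2) *m invmx H) -> S t1 -> S t2 ->
  enorm tau1 <= alpha * r / 4 -> enorm tau2 <= alpha * r / 4 ->
  enorm (z t1 - b - tau1) <= 2 * (gradient_cst * delta * r) ->
  enorm (z t2 - b + tau2) <= 2 * (gradient_cst * delta * r) ->
  z t1 + z t2 = z t + z t0 ->
  bil (invmx H) tau1 tau2 <=
    w t + w t0 - w t1 - w t2 + 3 * (gradient_cst + 1) * (delta * r ^+ 2).
Proof.
move=> at0 att St1 St2 tau1_r tau2_r grad1 grad2 zE.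
have ar : 0 <= alpha * r by rewrite mulr_ge0 ?ltW.
have low0 : - 2^-1 * bil (invmx H) 0 0 - r / 2 * (gradient_cst * delta * r)
    - 2 * (delta ^+ 2 * r ^+ 2) <= tilt t0.
  by apply: tilt_lower; rewrite ?mul0mx // enorm0 divr_ge0.
have low : - 2^-1 * bil (invmx H) (tau1 - tau2) (tau1 - tau2)
    - r / 2 * (gradient_cst * delta * r) - 2 * (delta ^+ 2 * r ^+ 2) <= tilt t.
  by apply: tilt_lower => //; apply: (le_trans (ler_enormB _ _)); lra.
have tau1_r' : enorm tau1 <= alpha * r / 2 by lra.
have tau2_r' : enorm (- tau2) <= alpha * r / 2 by rewrite enormN; lra.
have up1 := tilt_upper St1 tau1_r' grad1.
rewrite -[tau2]opprK in grad2; have up2 := tilt_upper St2 tau2_r' grad2.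
have d2 : 0 <= delta * r ^+ 2 by rewrite mulr_ge0 ?sqr_ge0 // ltW.
have := sqrM_le_half r (ltW delta0) delta_le; have := congr1 (dot p0) zE; rewrite !dotDr.
move: up1 up2 low low0; rewrite /tilt !bilE (bilC tau2 tau1 (invmx_sym HT)).
by lra.
Qed.

End ApproximateDuality.

Section SpringMatrix.
Variables (R : realType) (N : nat).
Implicit Types (kappa : R) (p q : 'rV[R]_N) (z : 'rV[R]_(N + N)).

(* The inverse of [[2, -1], [-1, 2]] * kappa, the Hessian in [(x, y)] of the penalty in
   [doubled]. *)
Definition spring kappa : 'M[R]_(N + N) :=
  block_mx (2 / (3 * kappa))%:M (1 / (3 * kappa))%:M
           (1 / (3 * kappa))%:M (2 / (3 * kappa))%:M.

Lemma spring_sym kappa : symmetric (spring kappa).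
Proof. by rewrite /symmetric /spring tr_block_mx !tr_scalar_mx. Qed.

Lemma mul_row_spring kappa p q : row_mx p q *m spring kappa =
  row_mx ((2 / (3 * kappa)) *: p + (1 / (3 * kappa)) *: q)
         ((1 / (3 * kappa)) *: p + (2 / (3 * kappa)) *: q).
Proof. by rewrite mul_row_block !mul_mx_scalar. Qed.

Lemma bil_spring kappa p q : kappa != 0 ->
  bil (spring kappa) (row_mx p q) (row_mx p q) =
  2 * (dot p p + dot p q + dot q q) / (3 * kappa).
Proof.
by move=> k0; rewrite /bil mul_row_spring dot_row !dotE (dotC q p); field.
Qed.

Lemma spring_ge kappa z : 0 < kappa ->
  1 / (3 * kappa) * dot z z <= bil (spring kappa) z z.
Proof.
move=> k0; rewrite -(hsubmxK z); set p := lsubmx z; set q := rsubmx z.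
rewrite dot_row bil_spring ?gt_eqF // mulrAC ler_pdivrMr ?mulr_gt0 // divfK ?gt_eqF ?mulr_gt0 //.
by have := dot_ge0 (p + q); rewrite !dotE (dotC q p); lra.
Qed.

Lemma spring_le kappa k l : 0 < kappa -> `|spring kappa k l| <= 2 / (3 * kappa).
Proof.
move=> k0; have k3 : 0 < (3 * kappa)^-1 by rewrite invr_gt0 mulr_gt0.
have scalar_le (i j : 'I_N) (a : R) : 0 <= a <= 2 / (3 * kappa) ->
    `|(a%:M : 'M[R]_N) i j| <= 2 / (3 * kappa).
  move=> /andP[a0 a1]; rewrite mxE; case: eqP => _ /=; rewrite ?mulr1n ?mulr0n ?normr0.
    by rewrite ger0_norm.
  by apply: le_trans a1.
have b1 : 0 <= 1 / (3 * kappa) <= 2 / (3 * kappa) by apply/andP; split; lra.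
have b2 : 0 <= 2 / (3 * kappa) <= 2 / (3 * kappa) by apply/andP; split; lra.
rewrite /spring; case: (split_ordP k) => i ->; case: (split_ordP l) => j ->;
  by rewrite ?block_mxEul ?block_mxEur ?block_mxEdl ?block_mxEdr; apply: scalar_le.
Qed.

End SpringMatrix.

Section ConvexHessian.
Variables (R : realType) (n : nat).

Lemma convex_quad_hessian_ge (psi : 'rV[R]_n -> R) p b (H : 'M[R]_n) (r e : R) x :
  convex psi -> 0 < r ->
  (forall z, enorm z <= r -> `|psi (p + z) - quad (psi p) b H z| <= e * r ^+ 2) ->
  - (2 * e) * dot x x <= bil H x x.
Proof.
move=> cvx r0 near; suff : bil (- H) x x <= 2 * e * dot x x by rewrite bilNm; lra.
apply: (bil_le_homogeneous _ r0) => y yr.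
have := convex_midpoint p y cvx; have := near y yr; have := near (- y).
rewrite enormN => /(_ yr); rewrite /quad !(bilE, dotNr) bilNm opprK !ler_norml.
by move=> /andP[? ?] /andP[? ?]; lra.
Qed.

End ConvexHessian.

Definition approx_superjet (R : realType) (N : nat) (D : set 'rV[R]_N) (f : 'rV[R]_N -> R)
    (xi : 'rV[R]_N) (r e : R) (l : 'rV[R]_N) (X : 'M[R]_N) :=
  forall ta, enorm ta <= r -> D (xi + ta) -> f (xi + ta) <= quad (f xi) l X ta + e * r ^+ 2.

Section DoublingVariables.
Variables (R : realType) (N : nat) (kappa : R) (D : set 'rV[R]_N) (u v : 'rV[R]_N -> R).
Implicit Types (x y xi eta om ta : 'rV[R]_N) (P : 'rV[R]_(N + N)).
Local Notation n := (N + N)%N.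
Hypothesis kappa0 : 0 < kappa.

Definition doubled xi eta x y : R := u xi - v eta
  - kappa / 2 * (dot (x - xi) (x - xi) + dot (x - y) (x - y) + dot (y - eta) (y - eta)).

Definition penalized xi eta : R := u xi - v eta - kappa / 6 * dot (xi - eta) (xi - eta).

Definition barycenter xi eta : 'rV[R]_n :=
  row_mx ((2 / 3) *: xi + (1 / 3) *: eta) ((1 / 3) *: xi + (2 / 3) *: eta).

(* Completing the square in [(x, y)]. *)
Lemma doubled_dual P xi eta x y (dx dy : 'rV[R]_N) :
  row_mx x y = barycenter xi eta + P *m spring N kappa + row_mx dx dy ->
  dot P (row_mx x y) + doubled xi eta x y =
  penalized xi eta + dot P (barycenter xi eta) + 2^-1 * bil (spring N kappa) P P
    - kappa / 2 * (dot dx dx + dot (dx - dy) (dx - dy) + dot dy dy).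
Proof.
have k0 : kappa != 0 by rewrite gt_eqF.
have k3 : 3 * kappa != 0 by rewrite mulf_neq0 // pnatr_eq0.
rewrite -(hsubmxK P); pose p := (3 * kappa)^-1 *: lsubmx P; pose q := (3 * kappa)^-1 *: rsubmx P.
have -> : lsubmx P = (3 * kappa) *: p by rewrite scalerA divff // scale1r.
have -> : rsubmx P = (3 * kappa) *: q by rewrite scalerA divff // scale1r.
move: p q => p q; rewrite mul_row_spring !add_row_mx !scalerA !divfK // !scale1r.
move=> /eq_row_mx[xE yE]; pose e := (1 / 3) *: (xi - eta).
rewrite bil_spring // !dot_row /doubled /penalized.
have -> : x - xi = 2 *: p + q + dx - e by rewrite xE; apply/rowP => k; rewrite !mxE; field.
have -> : y - eta = p + 2 *: q + dy + e by rewrite yE; apply/rowP => k; rewrite !mxE; field.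
have -> : x - y = p - q + (dx - dy) + e by rewrite xE yE; apply/rowP => k; rewrite !mxE; field.
have -> : xi - eta = 3 *: e by apply/rowP => k; rewrite !mxE; field.
rewrite xE yE {xE yE}; move: e (_ + _ *: eta) (_ + _ *: eta) => e c d.
rewrite !dotE ?(dotC q p) ?(dotC dx p) ?(dotC dy p) ?(dotC dx q) ?(dotC dy q).
rewrite ?(dotC e p) ?(dotC e q) ?(dotC e dx) ?(dotC e dy) ?(dotC dy dx).
by field.
Qed.

Lemma doubled_le P xi eta x y : dot P (row_mx x y) + doubled xi eta x y <=
  penalized xi eta + dot P (barycenter xi eta) + 2^-1 * bil (spring N kappa) P P.
Proof.
pose d := row_mx x y - (barycenter xi eta + P *m spring N kappa).
rewrite (@doubled_dual _ _ _ _ _ (lsubmx d) (rsubmx d)); last by rewrite hsubmxK addrC subrK.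
by rewrite gerBl mulr_ge0 ?divr_ge0 ?(ltW kappa0) // !addr_ge0 // dot_ge0.
Qed.

Lemma doubled_attained P xi eta : exists x y, dot P (row_mx x y) + doubled xi eta x y =
  penalized xi eta + dot P (barycenter xi eta) + 2^-1 * bil (spring N kappa) P P.
Proof.
pose c := barycenter xi eta + P *m spring N kappa; exists (lsubmx c), (rsubmx c).
rewrite (@doubled_dual _ _ _ _ _ 0 0); last by rewrite hsubmxK row_mx0 addr0.
by rewrite subr0 !dot0l !addr0 mulr0 subr0.
Qed.

Lemma doubled_cross xi eta x y xi0 eta0 x0 y0 :
  doubled xi eta0 x y0 + doubled xi0 eta x0 y =
  doubled xi eta x y + doubled xi0 eta0 x0 y0 - kappa * dot (x - x0) (y - y0).
Proof.
rewrite /doubled; set a := x - xi; set b := y - eta; set a0 := x0 - xi0; set b0 := y0 - eta0.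
rewrite !dotE ?(dotC y x) ?(dotC y0 x) ?(dotC y x0) ?(dotC y0 x0); by field.
Qed.

Lemma doubled_translate xi eta x y tx ty :
  doubled (xi + tx) (eta + ty) (x + tx) (y + ty) = doubled xi eta x y
    + (u (xi + tx) - u xi) - (v (eta + ty) - v eta)
    - kappa * dot (x - y) (tx - ty) - kappa / 2 * dot (tx - ty) (tx - ty).
Proof.
rewrite /doubled !opprD !(addrACA _ tx) !(addrACA _ ty) !subrr !addr0.
move: (tx - ty) (x - y) => t d; rewrite !(dotDl d t) !(dotDr _ d t) (dotC t d); by field.
Qed.

End DoublingVariables.

(** * An approximate theorem on sums *)

Section TheoremOnSums.
Variables (R : realType) (N : nat) (kappa : R) (D : set 'rV[R]_N) (u v : 'rV[R]_N -> R).
Variables (M L : R).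
Implicit Types (x y xi eta om ta : 'rV[R]_N) (P z : 'rV[R]_(N + N)).
Local Notation n := (N + N)%N.
Hypotheses (kappa0 : 0 < kappa) (D_nonempty : D !=set0).
Hypothesis uv_le : forall xi eta, D xi -> D eta -> u xi - v eta <= M.
Hypothesis D_le : forall xi k, D xi -> `|xi 0 k| <= L.

Let pairs : set ('rV[R]_N * 'rV[R]_N) := [set i | D i.1 /\ D i.2].

Let penalized_le i : pairs i -> penalized kappa u v i.1 i.2 <= M.
Proof.
move=> [D1 D2]; apply: le_trans (uv_le D1 D2); rewrite gerBl mulr_ge0 ?dot_ge0 //.
by rewrite divr_ge0 // ltW.
Qed.

Let barycenter_le i k : pairs i -> `|barycenter i.1 i.2 0 k| <= L.
Proof.
move=> [D1 D2]; rewrite /barycenter; case: (split_ordP k) => j ->;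
  rewrite ?row_mxEl ?row_mxEr !mxE; have := D_le j D1; have := D_le j D2;
  by rewrite !ler_norml => /andP[? ?] /andP[? ?]; apply/andP; split; lra.
Qed.

(* The Legendre transform of the doubled function is [coupling] plus half the form of
   [spring kappa]. *)
Definition coupling P : R :=
  support pairs (fun i => penalized kappa u v i.1 i.2) (fun i => barycenter i.1 i.2) P.

Let pairs_nonempty : pairs !=set0.
Proof. by have [xi Dxi] := D_nonempty; exists (xi, xi). Qed.

Lemma coupling_ge xi eta P : D xi -> D eta ->
  penalized kappa u v xi eta + dot P (barycenter xi eta) <= coupling P.
Proof.
by move=> Dxi Deta; exact: (support_ge pairs_nonempty penalized_le barycenter_le
  (i := (xi, eta)) P (conj Dxi Deta)).
Qed.

Lemma coupling_adherent P e : 0 < e -> exists xi eta,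
  [/\ D xi, D eta & coupling P - e < penalized kappa u v xi eta + dot P (barycenter xi eta)].
Proof.
move=> e0; have [[xi eta] [Dxi Deta] lt_e] :=
  support_adherent pairs_nonempty penalized_le barycenter_le P e0.
by exists xi, eta.
Qed.

Lemma coupling_convex : convex coupling.
Proof. exact: support_convex pairs_nonempty penalized_le barycenter_le. Qed.

Lemma coupling_coord_lipschitz : coord_lipschitz L coupling.
Proof. exact: support_coord_lipschitz pairs_nonempty penalized_le barycenter_le. Qed.

Definition coupling_alpha : R := 1 / (6 * kappa).

Let coupling_alpha_gt0 : 0 < coupling_alpha.
Proof. by rewrite divr_gt0 // mulr_gt0. Qed.

Definition cross_cst (c : R) : R := kappa * (coupling_alpha * c + 2 * c ^+ 2) + 3 * (c + 1).

Definition sums_cst (C : R) : R :=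
  let c := gradient_cst n (C + 2 / (3 * kappa)) in 2 * cross_cst c + c + 2.

Let cross_cst_ge0 c : 0 <= c -> 0 <= cross_cst c.
Proof.
move=> c0; rewrite addr_ge0 //; last by lra.
by rewrite mulr_ge0 ?(ltW kappa0) // addr_ge0 // mulr_ge0 ?sqr_ge0 // ltW.
Qed.

Let gradient_cst_ge0 C : 0 <= C -> 0 <= gradient_cst n (C + 2 / (3 * kappa)).
Proof.
move=> C0; apply: le_trans (gradient_cst_ge3 _ _) => //.
by rewrite addr_ge0 // divr_ge0 // mulr_ge0 // ltW.
Qed.

Let sums_cst_gt0 C : 0 <= C -> 0 < sums_cst C.
Proof.
move=> /gradient_cst_ge0 c0; have := cross_cst_ge0 c0; rewrite /sums_cst; move: c0.
by move: (gradient_cst _ _) => c; lra.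
Qed.

Section AtQuadraticPoint.
Variables (p0 b0 : 'rV[R]_n) (r delta C : R) (H0 : 'M[R]_n).
Hypotheses (r0 : 0 < r) (C0 : 0 <= C) (delta0 : 0 < delta) (delta_le : delta <= 2^-1).
Hypotheses (H0T : symmetric H0) (H0C : forall k l, `|H0 k l| <= C).
Hypothesis coupling_quad : forall z, enorm z <= r ->
  `|coupling (p0 + z) - quad (coupling p0) b0 H0 z| <= delta ^+ 2 * r ^+ 2.

Hypothesis delta_le_alpha : delta <= coupling_alpha.

Let psi P : R := coupling P + 2^-1 * bil (spring N kappa) P P.
Let H : 'M[R]_n := H0 + spring N kappa.
Let b : 'rV[R]_n := b0 + p0 *m spring N kappa.
Let C1 : R := C + 2 / (3 * kappa).
Let S : 'M[R]_n := invmx H.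
Let cst := gradient_cst n C1.

Let contact := ('rV[R]_N * 'rV[R]_N * ('rV[R]_N * 'rV[R]_N))%type.
Let admissible : set contact := [set t | D t.1.1 /\ D t.1.2].
Let point (t : contact) : 'rV[R]_n := row_mx t.2.1 t.2.2.
Let value (t : contact) : R := doubled kappa u v t.1.1 t.1.2 t.2.1 t.2.2.

Let psi_ge t P : admissible t -> dot P (point t) + value t <= psi P.
Proof.
move=> [D1 D2]; apply: (le_trans (doubled_le _ _ kappa0 P _ _ _ _)).
by rewrite lerD2r; exact: coupling_ge.
Qed.

Let psi_quad P : enorm P <= r -> `|psi (p0 + P) - quad (psi p0) b H P| <= delta ^+ 2 * r ^+ 2.
Proof.
move=> /coupling_quad; congr (`|_| <= _).
rewrite /psi /quad /b /H bilDm dotDl -/(bil (spring N kappa) p0 P).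
by rewrite !(bilDl, bilDr) (bilC P p0 (spring_sym N kappa)); field.
Qed.

Let HT : symmetric H.
Proof. by rewrite /symmetric /H linearD /= H0T spring_sym. Qed.

Let HC k l : `|H k l| <= C1.
Proof. by rewrite mxE; apply: (le_trans (ler_normD _ _)); apply: lerD => //; exact: spring_le. Qed.

Let C1_ge0 : 0 <= C1.
Proof. by rewrite addr_ge0 // divr_ge0 // mulr_ge0 // ltW. Qed.

Let H_ge P : coupling_alpha * dot P P <= bil H P P.
Proof.
have := convex_quad_hessian_ge P coupling_convex r0 coupling_quad.
have := spring_ge P kappa0; rewrite /H bilDm.
have -> : 1 / (3 * kappa) = 2 * coupling_alpha by rewrite /coupling_alpha; field; rewrite gt_eqF.
have : 2 * delta ^+ 2 * dot P P <= coupling_alpha * dot P P.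
  apply: ler_wpM2r; rewrite ?dot_ge0 //; apply: le_trans delta_le_alpha.
  by have := ler_wpM2l (ltW delta0) delta_le; rewrite expr2; lra.
by lra.
Qed.

Let exists_contact P : exists t, nearly_attains admissible point value psi delta r p0 t P.
Proof.
have e0 : 0 < delta ^+ 2 * r ^+ 2 by rewrite mulr_gt0 // exprn_gt0.
have [xi [eta [Dxi Deta lt_e]]] := coupling_adherent (p0 + P) e0.
have [x [y xyE]] := doubled_attained u v kappa0 (p0 + P) xi eta.
exists ((xi, eta), (x, y)); split=> //=; rewrite xyE /psi; lra.
Qed.

Let touching t := nearly_attains admissible point value psi delta r p0 t 0.

Let joint_superjet t tx ty : touching t ->
  D (t.1.1 + tx) -> D (t.1.2 + ty) -> enorm (row_mx tx ty) <= coupling_alpha * r / 2 ->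
  u (t.1.1 + tx) - v (t.1.2 + ty) <= u t.1.1 - v t.1.2 + kappa * dot (t.2.1 - t.2.2) (tx - ty)
    + kappa / 2 * dot (tx - ty) (tx - ty) - dot p0 (row_mx tx ty)
    - 2^-1 * bil S (row_mx tx ty) (row_mx tx ty) + (cst + 2) * (delta * r ^+ 2).
Proof.
case: t => [[xi eta] [x y]] /= at0 Dx Dy small.
pose t' : contact := ((xi + tx, eta + ty), (x + tx, y + ty)).
have pointE : point t' = point ((xi, eta), (x, y)) + row_mx tx ty.
  by rewrite /point /= add_row_mx.
have adm : admissible t' by [].
have := dual_quad_upper psi_ge psi_quad coupling_alpha_gt0 r0 C1_ge0 delta0 delta_le HT HC H_ge
  at0 adm pointE small.
by rewrite /value /= doubled_translate -/cst -/S; lra.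
Qed.

Let X : 'M[R]_N := kappa%:M - ulsubmx S.
Let Y : 'M[R]_N := kappa%:M - drsubmx S.

Let superjet_left t ta : touching t -> enorm ta <= coupling_alpha * r / 2 ->
  D (t.1.1 + ta) -> u (t.1.1 + ta) <=
    quad (u t.1.1) (kappa *: (t.2.1 - t.2.2) - lsubmx p0) X ta + (cst + 2) * (delta * r ^+ 2).
Proof.
move=> at0 small Da; have [[_ Deta] _] := at0.
have := joint_superjet at0 Da (_ : D (t.1.2 + 0)); rewrite addr0 enorm_row0 => /(_ Deta small).
rewrite -{1}(hsubmxK p0) dot_row dot0r bil_ulsub subr0 /quad bilDm bilNm bil_scalar.
by rewrite (dotDl (kappa *: _)) dotZl dotNl; lra.
Qed.

Let superjet_right t ta : touching t -> enorm ta <= coupling_alpha * r / 2 ->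
  D (t.1.2 + ta) -> - v (t.1.2 + ta) <=
    quad (- v t.1.2) (kappa *: (t.2.2 - t.2.1) - rsubmx p0) Y ta + (cst + 2) * (delta * r ^+ 2).
Proof.
move=> at0 small Da; have [[Dxi _] _] := at0.
have := joint_superjet at0 (_ : D (t.1.1 + 0)) Da; rewrite addr0 enorm_0row => /(_ Dxi small).
rewrite -{1}(hsubmxK p0) dot_row dot0r bil_drsub sub0r /quad bilDm bilNm bil_scalar.
by rewrite -(opprB t.2.1) !(dotDl (kappa *: _), dotZl, dotNl, dotNr); lra.
Qed.

Let point_sub t : point t - b = row_mx (t.2.1 - lsubmx b) (t.2.2 - rsubmx b).
Proof. by rewrite -[in LHS](hsubmxK b) opp_row_mx add_row_mx. Qed.

Let hessian_sum_le t om : touching t -> enorm om <= coupling_alpha * r / 4 ->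
  bil X om om + bil Y om om <= 2 * cross_cst cst * (delta * r ^+ 2).
Proof.
case: t => [[xi0 eta0] [x0 y0]] at0 om_r; have [[/= Dxi0 Deta0] _] := at0.
pose tau1 := row_mx om (0 : 'rV[R]_N); pose tau2 := row_mx (0 : 'rV[R]_N) om.
have [[[xi eta] [x y]] att] := exists_contact ((tau1 - tau2) *m S).
have [[/= Dxi Deta] _] := att; pose g := cst * delta * r.
have grad0 : enorm (row_mx (x0 - lsubmx b) (y0 - rsubmx b)) <= g.
  have := nearly_attains_gradient psi_ge psi_quad r0 C1_ge0 delta0 delta_le HT HC _ at0.
  by rewrite mul0mx subr0 point_sub; apply; rewrite enorm0 divr_ge0 // ltW.
have tauE : tau1 - tau2 = row_mx om (- om).
  by rewrite /tau1 /tau2 opp_row_mx add_row_mx subr0 sub0r.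
have grad : enorm (row_mx (x - lsubmx b - om) (y - rsubmx b + om)) <= g.
  have := nearly_attains_gradient psi_ge psi_quad r0 C1_ge0 delta0 delta_le HT HC _ att.
  rewrite mulmxKV ?(posdef_unitmx coupling_alpha_gt0 H_ge) // point_sub tauE.
  rewrite opp_row_mx add_row_mx opprK.
  apply; apply: (le_trans (enorm_invmx_le coupling_alpha_gt0 H_ge _)).
  rewrite ler_pdivrMr //; apply: (le_trans (enorm_row_le _ _)).
  by rewrite enormN; lra.
have grad1 : enorm (point ((xi, eta0), (x, y0)) - b - tau1) <= 2 * g.
  rewrite point_sub /tau1 opp_row_mx add_row_mx subr0; exact: enorm_row_exchange grad grad0.
have grad2 : enorm (point ((xi0, eta), (x0, y)) - b + tau2) <= 2 * g.
  rewrite point_sub /tau2 add_row_mx addr0; exact: enorm_row_exchange grad0 grad.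
have om_r1 : enorm tau1 <= coupling_alpha * r / 4 by rewrite enorm_row0.
have om_r2 : enorm tau2 <= coupling_alpha * r / 4 by rewrite enorm_0row.
have adm1 : admissible ((xi, eta0), (x, y0)) by [].
have adm2 : admissible ((xi0, eta), (x0, y)) by [].
have pointE : point ((xi, eta0), (x, y0)) + point ((xi0, eta), (x0, y)) =
    point ((xi, eta), (x, y)) + point ((xi0, eta0), (x0, y0)).
  by rewrite /point /= !add_row_mx (addrC y0).
have := dual_quad_cross psi_ge psi_quad coupling_alpha_gt0 r0 C1_ge0 delta0 delta_le HT HC H_ge
  at0 att adm1 adm2 om_r1 om_r2 grad1 grad2 pointE.
have := doubled_cross kappa u v xi eta x y xi0 eta0 x0 y0.
have /(ler_wpM2l (ltW kappa0)) := dot_increments_le om_r grad grad0.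
have := bil_invmx_ge0 coupling_alpha_gt0 H_ge (tau1 + tau2).
rewrite !(bilDl, bilDr) (bilC tau2 tau1 (invmx_sym HT)) -/S !bil_ulsub !bil_drsub.
rewrite /X /Y !(bilDm, bilNm, bil_scalar) /value /= -/cst.
have k4 : 0 <= kappa * (4 * cst ^+ 2) by rewrite mulr_ge0 ?(ltW kappa0) // mulr_ge0 // sqr_ge0.
have := ler_wpM2l k4 (sqrM_le_half r (ltW delta0) delta_le).
by rewrite /g /cross_cst; lra.
Qed.

Lemma sums_at_quadratic_point eps :
  16 * (sums_cst C * delta) <= eps * coupling_alpha ^+ 2 ->
  exists xi0 eta0 (l1 l2 : 'rV[R]_N) (X Y : 'M[R]_N),
  [/\ [/\ D xi0, D eta0, symmetric X & symmetric Y],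
    coupling p0 - delta ^+ 2 * r ^+ 2 <=
      penalized kappa u v xi0 eta0 + dot p0 (barycenter xi0 eta0),
    approx_superjet D u xi0 (coupling_alpha * r / 4) eps l1 X,
    approx_superjet D (fun y => - v y) eta0 (coupling_alpha * r / 4) eps l2 Y &
    forall om, bil X om om + bil Y om om <= eps * dot om om].
Proof.
move=> delta_eps; have [t at0] := exists_contact 0; have [[Dxi Deta] low] := at0.
have ar : 0 < coupling_alpha * r by rewrite mulr_gt0.
have radius ta : enorm ta <= coupling_alpha * r / 4 -> enorm ta <= coupling_alpha * r / 2 by lra.
have cst0 : 0 <= cst := gradient_cst_ge0 C0; have cross0 := cross_cst_ge0 cst0.
have error a : a <= sums_cst C ->
    a * (delta * r ^+ 2) <= eps * (coupling_alpha * r / 4) ^+ 2.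
  move=> a_le; have dr : 0 <= delta * r ^+ 2 by rewrite mulr_ge0 ?sqr_ge0 // ltW.
  have := ler_wpM2r dr a_le; have := ler_wpM2r (sqr_ge0 r) delta_eps.
  by move: (sums_cst C) => K; lra.
exists t.1.1, t.1.2, (kappa *: (t.2.1 - t.2.2) - lsubmx p0).
exists (kappa *: (t.2.2 - t.2.1) - rsubmx p0), X, Y; split.
- have S_sym : symmetric S := invmx_sym HT.
  by split; rewrite // /symmetric linearB /= tr_scalar_mx ?trmx_ulsub ?trmx_drsub S_sym.
- have := doubled_le u v kappa0 p0 t.1.1 t.1.2 t.2.1 t.2.2.
  by move: low; rewrite addr0 /psi /value /point; lra.
- move=> ta /radius ta_r Da; apply: (le_trans (superjet_left at0 ta_r Da)).
  by rewrite lerD2l; apply: error; rewrite /sums_cst -/C1 -/cst; lra.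
- move=> ta /radius ta_r Da; apply: (le_trans (superjet_right at0 ta_r Da)).
  by rewrite lerD2l; apply: error; rewrite /sums_cst -/C1 -/cst; lra.
move=> om; rewrite -bilDm; apply: (@bil_le_homogeneous _ _ _ _ (coupling_alpha * r / 4)).
  by rewrite divr_gt0.
move=> y y_r; rewrite bilDm; apply: (le_trans (hessian_sum_le at0 y_r)).
by apply: error; rewrite /sums_cst -/C1 -/cst; lra.
Qed.

End AtQuadraticPoint.

Let coupling_diag_ge P (a : R) xi xi0 eta0 : (forall k, `|P 0 k| <= a) ->
  D xi -> D xi0 -> D eta0 ->
  u xi - v xi - 4 * N%:R * a * L <= coupling P - dot P (barycenter xi0 eta0).
Proof.
move=> P_le Dx Dxi Deta; have := coupling_ge P Dx Dx.
rewrite {1}/penalized subrr dot0l mulr0 subr0.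
have bary_le k : `|(barycenter xi0 eta0 - barycenter xi xi) 0 k| <= 2 * L.
  rewrite mxE [X in _ + X]mxE; apply: (le_trans (ler_normB _ _)).
  rewrite mulr2n mulrDl mul1r lerD //.
    exact: (barycenter_le (i := (xi0, eta0)) k (conj Dxi Deta)).
  exact: (barycenter_le (i := (xi, xi)) k (conj Dx Dx)).
have := dot_le_coord P_le bary_le; rewrite dotDr dotNr natrD ler_norml => /andP[_].
by lra.
Qed.

Lemma approximate_theorem_on_sums (R0 eps : R) :
  (0 < N)%N -> 1 <= kappa -> 0 < R0 <= 1 -> 0 < eps ->
  exists (r : R) xi0 eta0 (l1 l2 : 'rV[R]_N) (X Y : 'M[R]_N),
  [/\ [/\ 0 < r <= R0, D xi0, D eta0, symmetric X & symmetric Y],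
    forall xi, D xi -> u xi - v xi - eps - 4 * N%:R * R0 * L <= penalized kappa u v xi0 eta0,
    approx_superjet D u xi0 r eps l1 X,
    approx_superjet D (fun y => - v y) eta0 r eps l2 Y &
    forall om, bil X om om + bil Y om om <= eps * dot om om].
Proof.
move=> N0 kappa1 /andP[R00 R01] eps0; have n0 : (0 < n)%N by rewrite addn_gt0 N0.
have [C C0 quadratic] :=
  convex_almost_quadratic n0 coupling_convex coupling_coord_lipschitz R00.
pose alpha := coupling_alpha.
have alpha0 : 0 < alpha := coupling_alpha_gt0.
have alpha1 : alpha <= 1 by rewrite ler_pdivrMr ?mulr_gt0 // mul1r; lra.
have K0 := sums_cst_gt0 C0; have K16 : 0 < 16 * sums_cst C by rewrite mulr_gt0.
pose delta := Num.min (Num.min 2^-1 alpha) (Num.min eps (eps * alpha ^+ 2 / (16 * sums_cst C))).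
have delta0 : 0 < delta.
  by rewrite !lt_min alpha0 eps0 invr_gt0 ltr0n /= divr_gt0 // mulr_gt0 // exprn_gt0.
have delta_half : delta <= 2^-1 by rewrite !ge_min lexx.
have delta_alpha : delta <= alpha by rewrite !ge_min lexx !orbT.
have delta_eps : delta <= eps by rewrite !ge_min lexx !orbT.
have delta_K : 16 * (sums_cst C * delta) <= eps * alpha ^+ 2.
  have : delta <= eps * alpha ^+ 2 / (16 * sums_cst C) by rewrite !ge_min lexx !orbT.
  by rewrite ler_pdivlMr //; lra.
have [|p0 [r [H [b [/andP[r0 rR0] p0R HT HC near]]]]] := quadratic (delta ^+ 2).
  by rewrite exprn_gt0.
have near_ball z : enorm z <= r ->
    `|coupling (p0 + z) - quad (coupling p0) b H z| <= delta ^+ 2 * r ^+ 2.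
  by move=> zr; apply: near => k; exact: le_trans (coord_le_enorm _ _) zr.
have [xi0 [eta0 [l1 [l2 [X [Y [[Dxi Deta XT YT] near_max jet_u jet_v XY]]]]]]] :=
  sums_at_quadratic_point r0 C0 delta0 delta_half HT HC near_ball delta_alpha delta_K.
have ar : 0 < alpha * r by rewrite mulr_gt0.
exists (alpha * r / 4), xi0, eta0, l1, l2, X, Y; split => //.
  split=> //; rewrite divr_gt0 //=.
  by have : alpha * r <= r by [rewrite ler_piMl // ltW]; lra.
have p0_le k : `|p0 0 k| <= R0 by have /andP[? ?] := p0R k; rewrite ger0_norm.
move=> xi Dx; have := coupling_diag_ge p0_le Dx Dxi Deta.
have : delta ^+ 2 * r ^+ 2 <= eps.
  have : delta * r ^+ 2 <= delta * 1.
    by rewrite ler_wpM2l ?(ltW delta0) // exprn_ile1 ?(ltW r0) // (le_trans rR0).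
  by have := sqrM_le_half r (ltW delta0) delta_half; lra.
by move: near_max; lra.
Qed.

End TheoremOnSums.

(** * Eigenvalues *)

Section ContinuityOfForms.
Variables (R : realType) (n : nat).

Lemma continuous_dot (b : 'rV[R]_n) : continuous (dot b).
Proof.
apply: continuous_big => [|k _ x]; first exact: add_continuous.
by apply: continuousM; [exact: cst_continuous|exact: coord_continuous].
Qed.

Lemma continuous_bil (A : 'M[R]_n) : continuous (fun x => bil A x x).
Proof.
apply: continuous_big => [|k _ x]; first exact: add_continuous.
apply: continuousM; last exact: coord_continuous.
rewrite (_ : (fun _ => _) = dot (col k A)^T); first exact: continuous_dot.
by apply/funext => y; rewrite mxE; apply: eq_bigr => l _; rewrite !mxE mulrC.
Qed.

End ContinuityOfForms.

Section Spectral.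
Variable R : realType.

Lemma bil_psd_kernel n (B : 'M[R]_n) v : symmetric B -> (forall x, 0 <= bil B x x) ->
  bil B v v = 0 -> v *m B = 0.
Proof.
move=> BT B0 vB; apply: dot_eq0; set y := v *m B.
have parabola t : 0 <= 2 * t * dot y y + t ^+ 2 * bil B y y.
  have := B0 (v + t *: y); rewrite !(bilDl, bilDr, bilZl, bilZr) vB (bilC y v BT).
  by rewrite -[bil B v y]/(dot y y); congr (_ <= _); ring.
apply/eqP; rewrite eq_le dot_ge0 andbT.
have [b0|b0] := eqVneq (bil B y y) 0.
  by have := parabola (- 1); rewrite b0; lra.
have bp : 0 < bil B y y by rewrite lt_def b0 B0.
have := parabola (- (dot y y / bil B y y)).
rewrite (_ : _ + _ = - (dot y y ^+ 2 / bil B y y)); last by field.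
rewrite oppr_ge0 pmulr_lle0 ?invr_gt0 // => h.
by rewrite le_eqVlt -sqrf_eq0 eq_le h sqr_ge0.
Qed.

Lemma compact_sphere n : compact [set x : 'rV[R]_n | dot x x = 1].
Proof.
apply: bounded_closed_compact.
  exists 1; split=> [|M M1 x /= x1]; first exact: num_real.
  apply: (le_trans (norm_le_enorm x)); apply: enorm_le; first by rewrite (le_trans ler01) // ltW.
  by rewrite x1 expr2 mulr_ege1 // ltW.
rewrite (_ : [set x | _] = (fun x => bil 1%:M x x) @^-1` [set 1]).
  by apply: preimage_closed => [x _|]; [exact: continuous_bil|exact: closed_eq].
by apply/seteqP; split => x /=; rewrite bil_scalar mul1r.
Qed.

(* A maximizer of the Rayleigh quotient. *)
Lemma symmetric_eigenvector n (A : 'M[R]_n.+1) : symmetric A ->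
  exists v (lam : R), dot v v = 1 /\ v *m A = lam *: v.
Proof.
move=> AT; pose sphere := [set x : 'rV[R]_n.+1 | dot x x = 1].
have sphere_n0 : sphere !=set0.
  by exists (delta_mx 0 0); rewrite /sphere /= dot_delta mxE !eqxx.
have [v /set_mem v1 vmax] := EVT_max_rV sphere_n0 (compact_sphere (n := n.+1))
  (continuous_subspaceT (@continuous_bil R n.+1 A)).
pose lam := bil A v v; exists v, lam; split => //.
have formE x : bil (lam%:M - A) x x = lam * dot x x - bil A x x by rewrite !bilmE.
have : v *m (lam%:M - A) = 0.
  apply: bil_psd_kernel => [|x|]; last by rewrite formE v1 mulr1 subrr.
    by rewrite /symmetric linearB /= tr_scalar_mx AT.
  rewrite formE subr_ge0; have [->|/enorm_gt0 xp] := eqVneq x 0.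
    by rewrite dot0l mulr0 bil0l.
  have := vmax ((enorm x)^-1 *: x); rewrite inE /sphere /= dotZl dotZr -enorm_sqr.
  have -> : (enorm x)^-1 * ((enorm x)^-1 * enorm x ^+ 2) = 1 by field; rewrite gt_eqF.
  move=> /(_ erefl); rewrite bilZl bilZr -/lam => /(ler_wpM2l (sqr_ge0 (enorm x))).
  have -> : enorm x ^+ 2 * ((enorm x)^-1 * ((enorm x)^-1 * bil A x x)) = bil A x x.
    by field; rewrite gt_eqF.
  by rewrite mulrC.
by rewrite mulmxBr mul_mx_scalar => /eqP; rewrite subr_eq0 => /eqP ->.
Qed.

(* The Householder reflection exchanging [v] and the first basis vector. *)
Lemma unit_vector_reflection n (v : 'rV[R]_n.+1) : dot v v = 1 ->
  exists Q : 'M[R]_n.+1, [/\ symmetric Q, Q *m Q = 1%:M & delta_mx 0 0 *m Q = v].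
Proof.
move=> v1; pose e : 'rV[R]_n.+1 := delta_mx 0 0; pose w := v - e.
have ee : dot e e = 1 by rewrite dot_delta mxE !eqxx.
have [w0|w0] := eqVneq (dot w w) 0.
  exists 1%:M; rewrite /symmetric trmx1 mulmx1; split => //; rewrite mulmx1.
  by apply/eqP; rewrite eq_sym -subr_eq0; apply/eqP/dot_eq0.
pose c := 2 / dot w w; exists (1%:M - c *: (w^T *m w)).
have mulw (x : 'rV[R]_n.+1) : x *m (1%:M - c *: (w^T *m w)) = x - (c * dot x w) *: w.
  rewrite mulmxBr mulmx1 -scalemxAr mulmxA [x *m w^T]mx11_scalar mul_scalar_mx scalerA.
  congr (_ - (_ * _) *: _); rewrite mxE; apply: eq_bigr => k _; by rewrite mxE.
have cw : c * dot w w = 2 by rewrite /c divfK.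
split.
- by rewrite /symmetric linearB /= linearZ /= trmx_mul trmxK trmx1.
- apply/row_matrixP => i; rewrite !rowE mulmxA mulw mulw mulmx1.
  set x : 'rV[R]_n.+1 := delta_mx 0 i.
  rewrite dotDl dotNl dotZl -addrA -opprD -scalerDl.
  have -> : c * dot x w + c * (dot x w - c * dot x w * dot w w) =
     c * dot x w * (2 - c * dot w w) by ring.
  by rewrite cw subrr mulr0 scale0r subr0.
- rewrite mulw -/e; have ew : dot e w = dot e v - 1 by rewrite /w dotDr dotNr ee.
  have ww : dot w w = - 2 * dot e w.
    by rewrite ew /w !(dotDl, dotDr, dotNl, dotNr) v1 ee (dotC v e); ring.
  have -> : c * dot e w = - 1.
    rewrite /c ww; field; apply: contraNneq w0; rewrite ww => ->; by rewrite mulr0.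
  by rewrite scaleN1r opprK /w addrC subrK.
Qed.

Lemma symmetric_block_eigenvector n (B : 'M[R]_(1 + n)) lam : symmetric B ->
  delta_mx 0 0 *m B = lam *: delta_mx 0 0 :> 'rV[R]_(1 + n) ->
  B = block_mx lam%:M 0 0 (drsubmx B).
Proof.
move=> BT eB; have lshift0 : lshift n 0 = 0 :> 'I_(1 + n) by apply/val_inj.
have B0 j : B 0 j = lam * (j == 0)%:R.
  have := congr1 (fun M : 'rV[R]_(1 + n) => M 0 j) eB; rewrite -rowE !mxE => ->.
  by rewrite eqxx.
rewrite -{1}(submxK B); congr block_mx; apply/matrixP => i j; rewrite !ord1 !mxE lshift0.
- by rewrite B0 mulr1.
- by rewrite B0 mulr0.
- by rewrite -BT mxE B0 mulr0.
Qed.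

Lemma symmetric_diag n (A : 'M[R]_n) : symmetric A ->
  exists (P : 'M[R]_n) d, P *m P^T = 1%:M /\ A = P^T *m diag_mx d *m P.
Proof.
elim: n A => [|n IH] A AT.
  by exists 1%:M, 0; rewrite trmx1 mulmx1; split => //; apply/matrixP => -[].
have [v [lam [v1 vA]]] := symmetric_eigenvector AT.
have [Q [QT QQ eQ]] := unit_vector_reflection v1.
have [B BD] : exists B : 'M[R]_(1 + n), B = Q *m A *m Q by eexists.
have BT : symmetric B by rewrite /symmetric BD !trmx_mul AT QT mulmxA.
have eB : delta_mx 0 0 *m B = lam *: delta_mx 0 0 :> 'rV[R]_(1 + n).
  rewrite BD !mulmxA eQ vA -scalemxAl; congr (_ *: _).
  by rewrite -eQ -mulmxA QQ mulmx1.
have [|P [d [PP PE]]] := IH (drsubmx B); first by rewrite /symmetric trmx_drsub BT.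
pose U : 'M[R]_(1 + n) := block_mx (1%:M : 'M[R]_1) 0 0 P.
pose e : 'rV[R]_(1 + n) := row_mx (lam%:M : 'M[R]_1) d.
have UT : U^T = block_mx (1%:M : 'M[R]_1) 0 0 P^T by rewrite tr_block_mx !trmx0 trmx1.
have UU : U *m U^T = 1%:M.
  rewrite UT mulmx_block !mulmx0 !mul0mx !mulmx1 !addr0 !add0r PP.
  by rewrite -scalar_mx_block.
have UB : U^T *m diag_mx e *m U = B.
  rewrite UT diag_mx_row !mulmx_block !mulmx0 !mul0mx !mulmx1 !mul1mx !addr0 !add0r.
  rewrite [RHS](symmetric_block_eigenvector BT eB) PE !mul0mx ?addr0; congr block_mx.
  by apply/matrixP => i j; rewrite !ord1 !mxE.
have UQT : (U *m Q)^T = Q *m U^T by rewrite trmx_mul QT.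
exists (U *m Q), e; rewrite UQT; split; first by rewrite mulmxA -(mulmxA U Q Q) QQ mulmx1.
have -> : A = Q *m B *m Q by rewrite BD !mulmxA QQ mul1mx -mulmxA QQ mulmx1.
by rewrite -UB !mulmxA.
Qed.

End Spectral.

Section Eigenvalues.
Variables (R : realType) (N : nat).
Implicit Types (A B P Q : 'M[R]_N) (a b : 'I_N -> R) (i j k : 'I_N).

Definition diag_form a P : 'M[R]_N := P^T *m diag_mx (\row_k a k) *m P.

Lemma diag_formE a P i j : diag_form a P i j = \sum_k P k i * a k * P k j.
Proof.
rewrite mxE; apply: eq_bigr => k _; rewrite mul_mx_diag !mxE; ring.
Qed.

Lemma diag_form_sym a P : symmetric (diag_form a P).
Proof. by rewrite /symmetric /diag_form !trmx_mul trmxK tr_diag_mx mulmxA. Qed.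

Lemma dot_mulmxl (M : 'M[R]_N) (x y : 'rV[R]_N) : dot (x *m M) y = dot x (y *m M^T).
Proof.
have dotE (z t : 'rV[R]_N) : dot z t = (z *m t^T) 0 0.
  by rewrite mxE; apply: eq_bigr => k _; rewrite mxE.
by rewrite !dotE trmx_mul trmxK mulmxA.
Qed.

Lemma bil_diag_form a P x :
  bil (diag_form a P) x x = \sum_k a k * (x *m P^T) 0 k ^+ 2.
Proof.
rewrite /bil /diag_form !mulmxA dot_mulmxl.
by apply: eq_bigr => k _; rewrite mul_mx_diag !mxE; ring.
Qed.

Lemma dot_orthogonal P x : P *m P^T = 1%:M -> dot x x = \sum_k (x *m P^T) 0 k ^+ 2.
Proof.
move=> /mulmx1C PP; rewrite -{1}(mulmx1 x) -PP mulmxA dot_mulmxl.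
by apply: eq_bigr => k _; rewrite expr2.
Qed.

(* Courant-Fischer, with a vector orthogonal to [i] eigenvectors of one matrix and to
   [N - 1 - i] of the other. *)
Lemma diag_form_le a b P Q i : P *m P^T = 1%:M -> Q *m Q^T = 1%:M ->
  {homo a : j k / (j <= k)%N >-> j <= k} -> {homo b : j k / (j <= k)%N >-> j <= k} ->
  (forall x, bil (diag_form a P) x x <= bil (diag_form b Q) x x) -> a i <= b i.
Proof.
move=> PP QQ ha hb le_ab.
pose T := \matrix_(q, j) (if (j < i)%N then P j q else if (i < j)%N then Q j q else 0).
have : \det T = 0.
  by rewrite (expand_det_col _ i) big1 // => q _; rewrite mxE ltnn mul0r.
move/eqP/det0P => [x x0 xT].
have xTj j : (x *m T) 0 j = 0 by rewrite xT mxE.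
have xP j : (j < i)%N -> (x *m P^T) 0 j = 0.
  by move=> ji; rewrite -[RHS](xTj j) !mxE; apply: eq_bigr => q _; rewrite !mxE ji.
have xQ j : (i < j)%N -> (x *m Q^T) 0 j = 0.
  move=> ij; rewrite -[RHS](xTj j) !mxE; apply: eq_bigr => q _; rewrite !mxE ij.
  by rewrite ltnNge (ltnW ij).
have x1 : 0 < dot x x by rewrite -enorm_sqr exprn_gt0 // enorm_gt0.
rewrite -(ler_pM2r x1) {1}(dot_orthogonal x PP) (dot_orthogonal x QQ).
apply: (le_trans _ (le_trans (le_ab x) _)); rewrite bil_diag_form mulr_sumr.
  apply: ler_sum => k _; have [ki|ik] := ltnP k i; first by rewrite xP // expr0n !mulr0.
  by rewrite ler_wpM2r ?sqr_ge0 // ha.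
apply: ler_sum => k _; have [ik|ki] := ltnP i k; first by rewrite xQ // expr0n !mulr0.
by rewrite ler_wpM2r ?sqr_ge0 // hb.
Qed.

Lemma char_poly_diag_form a P : P *m P^T = 1%:M ->
  char_poly (diag_form a P) = \prod_k ('X - (a k)%:P).
Proof.
move=> PP; have PP' := mulmx1C PP.
pose p := map_mx polyC P; pose D := diag_mx (\row_k a k).
have pp : p^T *m p = 1%:M by rewrite /p map_trmx -map_mxM PP' map_mx1.
have -> : char_poly (diag_form a P) = char_poly D.
  rewrite /char_poly.
  have -> : char_poly_mx (diag_form a P) = p^T *m char_poly_mx D *m p.
    rewrite /char_poly_mx mulmxBr mulmxBl mul_mx_scalar -scalemxAl pp scalemx1.
    by rewrite /diag_form !map_mxM -map_trmx.
  by rewrite !det_mulmx mulrAC -det_mulmx pp det1 mul1r.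
rewrite char_poly_trig; last by rewrite diag_mx_is_trig.
by apply: eq_bigr => k _; rewrite !mxE eqxx mulr1n.
Qed.

Lemma is_eigseq_diag_form a P : P *m P^T = 1%:M ->
  is_eigseq (diag_form a P) (sort <=%R [seq a k | k <- enum 'I_N]).
Proof.
move=> PP; split.
- by rewrite size_sort size_map size_enum_ord.
- exact/sort_sorted/le_total.
- rewrite char_poly_diag_form // (perm_big [seq a k | k <- enum 'I_N]) /=.
    by rewrite big_map big_enum.
  by rewrite perm_sort.
Qed.

Lemma eig_diag A : symmetric A -> exists P, [/\ P *m P^T = 1%:M,
  A = diag_form (eig A) P & {homo eig A : j k / (j <= k)%N >-> j <= k}].
Proof.
move=> AT; have [P [d [PP AE]]] := symmetric_diag AT.
pose a k := d 0 k.
have {}AE : A = diag_form a P.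
  by rewrite {1}AE /diag_form; congr (_ *m diag_mx _ *m _); apply/rowP => k; rewrite mxE.
have [] : is_eigseq A (eigseq A).
  apply: xgetPex; exists (sort <=%R [seq a k | k <- enum 'I_N]).
  by rewrite {1}AE; exact: is_eigseq_diag_form.
move=> sz srt cpE.
pose t := [tuple a k | k < N].
have pt : perm_eq (eigseq A) t.
  apply: prod_XsubC_eq; rewrite -cpE AE char_poly_diag_form //= big_map.
  by rewrite enumT.
have /tuple_permP [s sE] := pt.
have eE i : eig A i = a (s i) by rewrite /eig sE -tnth_nth !tnth_mktuple.
exists (row_perm s P); split.
- rewrite row_permE trmx_mul mulmxA -(mulmxA _ P) PP mulmx1 tr_perm_mx -perm_mxM.
  by rewrite mulgV perm_mx1.
- apply/matrixP => i j; rewrite {1}AE !diag_formE (reindex_inj (@perm_inj _ s)).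
  by apply: eq_bigr => k _; rewrite !mxE eE.
- move=> j k jk; rewrite /eig; apply: sorted_leq_nth => //; rewrite ?inE ?sz //.
  exact: le_trans.
Qed.

Lemma eig_le A B i : symmetric A -> symmetric B ->
  (forall x, bil A x x <= bil B x x) -> eig A i <= eig B i.
Proof.
move=> AT BT AB; have [P [PP AE hA]] := eig_diag AT; have [Q [QQ BE hB]] := eig_diag BT.
by apply: diag_form_le PP QQ hA hB _ => x; rewrite -AE -BE.
Qed.

Lemma eig_diag_form a P i : P *m P^T = 1%:M ->
  {homo a : j k / (j <= k)%N >-> j <= k} -> eig (diag_form a P) i = a i.
Proof.
move=> PP ha; have [Q [QQ BE hB]] := eig_diag (diag_form_sym a P).
apply/eqP; rewrite eq_le; apply/andP; split.
  by apply: diag_form_le QQ PP hB ha _ => x; rewrite -BE.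
by apply: diag_form_le PP QQ ha hB _ => x; rewrite -BE.
Qed.

Lemma eigD_scalar A (t : R) i : symmetric A -> eig (A + t%:M) i = eig A i + t.
Proof.
move=> AT; have [P [PP AE hA]] := eig_diag AT.
have -> : A + t%:M = diag_form (fun k => eig A k + t) P.
  rewrite {1}AE /diag_form.
  have -> : diag_mx (\row_k (eig A k + t)) = diag_mx (\row_k eig A k) + t%:M :> 'M[R]_N.
    by apply/matrixP => q j; rewrite !mxE -mulrnDl.
  by rewrite mulmxDr mulmxDl mul_mx_scalar -scalemxAl (mulmx1C PP) scalemx1.
by rewrite eig_diag_form // => j k jk; rewrite lerD2r hA.
Qed.

Lemma eig_scalar (t : R) i : eig (t%:M : 'M[R]_N) i = t.
Proof.
have -> : t%:M = diag_form (fun=> t) 1%:M.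
  by rewrite /diag_form trmx1 mul1mx mulmx1; apply/matrixP => q j; rewrite !mxE.
by rewrite eig_diag_form ?trmx1 ?mulmx1.
Qed.

Lemma bil_le_specnorm A x : symmetric A -> `|bil A x x| <= specnorm A * dot x x.
Proof.
move=> AT; have [P [PP AE hA]] := eig_diag AT.
rewrite {1}AE bil_diag_form (dot_orthogonal x PP) mulr_sumr.
apply: (le_trans (ler_norm_sum _ _ _)); apply: ler_sum => k _.
by rewrite normrM [`|_ ^+ 2|]ger0_norm ?sqr_ge0 // ler_wpM2r ?sqr_ge0 // le_bigmax.
Qed.

Lemma specnorm_scalar (t : R) : specnorm (t%:M : 'M[R]_N) <= `|t|.
Proof. by apply: bigmax_le => // i _; rewrite eig_scalar. Qed.

End Eigenvalues.

(** * The operator G on a phase interval *)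

Section Arctangent.
Variable R : realType.
Implicit Types x e t : R.

Lemma atanD_le x t : 0 <= t -> atan (x + t) <= atan x + t.
Proof.
move=> t0; have xt : x <= x + t by rewrite lerDl.
have [c _ E] := @MVT_segment R atan (fun y => (1 + y ^+ 2)^-1) x (x + t) xt
  (fun y _ => is_derive1_atan y) (continuous_subspaceT (@continuous_atan R)).
rewrite -lerBlDl E (addrC x) addrK ler_piMl // invf_le1 ?lerDl ?sqr_ge0 //.
by rewrite ltr_pwDl ?sqr_ge0.
Qed.

Lemma atan_increment_ge (M e : R) : 0 < e -> 0 <= M ->
  exists2 c : R, 0 < c & forall x, `|x| <= M -> atan x + c <= atan (x + e).
Proof.
move=> e0 M0; pose f x : R := atan (x + e) - atan x.
have NMM : - M <= M by lra.
have cf : {within `[- M, M], continuous f}.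
  apply: continuous_subspaceT => x; apply: continuousB; last exact: continuous_atan.
  apply: (@continuous_comp _ _ _ (fun y : R => y + e) (@atan R)); last exact: continuous_atan.
  by apply: continuousD; [exact: cvg_id|exact: cst_continuous].
have [x0 _ f_min] := EVT_min NMM cf.
exists (f x0); first by rewrite subr_gt0; apply: lt_atan; rewrite ltrDl.
move=> x xM; have : f x0 <= f x by apply: f_min; rewrite in_itv /= -ler_norml.
by rewrite /f; lra.
Qed.

Lemma atan_near_pihalf (tau : R) : 0 < tau -> exists2 M : R, 0 <= M &
  forall x, M <= x -> pi / 2 - tau <= atan x.
Proof.
move=> t0; have pi0 : 0 < pi / 2 :> R by rewrite divr_gt0 // pi_gt0.
pose y : R := Num.max 0 (pi / 2 - tau).
have y0 : 0 <= y by rewrite le_max lexx.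
have yt : pi / 2 - tau <= y by rewrite le_max lexx orbT.
have ypi : y < pi / 2 by rewrite gt_max pi0 /=; lra.
have yin : y \in `](- (pi / 2)), (pi / 2)[ by rewrite in_itv /= ypi andbT; lra.
have zin : (0 : R) \in `](- (pi / 2)), (pi / 2)[ by rewrite in_itv /= pi0 andbT; lra.
exists (tan y).
  have [->|yn0] := eqVneq y 0; first by rewrite tan0.
  by rewrite -tan0 ltW // ltr_tan // lt_def yn0.
move=> x xy; apply: (le_trans yt); rewrite -{1}(tanK yin).
exact: le_atan.
Qed.

Lemma atan_near_asymptote (tau : R) : 0 < tau -> exists2 M : R, 0 <= M &
  forall x, M <= `|x| -> `|atan x - (pi / 2 - (x < 0)%R%:R * pi)| <= tau.
Proof.
move=> /atan_near_pihalf[M M0 near]; exists M => // x; case: (ltP x 0) => x0.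
  rewrite ltr0_norm // => /near; rewrite atanN; have := atan_gtNpi2 x.
  by rewrite ler_norml mul1r => *; apply/andP; split; lra.
rewrite ger0_norm // => /near; have := atan_ltpi2 x.
by rewrite ler_norml mul0r subr0 => *; apply/andP; split; lra.
Qed.

End Arctangent.

Section Phase.
Variables (R : realType) (N : nat).
Implicit Types (A B : 'M[R]_N) (t c e : R).

Definition phase_interval (k : nat) : set R :=
  [set t | (N%:R - 2 * k%:R) * pi / 2 < t /\ t < (N%:R - 2 * (k%:R - 1)) * pi / 2].

Definition Gop_jumps t e c :=
  forall A, symmetric A -> t - c <= Gop A -> t + c <= Gop (A + e%:M).

Lemma symmetricD_scalar A t : symmetric A -> symmetric (A + t%:M).
Proof. by move=> AT; rewrite /symmetric linearD /= tr_scalar_mx AT. Qed.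

Lemma symmetricN A : symmetric A -> symmetric (- A).
Proof. by move=> AT; rewrite /symmetric linearN /= AT. Qed.

Lemma Gop_le A B : symmetric A -> symmetric B ->
  (forall x, bil A x x <= bil B x x) -> Gop A <= Gop B.
Proof. by move=> AT BT AB; apply: ler_sum => i _; apply/le_atan/eig_le. Qed.

Lemma GopD_scalar A t : symmetric A -> Gop (A + t%:M) = \sum_(i < N) atan (eig A i + t).
Proof. by move=> AT; apply: eq_bigr => i _; rewrite eigD_scalar. Qed.

Lemma Gop_scalar t : Gop (t%:M : 'M[R]_N) = N%:R * atan t.
Proof.
rewrite /Gop; under eq_bigr do rewrite eig_scalar.
by rewrite sumr_const card_ord mulr_natl.
Qed.

Lemma GopD_scalar_le A t : symmetric A -> 0 <= t -> Gop (A + t%:M) <= Gop A + N%:R * t.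
Proof.
move=> AT t0; rewrite GopD_scalar //.
apply: (@le_trans _ _ (\sum_(i < N) (atan (eig A i) + t))).
  by apply: ler_sum => i _; exact: atanD_le.
by rewrite big_split /= sumr_const card_ord mulr_natl.
Qed.

Lemma Gop_le_add A B t : symmetric A -> symmetric B -> 0 <= t ->
  (forall x, bil B x x <= bil A x x + t * dot x x) -> Gop B <= Gop A + N%:R * t.
Proof.
move=> AT BT t0 BA; apply: le_trans (GopD_scalar_le AT t0); apply: Gop_le => // [|x].
  exact: symmetricD_scalar.
by rewrite !bilmE.
Qed.

Lemma phase_interval_bounds k t : (1 <= k <= N)%N -> phase_interval k t ->
  - (N%:R * (pi / 2)) < t < N%:R * (pi / 2).
Proof.
move=> /andP[k1 kN] [lo hi]; have pi0 : 0 < pi :> R := pi_gt0 R.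
have k1r : 1 * pi <= k%:R * pi :> R by rewrite ler_pM2r // ler1n.
have kNr : k%:R * pi <= N%:R * pi :> R by rewrite ler_pM2r // ler_nat.
by apply/andP; split; lra.
Qed.

Lemma phase_interval_gap k t : phase_interval k t ->
  exists2 d : R, 0 < d & forall j : nat, d <= `|t - (N%:R * (pi / 2) - j%:R * pi)|.
Proof.
rewrite /phase_interval /=; set lo := (_ - 2 * k%:R) * pi / 2; set hi := _ * pi / 2 => -[lo_t t_hi].
have pi0 : 0 < pi :> R := pi_gt0 R.
exists (Num.min (t - lo) (hi - t)) => [|j]; first by rewrite lt_min !subr_gt0 lo_t.
rewrite ge_min ler_normr ler_normr; have [kj|jk] := leqP k j.
  have : k%:R * pi <= j%:R * pi :> R by rewrite ler_wpM2r ?ler_nat // ltW.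
  by rewrite /lo => kj_pi; apply/orP; left; apply/orP; left; lra.
have : (j%:R + 1) * pi <= k%:R * pi :> R by rewrite ler_wpM2r ?natr1 ?ler_nat // ltW.
by rewrite /hi => jk_pi; apply/orP; right; apply/orP; right; lra.
Qed.

Lemma Gop_near_multiple (tau : R) : 0 < tau -> exists2 M : R, 0 <= M &
  forall A, (forall i, M <= `|eig A i|) ->
    exists j : nat, `|Gop A - (N%:R * (pi / 2) - j%:R * pi)| <= N%:R * tau.
Proof.
move=> /atan_near_asymptote[M M0 near]; exists M => // A large.
exists (\sum_(i < N) (eig A i < 0)%R)%N.
have -> : N%:R * (pi / 2) - (\sum_(i < N) (eig A i < 0)%R)%N%:R * pi =
    \sum_(i < N) (pi / 2 - (eig A i < 0)%R%:R * pi) :> R.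
  by rewrite sumrB sumr_const card_ord natr_sum mulr_suml [N%:R * _]mulr_natl.
rewrite -sumrB; apply: (le_trans (ler_norm_sum _ _ _)).
apply: (le_trans (ler_sum _ (fun i _ => near _ (large i)))).
by rewrite sumr_const card_ord mulr_natl.
Qed.

(* Eigenvalues of large modulus contribute nearly [pi / 2] or [- pi / 2], so a phase inside
   the interval forces some eigenvalue to be bounded. *)
Lemma exists_Gop_jump k t e : (0 < N)%N -> phase_interval k t -> 0 < e ->
  exists2 c : R, 0 < c & Gop_jumps t e c.
Proof.
move=> N0 /phase_interval_gap[d d0 gap] e0; have N0r : 0 < N%:R :> R by rewrite ltr0n.
have tau0 : 0 < d / (4 * N%:R) by rewrite divr_gt0 // mulr_gt0.
have [M M0 near] := Gop_near_multiple tau0.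
have [cM cM0 increment] := atan_increment_ge e0 M0.
pose c := Num.min (d / 4) (cM / 4).
have c_d : c <= d / 4 by rewrite ge_min lexx.
have c_cM : c <= cM / 4 by rewrite ge_min lexx orbT.
have c0 : 0 < c by rewrite lt_min !divr_gt0.
exists c => // A AT low; rewrite leNgt; apply/negP; rewrite GopD_scalar // => up.
pose inc i := atan (eig A i + e) - atan (eig A i).
have inc0 i : 0 <= inc i by rewrite subr_ge0; apply: le_atan; rewrite lerDl ltW.
have inc_lt : \sum_(i < N) inc i < 2 * c by rewrite sumrB -/(Gop A); lra.
have inc_sum0 : 0 <= \sum_(i < N) inc i by apply: sumr_ge0.
have [i|j] := near A.
  apply/ltW; rewrite ltNge; apply/negP => /increment.
  have : inc i <= \sum_(i < N) inc i by rewrite (bigD1 i) //= lerDl; apply: sumr_ge0.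
  by rewrite {1}/inc; lra.
have -> : N%:R * (d / (4 * N%:R)) = d / 4 by field; rewrite gt_eqF.
have : Gop A < t + c by move: inc_sum0; rewrite sumrB -/(Gop A) => ?; lra.
have := gap j; rewrite ler_normr ler_norml => /orP[?|?] ? /andP[? ?]; lra.
Qed.

End Phase.

(** * Semicontinuous functions and jets *)

Section EuclideanTopology.
Variables (R : realType) (N : nat).
Implicit Types (x y : 'rV[R]_N) (D K : set 'rV[R]_N) (f g : 'rV[R]_N -> R).

Definition eball x (r : R) : set 'rV[R]_N := [set y | enorm (y - x) <= r].

Lemma nbhs_enormP x (P : set 'rV[R]_N) :
  nbhs x P <-> exists2 d : R, 0 < d & forall y, enorm (y - x) < d -> P y.
Proof.
split=> [/nbhs_normP[d /= d0 xP]|[d d0 xP]].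
  exists d => // y yx; apply: xP; rewrite /ball_ /=; apply: le_lt_trans yx.
  by rewrite enormC norm_le_enorm.
apply: (iffRL (nbhs_normP x P)); have N1 : 0 < N%:R + 1 :> R by rewrite ltr_wpDl.
exists (d / (N%:R + 1)); first by rewrite /= divr_gt0.
move=> y; rewrite /ball_ /= ltr_pdivlMr // => yx; apply: xP; rewrite enormC.
apply: le_lt_trans (enorm_le_norm _) _; apply: le_lt_trans yx.
by rewrite mulrC ler_wpM2l // lerDl.
Qed.

Lemma open_enorm D x : open D -> D x ->
  exists2 d : R, 0 < d & forall y, enorm (y - x) < d -> D y.
Proof. by move=> oD Dx; apply/nbhs_enormP; apply: open_nbhs_nbhs. Qed.

Lemma continuous_enorm D f x (e : R) :
  open D -> {within D, continuous f} -> D x -> 0 < e ->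
  exists2 d : R, 0 < d & forall y, enorm (y - x) < d -> `|f y - f x| < e.
Proof.
move=> oD; rewrite continuous_open_subspace // => fc Dx e0.
have := fc x (mem_set Dx) => /cvgrPdist_lt /(_ _ e0) /nbhs_enormP[d d0 fd].
by exists d => // y /fd; rewrite distrC.
Qed.

Lemma usc_on_sub D K f : K `<=` D -> usc_on D f -> usc_on K f.
Proof.
by move=> KD uf x /KD Dx e e0; have [d d0 fd] := uf x Dx e e0; exists d => // y /KD; exact: fd.
Qed.

Lemma usc_onD D f g : usc_on D f -> continuous g -> usc_on D (fun x => f x + g x).
Proof.
move=> uf cg x Dx e e0; have e2 : 0 < e / 2 by rewrite divr_gt0.
have [d1 d10 fd] := uf x Dx _ e2.
have /cvgrPdist_lt /(_ _ e2) /nbhs_enormP[d2 d20 gd] := cg x.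
exists (Num.min d1 d2); first by rewrite lt_min d10.
move=> y Dy; rewrite lt_min => /andP[/(fd _ Dy) ? /gd].
by rewrite ltr_norml => /andP[? ?]; lra.
Qed.

Lemma lsc_onN D f : lsc_on D f -> usc_on D (fun x => - f x).
Proof.
move=> lf x Dx e e0; have [d d0 fd] := lf x Dx e e0; exists d => // y Dy yx.
by have := fd y Dy yx; lra.
Qed.

(* Without a maximum, the superlevel sets form a filter base with no cluster point in [K]. *)
Lemma usc_max K f : K !=set0 -> compact K -> usc_on K f ->
  exists2 x, K x & forall y, K y -> f y <= f x.
Proof.
move=> [x0 Kx0] cK uf; apply: contrapT => nomax.
have up x : K x -> exists2 y, K y & f x < f y.
  move=> Kx; apply: contrapT => top; apply: nomax; exists x => // y Ky.
  by rewrite leNgt; apply/negP => xy; apply: top; exists y.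
pose F : set_system 'rV[R]_N := fun A =>
  exists2 y0, K y0 & forall y, K y -> f y0 <= f y -> A y.
have FF : Filter F.
  split.
  - by exists x0.
  - move=> A B [a Ka aA] [b Kb bB]; have [ab|ba] := leP (f a) (f b).
      by exists b => // y Ky by_; split; [apply: aA => //; exact: le_trans by_|exact: bB].
    by exists a => // y Ky ay; split; [exact: aA|apply: bB => //; apply: le_trans (ltW ba) ay].
  - by move=> A B AB [a Ka aA]; exists a => // y Ky ay; apply/AB/aA.
move/compact_near_coveringP/(_ _ F (fun y x => K x -> f x < f y) FF): cK => cover.
have [x Kx|y0 Ky0 lt_y0] := cover; last by have := lt_y0 _ Ky0 (lexx _) _ Ky0 Ky0; rewrite ltxx.
have [y1 Ky1 xy1] := up x Kx.
have [|d d0 fd] := uf x Kx (f y1 - f x); first by rewrite subr_gt0.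
exists ([set x' | enorm (x' - x) < d], [set y | K y /\ f y1 <= f y]).
  split=> /=; first by apply/nbhs_enormP; exists d.
  by exists y1.
case=> x' y /= [x'd [Ky y1y]] Kx'.
by apply: lt_le_trans y1y; have := fd x' Kx' x'd; rewrite addrC subrK.
Qed.

Lemma bounded_closure_coord D : bounded_set D ->
  exists2 L : R, 0 < L & forall x k, closure D x -> `|x 0 k| <= L.
Proof.
move=> [M [_ DM]]; pose L := Num.max M 0 + 1.
have M_max : M <= Num.max M 0 by rewrite le_max lexx.
have max0 : 0 <= Num.max M 0 by rewrite le_max lexx orbT.
have ML : M < L by rewrite /L; lra.
exists (L + 1); first by rewrite /L; lra.
move=> x k cx; have near : nbhs x [set y | enorm (y - x) < 1].
  by apply/nbhs_enormP; exists 1.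
have [y [Dy /= yx]] := cx _ near; have yL := DM L ML y Dy.
have -> : x 0 k = y 0 k - (y - x) 0 k by rewrite !mxE; ring.
apply: (le_trans (ler_normB _ _)); apply: lerD.
  exact: le_trans (coord_le_norm _ _) yL.
exact: le_trans (coord_le_enorm _ _) (ltW yx).
Qed.

Lemma compact_closure_bounded D : bounded_set D -> compact (closure D).
Proof.
move=> /bounded_closure_coord[L L0 DL]; apply: bounded_closed_compact; last exact: closed_closure.
exists L; split; first exact: num_real.
move=> M LM x cx; apply: le_trans (ltW LM); apply: mx_norm_le; first exact: ltW.
by move=> k; exact: DL.
Qed.

End EuclideanTopology.

Section QuadraticTestFunctions.
Variables (R : realType) (N : nat).
Implicit Types (x v b : 'rV[R]_N) (c : R) (H : 'M[R]_N).

Lemma is_derive_along (f : 'rV[R]_N -> R) x v (L M : R) :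
  (forall t : R, f (t *: v + x) = f x + t * L + t ^+ 2 * M) -> is_derive x v f L.
Proof.
move=> expansion.
have cv : (fun t : R => t^-1 *: ((f \o shift x) (t *: v) - f x)) @ 0^' --> L.
  have cL : (fun t : R => L + t * M) @ 0^' --> L.
    have : {for 0, continuous (fun t : R => L + t * M)}.
      apply: continuousD; first exact: cst_continuous.
      by apply: continuousM; [exact: cvg_id|exact: cst_continuous].
    rewrite /prop_for /continuous_at /= mul0r addr0; apply: cvg_trans; apply: cvg_app.
    exact: nbhs_dnbhs.
  apply: cvg_trans cL; apply: near_eq_cvg; near=> t.
  have t0 : t != 0 by near: t; exact: nbhs_dnbhs_neq.
  rewrite /= expansion -[RHS]/(t^-1 * (f x + t * L + t ^+ 2 * M - f x)).
  by field.
apply: DeriveDef; first by apply/cvg_ex; exists L.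
exact: cvg_lim cv.
Unshelve. all: by end_near.
Qed.

Definition quad_at x0 c b H x : R := quad c b H (x - x0).

Lemma is_derive_quad_at x0 c b H x v : symmetric H ->
  is_derive x v (quad_at x0 c b H) (dot b v + bil H (x - x0) v).
Proof.
move=> HT; apply: (@is_derive_along _ _ _ _ (2^-1 * bil H v v)) => t; rewrite /quad_at /quad.
have -> : t *: v + x - x0 = t *: v + (x - x0) by rewrite addrA.
move: (x - x0) => d; rewrite !(bilDl, bilDr, bilZl, bilZr, dotDr, dotZr) (bilC d v HT).
by field.
Qed.

Lemma pd_quad_at x0 c b H i : symmetric H ->
  pd i (quad_at x0 c b H) = quad_at x0 (b 0 i) (evec R i *m H) 0.
Proof.
move=> HT; apply/funext => x; rewrite /pd.
rewrite (@derive_val _ _ _ _ _ _ _ (is_derive_quad_at x0 c b x (evec R i) HT)).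
by rewrite dot_delta (bilC _ _ HT) /quad_at /quad bil0m mulr0 addr0.
Qed.

Lemma pd_pd_quad_at x0 c b H i j : symmetric H ->
  pd i (pd j (quad_at x0 c b H)) = fun=> H i j.
Proof.
move=> HT; rewrite pd_quad_at // pd_quad_at ?/symmetric ?trmx0 //; apply/funext => x.
rewrite /quad_at /quad mulmx0 dot0l bil0m mulr0 !addr0 -rowE mxE.
by rewrite -{1}HT mxE.
Qed.

Lemma continuous_quad_at x0 c b H : continuous (quad_at x0 c b H).
Proof.
have shift_cont : continuous (fun x : 'rV[R]_N => x - x0).
  by move=> x; apply: continuousB; [exact: cvg_id|exact: cst_continuous].
move=> x.
have linear_part : {for x, continuous (fun y : 'rV[R]_N => dot b (y - x0))}.
  by apply: (continuous_comp (shift_cont x)); exact: continuous_dot.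
have quadratic_part : {for x, continuous (fun y : 'rV[R]_N => bil H (y - x0) (y - x0))}.
  by apply: (continuous_comp (shift_cont x) (g := fun y => bil H y y)); exact: continuous_bil.
have c1 : {for x, continuous (fun=> c : R)} by exact: cst_continuous.
have c2 : {for x, continuous (fun=> 2^-1 : R)} by exact: cst_continuous.
exact: (continuousD (continuousD c1 linear_part) (continuousM c2 quadratic_part)).
Qed.

Lemma C2near_quad_at x0 c b H x : symmetric H -> C2near (quad_at x0 c b H) x.
Proof.
move=> HT; have zero_sym : symmetric (0 : 'M[R]_N) by rewrite /symmetric trmx0.
exists 1 => // y _; split.
- exact: continuous_quad_at.
- move=> i; split; first by have [] := is_derive_quad_at x0 c b y (evec R i) HT.
  by rewrite pd_quad_at //; exact: continuous_quad_at.
- move=> i j; split; last by rewrite pd_pd_quad_at //; exact: cst_continuous.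
  rewrite pd_quad_at //.
  by have [] := is_derive_quad_at x0 (b 0 j) (evec R j *m H) y (evec R i) zero_sym.
Qed.

Lemma hessian_quad_at x0 c b H x : symmetric H -> hessian (quad_at x0 c b H) x = H.
Proof. by move=> HT; apply/matrixP => i j; rewrite mxE pd_pd_quad_at. Qed.

Lemma quad_at_center c b H x : quad_at x c b H x = c.
Proof. by rewrite /quad_at subrr quad0r. Qed.

Lemma Jplus_quad_at (u : 'rV[R]_N -> R) x b H (rho : R) : symmetric H -> 0 < rho ->
  (forall z, enorm (z - x) < rho -> u z <= quad_at x (u x) b H z) -> Jplus u x (u x, H).
Proof.
move=> HT rho0 above; exists (quad_at x (u x) b H); split.
- exact: C2near_quad_at.
- by exists rho.
- by rewrite quad_at_center.
- by rewrite hessian_quad_at // quad_at_center.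
Qed.

Lemma Jminus_quad_at (v : 'rV[R]_N -> R) x b H (rho : R) : symmetric H -> 0 < rho ->
  (forall z, enorm (z - x) < rho -> quad_at x (v x) b H z <= v z) -> Jminus v x (v x, H).
Proof.
move=> HT rho0 below; exists (quad_at x (v x) b H); split.
- exact: C2near_quad_at.
- by exists rho.
- by rewrite quad_at_center.
- by rewrite hessian_quad_at // quad_at_center.
Qed.

Lemma compact_eball x (r : R) : compact (eball x r).
Proof.
have [r0|r0] := ltP r 0.
  rewrite (_ : eball x r = set0); first exact: compact0.
  by apply/seteqP; split => y //= yr; have := enorm_ge0 (y - x); rewrite /eball /= in yr; lra.
apply: bounded_closed_compact.
  exists (r + `|x|); split; first exact: num_real.
  move=> M rM y /= yr; apply: le_trans (ltW rM).
  rewrite -[y](subrK x); apply: (le_trans (ler_normD _ _)); rewrite lerD2r.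
  exact: le_trans (norm_le_enorm _) yr.
rewrite (_ : eball x r = quad_at x 0 0 1%:M @^-1` [set t | t <= 2^-1 * r ^+ 2]).
  by apply: preimage_closed => [y _|]; [exact: continuous_quad_at|exact: closed_le].
apply/seteqP; split => y; rewrite /eball /= /quad_at /quad dot0l !add0r bil_scalar mul1r.
  by rewrite -enorm_sqr ler_pM2l // ler_sqr ?nnegrE ?enorm_ge0.
by rewrite -enorm_sqr ler_pM2l // ler_sqr ?nnegrE ?enorm_ge0.
Qed.

End QuadraticTestFunctions.

Section Theta.
Variables (R : realType) (N : nat).
Implicit Types (p q : R * 'M[R]_N) (h : 'rV[R]_N -> R).

Lemma Gop_lipschitz_pdist p q (e : R) : SN p -> SN q -> pdist q p < e ->
  `|Gop q.2 - Gop p.2| <= N%:R * e.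
Proof.
move=> Sp Sq; rewrite /pdist /pnorm gt_max => /andP[/(le_lt_trans (normr_ge0 _)) e0 /= near].
have diff_sym : symmetric (q.2 - p.2) by rewrite /symmetric linearB /= Sp Sq.
have diff_le x : `|bil q.2 x x - bil p.2 x x| <= e * dot x x.
  rewrite -bilNm -bilDm; apply: (le_trans (bil_le_specnorm x diff_sym)).
  by rewrite ler_wpM2r ?dot_ge0 // ltW.
have pq : Gop q.2 <= Gop p.2 + N%:R * e.
  by apply: Gop_le_add => // [|x]; [exact: ltW|have := diff_le x; rewrite ler_norml; lra].
have qp : Gop p.2 <= Gop q.2 + N%:R * e.
  by apply: Gop_le_add => // [|x]; [exact: ltW|have := diff_le x; rewrite ler_norml; lra].
by rewrite ler_norml; apply/andP; split; lra.
Qed.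

Lemma le_of_forall_natr_eps (a b : R) : (forall e, 0 < e -> a <= b + N%:R * e) -> a <= b.
Proof.
move=> ab; apply/ler_addgt0Pr => e e0; have N1 : 0 < N%:R + 1 :> R by rewrite ltr_wpDl.
have e1 : 0 < e / (N%:R + 1) by rewrite divr_gt0.
apply: (le_trans (ab _ e1)); rewrite lerD2l mulrCA ler_piMr ?(ltW e0) //.
by rewrite ler_pdivrMr // mul1r lerDl.
Qed.

Lemma ThetaG_closed h x : closedS (ThetaG h x).
Proof.
split=> [p []//|p Sp adherent]; split=> //; apply: le_of_forall_natr_eps => e e0.
have [q [Sq hq] qp] := adherent e e0; apply: (le_trans hq).
by have := Gop_lipschitz_pdist Sp Sq qp; rewrite ler_norml; lra.
Qed.

Lemma ThetaG_boundary h x :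
  boundaryS (ThetaG h x) `<=` [set p | SN p /\ Gop p.2 = h x].
Proof.
move=> p [Sp bd]; split=> //; apply/eqP; rewrite eq_le; apply/andP; split.
  apply: le_of_forall_natr_eps => e /bd[_ [q [Sq notTheta] qp]].
  have : Gop q.2 < h x by rewrite ltNge; apply/negP => hq; apply: notTheta.
  by have := Gop_lipschitz_pdist Sp Sq qp; rewrite ler_norml; lra.
by have [_ /(_ p Sp) []] := ThetaG_closed h x => // e /bd[].
Qed.

Lemma psd_bil_ge0 (P : 'M[R]_N) x : psd P -> 0 <= bil P x x.
Proof.
move=> [_ /(_ x^T)]; rewrite trmxK; congr (_ <= _); rewrite mxE; apply: eq_bigr => k _.
by rewrite [x^T _ _]mxE.
Qed.

Lemma exists_Gop_scalar_gt (t : R) : (0 < N)%N -> t < N%:R * (pi / 2) ->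
  exists a : R, t < Gop (a%:M : 'M[R]_N).
Proof.
move=> N0 t_lt; have N0r : 0 < N%:R :> R by rewrite ltr0n.
have gap0 : 0 < (N%:R * (pi / 2) - t) / N%:R / 2 by rewrite !divr_gt0 // subr_gt0.
have [M M0 /(_ M (lexx M))] := atan_near_pihalf gap0.
move/(ler_wpM2l (ltW N0r)) => near; exists M; rewrite Gop_scalar.
apply: lt_le_trans near; rewrite mulrBr.
have -> : N%:R * ((N%:R * (pi / 2) - t) / N%:R / 2) = (N%:R * (pi / 2) - t) / 2.
  by field; rewrite gt_eqF.
by lra.
Qed.

Lemma ThetaG_proper (Om : set 'rV[R]_N) h (k : nat) : (1 <= k <= N)%N ->
  (forall x, Om x -> phase_interval N k (h x)) -> proper_elliptic_map Om (ThetaG h).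
Proof.
move=> kN h_in x /h_in /(phase_interval_bounds kN)/andP[h_gt h_lt].
have N0 : (0 < N)%N by case/andP: kN => k1; exact: leq_trans.
have scalar_sym (a : R) : symmetric (a%:M : 'M[R]_N) by rewrite /symmetric tr_scalar_mx.
split.
- exact: ThetaG_closed.
- have [a /ltW a_ge] := exists_Gop_scalar_gt N0 h_lt.
  by exists (0, a%:M); split=> //; exact: scalar_sym.
- have [|a] := exists_Gop_scalar_gt (t := - h x) N0; first by lra.
  rewrite Gop_scalar => a_gt full.
  have [_] : ThetaG h x (0, (- a)%:M) by rewrite full; exact: scalar_sym.
  by rewrite /= Gop_scalar atanN; lra.
- move=> p q [Sp Gp] [_ Pq]; have [Sq _] := Pq.
  have pq_sym : symmetric (p.2 + q.2) by rewrite /symmetric linearD /= Sp Sq.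
  split=> //; apply: (le_trans Gp); apply: (Gop_le Sp pq_sym) => y.
  by rewrite bilDm lerDl psd_bil_ge0.
Qed.

Lemma exc_ThetaG_le h x y (e : R) : 0 < e ->
  (forall A : 'M[R]_N, symmetric A -> h x <= Gop A -> h y <= Gop (A + e%:M)) ->
  (exc (ThetaG h x) (ThetaG h y) <= e%:E)%E.
Proof.
move=> e0 xy; apply: ge_ereal_sup => _ [p [Sp hp] <-].
apply: ge_ereal_inf; exists (pdist p (p.1, p.2 + e%:M))%:E.
  exists (p.1, p.2 + e%:M); last by [].
  by split; [exact: symmetricD_scalar|exact: xy].
rewrite lee_fin /pdist /pnorm /= subrr normr0 opprD addrA subrr add0r ge_max ltW //=.
have -> : - e%:M = (- e)%:M :> 'M[R]_N by rewrite raddfN.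
by apply: (le_trans (specnorm_scalar _ _)); rewrite normrN gtr0_norm.
Qed.

Lemma ThetaG_hausdorff (Om : set 'rV[R]_N) h (k : nat) : (0 < N)%N -> open Om ->
  {within Om, continuous h} -> (forall x, Om x -> phase_interval N k (h x)) ->
  hausdorff_continuous Om (ThetaG h).
Proof.
move=> N0 oOm hc h_in x Ox eta eta0.
have e0 : 0 < eta / 2 by rewrite divr_gt0.
have [c c0 jumps] := exists_Gop_jump N0 (h_in x Ox) e0.
have [d d0 near] := continuous_enorm oOm hc Ox c0.
exists d => // y Oy; rewrite enormC => /near; rewrite ltr_norml => /andP[h_gt h_lt].
apply: (@le_lt_trans _ _ (eta / 2)%:E); last by rewrite lte_fin; lra.
rewrite /hausdorff_dist ge_max; apply/andP; split; apply: exc_ThetaG_le => // A AT hA.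
  have : h x - c <= Gop A by lra.
  by move=> /(jumps A AT); lra.
have : h x - c <= Gop A by lra.
by move=> /(jumps A AT); lra.
Qed.

End Theta.

(** * Comparison *)

Section Comparison.
Variables (R : realType) (N : nat) (Om : set 'rV[R]_N) (h : 'rV[R]_N -> R).
Implicit Types (x y z xi eta b l : 'rV[R]_N) (u v f : 'rV[R]_N -> R).
Implicit Types (D K : set 'rV[R]_N) (X Y Z : 'M[R]_N) (c e m r w : R).

(* Opening the paraboloid slightly makes it slide to an interior touching point. *)
Lemma touching_paraboloid D f xi r e l X : 0 < r -> 0 < e -> symmetric X ->
  eball xi r `<=` D -> usc_on D f -> approx_superjet D f xi r e l X ->
  exists y b (rho : R), [/\ enorm (y - xi) < r, 0 < rho &
    forall z, enorm (z - y) < rho -> f z <= quad_at y (f y) b (X + (4 * e)%:M) z].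
Proof.
move=> r0 e0 XT ballD uf jet; pose Z := X + (4 * e)%:M.
have ZT : symmetric Z by exact: symmetricD_scalar.
pose q := quad_at xi 0 l Z.
have ug : usc_on (eball xi r) (fun y => f y - q y).
  apply: usc_onD; first exact: usc_on_sub uf.
  by move=> y; apply: continuousN; exact: continuous_quad_at.
have xi_in : eball xi r xi by rewrite /eball /= subrr enorm0 ltW.
have [y y_in y_max] := usc_max (ex_intro _ xi xi_in) (compact_eball (x := xi) (r := r)) ug.
have yr : enorm (y - xi) < r.
  have := y_max xi xi_in; rewrite {1 2}/q /quad_at subrr quad0r.
  have yE : xi + (y - xi) = y by rewrite addrC subrK.
  have := jet (y - xi) y_in; rewrite yE => /(_ (ballD _ y_in)).
  rewrite /quad bilDm bil_scalar -enorm_sqr => jet_y max_y.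
  rewrite -(ltr_sqr (enorm_ge0 _)) ?nnegrE ?(ltW r0) // -(ltr_pM2l e0).
  have : 0 < e * r ^+ 2 by rewrite mulr_gt0 // exprn_gt0.
  by lra.
exists y, (l + (y - xi) *m Z), (r - enorm (y - xi)); split; rewrite ?subr_gt0 //.
move=> z zy; have z_in : eball xi r z.
  by apply: (le_trans (ler_enorm_triangle y _ _)); lra.
have := y_max z z_in; rewrite {1 2}/q {1}/quad_at.
have -> : z - xi = (y - xi) + (z - y) by rewrite [RHS]addrC addrA subrK.
by rewrite quadD // /quad_at [quad (quad _ _ _ _) _ _ _]/quad [quad (f y) _ _ _]/quad; lra.
Qed.

Definition strict_visc_sub (eta : R) u := forall y b Z (rho : R),
  Om y -> symmetric Z -> 0 < rho ->
  (forall z, enorm (z - y) < rho -> u z <= quad_at y (u y) b Z z) ->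
  h y <= Gop (Z - eta%:M).

Definition perturb (eta K : R) u x : R := u x + eta / 2 * (dot x x - K).

Lemma perturbE (eta K : R) u :
  perturb eta K u = fun x => u x + quad_at 0 (- (eta / 2 * K)) 0 eta%:M x.
Proof.
by apply/funext => x; rewrite /perturb /quad_at /quad subr0 dot0l bil_scalar; field.
Qed.

Lemma usc_on_perturb D (eta K : R) u : usc_on D u -> usc_on D (perturb eta K u).
Proof. by move=> uu; rewrite perturbE; apply: usc_onD => //; exact: continuous_quad_at. Qed.

Lemma strict_visc_sub_perturb (eta K : R) u : visc_sub Om h u ->
  strict_visc_sub eta (perturb eta K u).
Proof.
move=> [_ sub] y b Z rho Oy ZT rho0 above.
have Z_sym : symmetric (Z - eta%:M) by rewrite -raddfN; exact: symmetricD_scalar.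
apply: (sub y Oy (u y, Z - eta%:M)).
apply: (Jplus_quad_at (b := b - eta *: y) Z_sym rho0) => z /above.
rewrite /perturb /quad_at /quad !bilmE; have := subrK y z; move: (z - y) => a <-.
by rewrite !(dotDl, dotDr, dotNl, dotZl) (dotC a y); lra.
Qed.

Lemma visc_super_quad_at v y b Z (rho : R) :
  visc_super Om h v -> Om y -> symmetric Z -> 0 < rho ->
  (forall z, enorm (z - y) < rho -> - v z <= quad_at y (- v y) b Z z) -> Gop (- Z) <= h y.
Proof.
move=> [_ super] Oy ZT rho0 above; apply: (super y Oy (v y, - Z)).
apply: (Jminus_quad_at (b := - b) (symmetricN ZT) rho0) => z /above.
by rewrite /quad_at /quad bilNm dotNl; lra.
Qed.

(* The two touching points see almost the same value of [h], but the Hessians at them differ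
   by at least [eta / 2]. *)
Lemma superjets_contradiction D u v x c (eta : R) r e xi1 xi2 l1 l2 X Y :
  strict_visc_sub eta u -> visc_super Om h v -> usc_on D u -> usc_on D (fun y => - v y) ->
  Om `<=` D -> Gop_jumps N (h x) (eta / 2) c ->
  (forall y, enorm (y - xi1) <= r \/ enorm (y - xi2) <= r -> Om y /\ `|h y - h x| < c) ->
  0 < r -> 0 < e -> e <= eta / 18 -> symmetric X -> symmetric Y ->
  approx_superjet D u xi1 r e l1 X -> approx_superjet D (fun y => - v y) xi2 r e l2 Y ->
  (forall om, bil X om om + bil Y om om <= e * dot om om) -> False.
Proof.
move=> sub super uu uv OD jumps near r0 e0 e_eta XT YT jet_u jet_v XY.
have [ball1 ball2] : eball xi1 r `<=` Om /\ eball xi2 r `<=` Om.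
  by split=> y yr; have [] := near y; [left|by []|right|by []].
have [y1 [b1 [rho1 [y1r rho10 above1]]]] :=
  touching_paraboloid r0 e0 XT (subset_trans ball1 OD) uu jet_u.
have [y2 [b2 [rho2 [y2r rho20 above2]]]] :=
  touching_paraboloid r0 e0 YT (subset_trans ball2 OD) uv jet_v.
have [Oy1] := near y1 (or_introl (ltW y1r)); rewrite ltr_distl => /andP[h_gt _].
have [Oy2] := near y2 (or_intror (ltW y2r)); rewrite ltr_distl => /andP[_ h_lt].
set A := X + (4 * e)%:M - eta%:M.
have A_sym : symmetric A by rewrite /A -raddfN; do 2! apply: symmetricD_scalar.
have Z_sym : symmetric (Y + (4 * e)%:M) by exact: symmetricD_scalar.
have hA : h y1 <= Gop A by apply: sub above1 => //; exact: symmetricD_scalar.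
have hZ := visc_super_quad_at super Oy2 Z_sym rho20 above2.
have AZ : Gop (A + (eta / 2)%:M) <= Gop (- (Y + (4 * e)%:M)).
  apply: Gop_le => [||z]; [exact: symmetricD_scalar|exact: symmetricN|].
  rewrite !bilmE; have := XY z.
  have : e * dot z z <= eta / 18 * dot z z by rewrite ler_wpM2r ?dot_ge0.
  by clear; lra.
have jump := jumps A A_sym (le_trans (ltW h_gt) hA).
by have := lt_le_trans h_lt (le_trans jump (le_trans AZ hZ)); rewrite ltxx.
Qed.

Lemma compact_uniform_radius K (P : R -> set 'rV[R]_N) : compact K ->
  (forall x, K x -> exists2 d : R, 0 < d &
    forall y w, enorm (y - x) < d -> 0 < w < d -> K y -> P w y) ->
  exists2 w : R, 0 < w & K `<=` P w.
Proof.
move=> /compact_near_coveringP cK loc.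
have : \forall w \near 0^'+, K `<=` [set y | K y -> P w y].
  apply: cK => x /loc[d d0 near].
  exists ([set y | enorm (y - x) < d], [set w : R | 0 < w < d]); last first.
    by case=> y w /= [yx wd] Ky; exact: near.
  split => /=; first by apply/nbhs_enormP; exists d.
  by near=> w; apply/andP; split; near: w; [exact: nbhs_right_gt|exact: nbhs_right_lt].
move=> /(filterI (nbhs_right_gt (0 : R)))/filter_ex[w [w0 Kw]].
by exists w => // y Ky; exact: Kw.
Unshelve. all: by end_near.
Qed.

Lemma usc_lsc_gap_lt D u v x m : usc_on D u -> lsc_on D v -> D x -> u x <= v x -> 0 < m ->
  exists2 d : R, 0 < d & forall xi eta, D xi -> D eta -> enorm (xi - x) < d ->
    enorm (eta - xi) < d -> u xi - v eta < m.
Proof.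
move=> uu lv Dx uv m0; have m2 : 0 < m / 2 by rewrite divr_gt0.
have [d1 d10 u_lt] := uu x Dx _ m2; have [d2 d20 v_gt] := lv x Dx _ m2.
exists (Num.min d1 (d2 / 2)); first by rewrite lt_min d10 divr_gt0.
move=> xi eta Dxi Deta; rewrite !lt_min => /andP[xi1 xi2] /andP[_ eta2].
have := u_lt xi Dxi xi1; have := v_gt eta Deta.
have := ler_enorm_triangle xi eta x => tri v_lt u_le.
by have := v_lt (le_lt_trans tri _); lra.
Qed.

Definition localized x c y : Prop := Om y /\ `|h y - h x| < c.

Section PhaseInInterval.
Variable k : nat.
Hypotheses (N_gt0 : (0 < N)%N) (open_Om : open Om) (cont_h : {within Om, continuous h}).
Hypothesis h_phase : forall x, Om x -> phase_interval N k (h x).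

Lemma exists_localized x e : Om x -> 0 < e -> exists2 c, Gop_jumps N (h x) e c &
  exists2 d : R, 0 < d & forall y, enorm (y - x) < d -> localized x c y.
Proof.
move=> Ox e0; have [c c0 jumps] := exists_Gop_jump N_gt0 (h_phase Ox) e0.
have [d1 d10 Od] := open_enorm open_Om Ox.
have [d2 d20 hd] := continuous_enorm open_Om cont_h Ox c0.
exists c => //; exists (Num.min d1 d2); first by rewrite lt_min d10.
by move=> y; rewrite lt_min => /andP[/Od ? /hd].
Qed.

Lemma exists_localization_radius K u v m e :
  compact K -> Om `<=` K -> usc_on K u -> lsc_on K v ->
  (forall x, (K `\` Om) x -> u x <= v x) -> 0 < m -> 0 < e ->
  exists2 w : R, 0 < w & forall xi eta, K xi -> K eta -> enorm (eta - xi) < w ->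
    m <= u xi - v eta -> exists2 x, Om x & exists2 c, Gop_jumps N (h x) e c &
    forall y, enorm (y - xi) < w \/ enorm (y - eta) < w -> localized x c y.
Proof.
move=> cK OmK uu lv bd m0 e0.
pose P w xi := forall eta, K eta -> enorm (eta - xi) < w -> m <= u xi - v eta ->
  exists2 x, Om x & exists2 c, Gop_jumps N (h x) e c &
  forall y, enorm (y - xi) < w \/ enorm (y - eta) < w -> localized x c y.
suff [w w0 KP] : exists2 w : R, 0 < w & K `<=` P w by exists w => // xi eta /KP; exact.
apply: compact_uniform_radius => // x Kx; have [uv|vu] := leP (u x) (v x).
  have [d d0 gap] := usc_lsc_gap_lt uu lv Kx uv m0.
  exists d => // xi w xi_x /andP[_ wd] Kxi eta Keta.
  by move=> /lt_trans/(_ wd) /(gap _ _ Kxi Keta xi_x); rewrite ltNge => /negP.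
have Ox : Om x by apply: contrapT => nOx; have := bd x (conj Kx nOx); lra.
have [c jumps [d d0 loc]] := exists_localized Ox e0.
exists (d / 3); first by rewrite divr_gt0.
move=> xi w xi_x /andP[_ wd] Kxi eta _ eta_xi _; exists x => //; exists c => // y.
have := ler_enorm_triangle xi eta x; have := ler_enorm_triangle xi y x.
by have := ler_enorm_triangle eta y x => ? ? ? [?|?]; apply: loc; lra.
Qed.

Lemma close_of_penalized u v xi eta (M : R) m w : 0 < w -> 0 < m -> 0 <= M ->
  u xi - v eta <= M -> m <= penalized (1 + 6 * M / w ^+ 2) u v xi eta ->
  enorm (eta - xi) < w /\ m <= u xi - v eta.
Proof.
move=> w0 m0 M0 uvM; have w2 : 0 < w ^+ 2 by rewrite exprn_gt0.
set kappa := 1 + _; rewrite /penalized => m_le.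
have kappa0 : 0 < kappa by rewrite ltr_wpDr // divr_ge0 ?mulr_ge0 // ltW.
have kappaE : kappa * w ^+ 2 = w ^+ 2 + 6 * M by rewrite mulrDl mul1r divfK ?gt_eqF.
have pen0 : 0 <= kappa / 6 * dot (xi - eta) (xi - eta).
  by rewrite mulr_ge0 ?dot_ge0 // divr_ge0 // ltW.
split; last by lra.
rewrite enormC -(ltr_sqr (enorm_ge0 _)) ?nnegrE ?(ltW w0) // enorm_sqr -(ltr_pM2l kappa0) kappaE.
by lra.
Qed.

Lemma exists_superjets_of_gap D u v (kappa M L : R) x m w e : (0 < N)%N -> 1 <= kappa ->
  (forall xi eta, D xi -> D eta -> u xi - v eta <= M) ->
  (forall xi j, D xi -> `|xi 0 j| <= L) -> D x ->
  0 < m -> 4 * m <= u x - v x -> 0 < w -> 0 < e ->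
  exists (r eps : R) xi eta l1 l2 X Y,
  [/\ [/\ 0 < r < w, 0 < eps <= e, D xi & D eta], symmetric X /\ symmetric Y,
    m <= penalized kappa u v xi eta,
    approx_superjet D u xi r eps l1 X /\ approx_superjet D (fun y => - v y) eta r eps l2 Y &
    forall om, bil X om om + bil Y om om <= eps * dot om om].
Proof.
move=> N0 kappa1 uvM DL Dx m0 gap w0 e0.
have L0 : 0 <= L := le_trans (normr_ge0 _) (DL x (Ordinal N0) Dx).
have NL : 0 < 4 * N%:R * L + 1 by rewrite ltr_wpDl // mulr_ge0.
have [R0 R00 [R01 R0w R0m]] :
    exists2 R0 : R, 0 < R0 & [/\ R0 <= 1, R0 <= w / 2 & R0 <= m / (4 * N%:R * L + 1)].
  exists (Num.min 1 (Num.min (w / 2) (m / (4 * N%:R * L + 1)))).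
    by rewrite !lt_min ltr01 !divr_gt0.
  by rewrite !ge_min !lexx !orbT.
have [eps eps0 [eps_m eps_e]] : exists2 eps : R, 0 < eps & eps <= m /\ eps <= e.
  by exists (Num.min m e); rewrite ?lt_min ?m0 // !ge_min !lexx orbT.
have R0_in : 0 < R0 <= 1 by rewrite R00.
have D_nonempty : D !=set0 by exists x.
have [r [xi [eta [l1 [l2 [X [Y [[/andP[r0 rR0] Dxi Deta XT YT] large jet_u jet_v XY]]]]]]]] :=
  approximate_theorem_on_sums (lt_le_trans ltr01 kappa1) D_nonempty uvM DL N0 kappa1 R0_in eps0.
exists r, eps, xi, eta, l1, l2, X, Y; split=> //.
  split=> //; last by rewrite eps0.
  by rewrite r0; apply: le_lt_trans rR0 _; apply: le_lt_trans R0w _; lra.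
apply: le_trans (large x Dx).
have : R0 * (4 * N%:R * L + 1) <= m by rewrite -ler_pdivlMr.
rewrite mulrDr mulr1 mulrA (mulrC R0); lra.
Qed.

Lemma comparison_strict (eta : R) u v : bounded_set Om -> 0 < eta ->
  usc_on (closure Om) u -> lsc_on (closure Om) v ->
  strict_visc_sub eta u -> visc_super Om h v ->
  (forall x, (closure Om `\` Om) x -> u x <= v x) -> forall x, Om x -> u x <= v x.
Proof.
move=> bOm eta0 uu lv sub super bd x Ox; rewrite leNgt; apply/negP => gap.
have OmD : Om `<=` closure Om := @subset_closure _ Om; set D := closure Om in OmD uu lv bd *.
have Dx := OmD _ Ox; have D_nonempty : D !=set0 by exists x.
have cD : compact D := compact_closure_bounded bOm; have uv := lsc_onN lv.
have [[x1 _ u_max] [x2 _ v_min]] := (usc_max D_nonempty cD uu, usc_max D_nonempty cD uv).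
pose M := u x1 - v x2.
have uvM xi et : D xi -> D et -> u xi - v et <= M.
  by move=> /u_max u_le /v_min v_le; rewrite /M; lra.
have M0 : 0 <= M by have := uvM x x Dx Dx; lra.
have [L _ DL] := bounded_closure_coord bOm.
have m0 : 0 < (u x - v x) / 4 by rewrite divr_gt0 // subr_gt0.
have eta2 : 0 < eta / 2 by rewrite divr_gt0.
have eta18 : 0 < eta / 18 by rewrite divr_gt0.
have [w w0 loc] := exists_localization_radius cD OmD uu lv bd m0 eta2.
have kappa1 : 1 <= 1 + 6 * M / w ^+ 2 by rewrite lerDl divr_ge0 ?sqr_ge0 ?mulr_ge0.
have gap4 : 4 * ((u x - v x) / 4) <= u x - v x by rewrite mulrC divfK.
have [r [eps [xi [et [l1 [l2 [X [Y [[/andP[r0 rw] eps_in Dxi Det] [XT YT] pen]]]]]]]]] :=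
  exists_superjets_of_gap N_gt0 kappa1 uvM (fun y j => DL y j) Dx m0 gap4 w0 eta18.
move=> [jet_u jet_v] XY; have /andP[eps0 eps_eta] := eps_in.
have [et_xi m_le] := close_of_penalized w0 m0 M0 (uvM _ _ Dxi Det) pen.
have [y _ [c jumps near]] := loc xi et Dxi Det et_xi m_le.
apply: (superjets_contradiction sub super uu uv OmD jumps _ r0 eps0 eps_eta XT YT jet_u jet_v XY).
by move=> z [/le_lt_trans/(_ rw) z_near|/le_lt_trans/(_ rw) z_near]; apply: near; [left|right].
Qed.

Lemma comparison u v : bounded_set Om ->
  usc_on (closure Om) u -> lsc_on (closure Om) v -> visc_sub Om h u -> visc_super Om h v ->
  (forall x, (closure Om `\` Om) x -> u x <= v x) -> forall x, Om x -> u x <= v x.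
Proof.
move=> bOm uu lv sub super bd x Ox; apply/ler_addgt0Pr => m m0.
have [L L0 DL] := bounded_closure_coord bOm; pose K := (N%:R * L) ^+ 2.
have K0 : 0 <= K := sqr_ge0 _.
have dot_le y : closure Om y -> dot y y <= K.
  move=> Dy; rewrite -enorm_sqr ler_sqr ?nnegrE ?enorm_ge0 ?mulr_ge0 ?(ltW L0) //.
  by apply: enorm_le_coord => [|j]; [exact: ltW|exact: DL].
pose eta : R := m / (K + 1); have eta0 : 0 < eta by rewrite divr_gt0 // ltr_wpDl.
have perturb_le y : closure Om y -> perturb eta K u y <= u y.
  by move=> /dot_le yK; rewrite gerDl mulr_ge0_le0 ?subr_le0 // divr_ge0 ?ltW.
have := comparison_strict bOm eta0 (usc_on_perturb eta K uu) lv
  (strict_visc_sub_perturb sub) super.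
move=> /(_ (fun y bdy => le_trans (perturb_le y bdy.1) (bd y bdy)) x Ox).
rewrite /perturb => pert_le.
have : eta / 2 * K <= m.
  have : eta * (K + 1) = m by rewrite divfK // gt_eqF // ltr_wpDl.
  by have := mulr_ge0 (ltW eta0) K0; rewrite mulrDr mulr1; lra.
have : 0 <= eta / 2 * dot x x by rewrite mulr_ge0 ?dot_ge0 // divr_ge0 // ltW.
by lra.
Qed.

End PhaseInInterval.

End Comparison.

Theorem theorem6p18 (R : realType) (N : nat) (Om : set 'rV[R]_N)
  (h : 'rV[R]_N -> R) (k : nat) :
  open Om -> bounded_set Om -> connected Om ->
  {within Om, continuous h} ->
  (1 <= k <= N)%N ->
  (forall x, Om x ->
     (N%:R - 2 * k%:R) * pi / 2 < h x /\
     h x < (N%:R - 2 * (k%:R - 1)) * pi / 2) ->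
  [/\ proper_elliptic_map Om (ThetaG h),
      hausdorff_continuous Om (ThetaG h),
      (forall x, Om x ->
         boundaryS (ThetaG h x) `<=` [set p | SN p /\ Gop p.2 = h x]) &
      forall u v : 'rV[R]_N -> R,
        usc_on (closure Om) u -> lsc_on (closure Om) v ->
        visc_sub Om h u -> visc_super Om h v ->
        (forall x, (closure Om `\` Om) x -> u x <= v x) ->
        forall x, Om x -> u x <= v x].
Proof.
move=> open_Om bounded_Om _ cont_h k_range h_phase.
have N_gt0 : (0 < N)%N by case/andP: k_range => k_gt0; exact: leq_trans.
split.
- exact: ThetaG_proper k_range h_phase.
- exact: ThetaG_hausdorff N_gt0 open_Om cont_h h_phase.
- by move=> x _; exact: ThetaG_boundary.
- by move=> u v uu lv sub super; exact: (comparison N_gt0 open_Om cont_h h_phase).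
Qed.
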